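(* The topological graded ideal zeta function $\zeta^{\triangleleft_{\mathrm{gr}}}_{\mathfrak{f}_{3,3},\mathrm{top}}(s)$ satisfies $$\zeta^{\triangleleft_{\mathrm{gr}}}_{\mathfrak{f}_{3,3},\mathrm{top}}(s)=\frac{(33250s^{4}-81537s^{3}+66573s^{2}-20800s+1920)/56}{D_{\mathrm{top}}(s)},$$ where $D_{\mathrm{top}}(s)\in\mathbb{Z}[s]$ is $$s^{3}(s-1)^{4}(s-2)(3s-2)(4s-3)(5s-1)(5s-2)(7s-8)(2s-3)(3s-5)(5s-8)(11s-15)(13s-7).$$
   Context: For $c\ge 1$, $d\ge 2$, $\mathfrak{f}_{c,d}$ denotes the free nilpotent Lie ring of nilpotency class $c$ on $d$ generators, i.e. the quotient of the free $\mathbb{Z}$-Lie algebra on $d$ generators by the $(c+1)$-th term of its lower central series. For a commutative ring $R$ set $\mathfrak{f}_{c,d}(R)=\mathfrak{f}_{c,d}\otimes_{\mathbb{Z}}R$, an $R$-Lie algebra. For an $R$-Lie algebra $L$, nilpotent of class $c$ and free of finite rank over $R$, with lower central series $(\gamma_i(L))$, set $L^{(i)}=\gamma_i(L)/\gamma_{i+1}(L)$ and let $\mathrm{gr}L=\bigoplus_{i=1}^c L^{(i)}$ be the associated graded $R$-Lie algebra. An $R$-ideal $I$ of $\mathrm{gr}L$ is graded if $I=\bigoplus_{i=1}^c (I\cap L^{(i)})$. The graded ideal zeta function of $L$ is $\zeta^{\triangleleft_{\mathrm{gr}}}_L(s)=\sum_{I}|\mathrm{gr}L:I|^{-s}$,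 the sum over graded $R$-ideals $I$ of finite index in $\mathrm{gr}L$. There is a unique rational function $W\in\mathbb{Q}(X,Y)$ such that $\zeta^{\triangleleft_{\mathrm{gr}}}_{\mathfrak{f}_{3,3}(\mathfrak{o})}(s)=W(q,q^{-s})$ for all primes $p$ and all finite extensions $\mathfrak{o}$ of $\mathbb{Z}_p$ (rings of integers of finite extensions of $\mathbb{Q}_p$), where $q$ is the residue field cardinality of $\mathfrak{o}$ (this is another theorem of the source). The topological graded ideal zeta function $\zeta^{\triangleleft_{\mathrm{gr}}}_{\mathfrak{f}_{3,3},\mathrm{top}}(s)\in\mathbb{Q}(s)$ is the coefficient of $(q-1)^{-14}$ in the expansion of $W(q,q^{-s})$ in $q-1$, where $14=\mathrm{rk}_{\mathbb{Z}}\mathfrak{f}_{3,3}$; here $W(q,q^{-s})$ is viewed as a formal Laurent series in $q-1$ over $\mathbb{Q}(s)$ via $q=1+(q-1)$, $q^{-s}=\sum_{k\ge0}\binom{-s}{k}(q-1)^k$. *)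

(* Defs.v *)
From HB Require Import structures.
From mathcomp Require Import all_boot all_order all_algebra all_field generic_quotient ring_quotient.
From mathcomp Require Import finmap.
From mathcomp Require Import all_classical all_reals all_analysis.
From mathcomp Require Import complex.
From mathcomp Require summability.

Set Implicit Arguments.
Unset Strict Implicit.
Unset Printing Implicit Defensive.
Import Order.TTheory GRing.Theory Num.Theory numFieldNormedType.Exports.
Local Open Scope ring_scope.
Local Open Scope classical_set_scope.
Local Open Scope quotient_scope.

HB.mixin Record Lmodule_isLie (R : comNzRingType) L of GRing.Lmodule R L := {
  lie : L -> L -> L;
  lieDl : left_distributive lie +%R;
  lieDr : right_distributive lie +%R;
  lieZl : forall a x y, lie (a *: x) y = a *: lie x y;
  lieZr : forall a x y, lie x (a *: y) = a *: lie x y;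
  liexx : forall x, lie x x = 0;
  lieJ : forall x y z, lie x (lie y z) + lie y (lie z x) + lie z (lie x y) = 0
}.

#[short(type="lieAlgType")]
HB.structure Definition LieAlgebra (R : comNzRingType) :=
  { L of Lmodule_isLie R L & GRing.Lmodule R L }.

Section LieTheory.
Variables (R : comNzRingType) (L : lieAlgType R).
Implicit Types x y z : L.

Lemma lie0l x : lie 0 x = 0.
Proof. by have := lieZl 0 0 x; rewrite !scale0r. Qed.

Lemma lie0r x : lie x 0 = 0.
Proof. by have := lieZr 0 x 0; rewrite !scale0r. Qed.

Lemma lieNl x y : lie (- x) y = - lie x y.
Proof. by rewrite -scaleN1r lieZl scaleN1r. Qed.

Lemma lieNr x y : lie x (- y) = - lie x y.
Proof. by rewrite -scaleN1r lieZr scaleN1r. Qed.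

Lemma lieBl x y z : lie (x - y) z = lie x z - lie y z.
Proof. by rewrite lieDl lieNl. Qed.

Lemma lieBr x y z : lie x (y - z) = lie x y - lie x z.
Proof. by rewrite lieDr lieNr. Qed.

Lemma lieC x y : lie x y = - lie y x.
Proof.
have := liexx (x + y); rewrite lieDl !lieDr !liexx add0r addr0 => /eqP.
by rewrite addr_eq0 => /eqP.
Qed.

Lemma lieJ' x y z : lie x (lie y z) = lie (lie x y) z + lie y (lie x z).
Proof.
have /eqP := lieJ x y z; rewrite -addrA addr_eq0 => /eqP ->.
by rewrite (lieC z x) lieNr opprD opprK (lieC z) opprK addrC.
Qed.

End LieTheory.

(* The library's submodClosed is stated for semimodules, so it does not      *)
(* provide closure under opposites.                                          *)
Section SubmodZmod.
Variables (R : pzRingType) (V : lmodType R) (S : submodClosed V).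

Lemma submodN x : x \in S -> - x \in S.
Proof. by move=> Sx; rewrite -scaleN1r rpredZ. Qed.

Lemma submodB x y : x \in S -> y \in S -> x - y \in S.
Proof. by move=> Sx Sy; rewrite rpredD ?submodN. Qed.

Definition submod_zmod : {pred V} := S.

Fact submod_zmod_subproof : zmod_closed submod_zmod.
Proof. by split=> [|x y]; [apply: rpred0 | apply: submodB]. Qed.

HB.instance Definition _ := GRing.isZmodClosed.Build V submod_zmod
  submod_zmod_subproof.

End SubmodZmod.

HB.mixin Record isLieIdeal (R : comNzRingType) (L : lieAlgType R)
    (I : L -> bool) := {
  lie_ideal_subproof : forall x y : L, y \in (I : {pred L}) -> lie x y \in (I : {pred L})
}.

#[short(type="lieIdeal")]
HB.structure Definition LieIdeal (R : comNzRingType) (L : lieAlgType R) :=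
  { I of isLieIdeal R L I & @GRing.SubmodClosed R L I }.

Section LieIdealTheory.
Variables (R : comNzRingType) (L : lieAlgType R) (I : lieIdeal L).

Lemma rpred_lier x y : y \in I -> lie x y \in I.
Proof. exact: lie_ideal_subproof. Qed.

Lemma rpred_liel x y : x \in I -> lie x y \in I.
Proof. by move=> Ix; rewrite lieC submodN ?rpred_lier. Qed.

End LieIdealTheory.

Section LmodQuot.
Variables (R : comNzRingType) (V : lmodType R) (S : submodClosed V).

Definition lmod_quot : Type := Quotient.quot (submod_zmod S).

HB.instance Definition _ := GRing.Zmodule.on lmod_quot.
HB.instance Definition _ := EqQuotient.on lmod_quot.

Definition lmod_pi (x : V) : lmod_quot := \pi_(Quotient.quot (submod_zmod S)) x.
Definition lmod_repr (x : lmod_quot) : V := repr (x : Quotient.quot (submod_zmod S)).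

Lemma lmod_reprK : cancel lmod_repr lmod_pi.
Proof. by move=> x; rewrite /lmod_pi /lmod_repr reprK. Qed.

Lemma lmod_piP x y : reflect (lmod_pi x = lmod_pi y) (x - y \in S).
Proof.
rewrite -[_ \in S]/(x - y \in submod_zmod S) Quotient.idealrBE.
exact: eqP.
Qed.

Lemma lmod_piB x : lmod_repr (lmod_pi x) - x \in S.
Proof. by apply/lmod_piP; rewrite lmod_reprK. Qed.

Lemma lmod_piD x y : lmod_pi (x + y) = lmod_pi x + lmod_pi y.
Proof. exact: (raddfD \pi_(Quotient.quot (submod_zmod S))). Qed.

Definition lmod_quot_scale a (x : lmod_quot) := lmod_pi (a *: lmod_repr x).

Lemma lmod_quot_scaleE a x : lmod_quot_scale a (lmod_pi x) = lmod_pi (a *: x).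
Proof. by apply/lmod_piP; rewrite -scalerBr rpredZ ?lmod_piB. Qed.

Lemma lmod_quot_scaleA a b x :
  lmod_quot_scale a (lmod_quot_scale b x) = lmod_quot_scale (a * b) x.
Proof. by rewrite -[x]lmod_reprK !lmod_quot_scaleE scalerA. Qed.

Lemma lmod_quot_scale1 : left_id 1 lmod_quot_scale.
Proof. by move=> x; rewrite -[x]lmod_reprK !lmod_quot_scaleE scale1r. Qed.

Lemma lmod_quot_scaleDr : right_distributive lmod_quot_scale +%R.
Proof.
move=> a x y; rewrite -[x]lmod_reprK -[y]lmod_reprK -lmod_piD.
by rewrite !lmod_quot_scaleE -lmod_piD scalerDr.
Qed.

Lemma lmod_quot_scaleDl x : {morph lmod_quot_scale^~ x : a b / a + b}.
Proof.
by move=> a b; rewrite -[x]lmod_reprK !lmod_quot_scaleE -lmod_piD scalerDl.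
Qed.

HB.instance Definition _ := GRing.Zmodule_isLmodule.Build R lmod_quot
  lmod_quot_scaleA lmod_quot_scale1 lmod_quot_scaleDr lmod_quot_scaleDl.

Lemma lmod_piZ a x : lmod_pi (a *: x) = a *: lmod_pi x.
Proof. by rewrite -lmod_quot_scaleE. Qed.

Lemma lmod_pi_linear : linear lmod_pi.
Proof. by move=> a x y; rewrite lmod_piD lmod_piZ. Qed.

HB.instance Definition _ := GRing.isLinear.Build R V lmod_quot *:%R lmod_pi
  lmod_pi_linear.

End LmodQuot.

Section LieQuot.
Variables (R : comNzRingType) (L : lieAlgType R) (I : lieIdeal L).

Definition lie_quot : Type := lmod_quot I.
HB.instance Definition _ := GRing.Lmodule.on lie_quot.

Local Notation pi := (@lmod_pi R L I).
Local Notation rep := (@lmod_repr R L I).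

Definition lie_quot_lie (x y : lie_quot) : lie_quot := pi (lie (rep x) (rep y)).

Lemma lie_quot_lieE x y : lie_quot_lie (pi x) (pi y) = pi (lie x y).
Proof.
apply/lmod_piP; rewrite -(subrKA (lie (rep (pi x)) y)) -lieBr -lieBl.
by apply: rpredD; [apply: rpred_lier | apply: rpred_liel]; apply: lmod_piB.
Qed.

Fact lie_quot_lieDl : left_distributive lie_quot_lie +%R.
Proof.
move=> x y z; rewrite -[x]lmod_reprK -[y]lmod_reprK -[z]lmod_reprK.
by rewrite -lmod_piD !lie_quot_lieE -lmod_piD lieDl.
Qed.

Fact lie_quot_lieDr : right_distributive lie_quot_lie +%R.
Proof.
move=> x y z; rewrite -[x]lmod_reprK -[y]lmod_reprK -[z]lmod_reprK.
by rewrite -lmod_piD !lie_quot_lieE -lmod_piD lieDr.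
Qed.

Fact lie_quot_lieZl a x y : lie_quot_lie (a *: x) y = a *: lie_quot_lie x y.
Proof.
rewrite -[x]lmod_reprK -[y]lmod_reprK.
by rewrite -lmod_piZ !lie_quot_lieE -lmod_piZ lieZl.
Qed.

Fact lie_quot_lieZr a x y : lie_quot_lie x (a *: y) = a *: lie_quot_lie x y.
Proof.
rewrite -[x]lmod_reprK -[y]lmod_reprK.
by rewrite -lmod_piZ !lie_quot_lieE -lmod_piZ lieZr.
Qed.

Fact lie_quot_liexx x : lie_quot_lie x x = 0.
Proof. by rewrite -[x]lmod_reprK lie_quot_lieE liexx raddf0. Qed.

Fact lie_quot_lieJ x y z :
  lie_quot_lie x (lie_quot_lie y z) + lie_quot_lie y (lie_quot_lie z x)
  + lie_quot_lie z (lie_quot_lie x y) = 0.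
Proof.
rewrite -[x]lmod_reprK -[y]lmod_reprK -[z]lmod_reprK.
by rewrite !lie_quot_lieE -!lmod_piD lieJ raddf0.
Qed.

HB.instance Definition _ := Lmodule_isLie.Build R lie_quot
  lie_quot_lieDl lie_quot_lieDr lie_quot_lieZl lie_quot_lieZr
  lie_quot_liexx lie_quot_lieJ.

End LieQuot.

Section LowerCentralSeries.
Variables (R : comNzRingType) (L : lieAlgType R).

Definition submodule (A : set L) : Prop := GRing.submod_closed (mem A).

(* gamma n is the (n+1)-st term of the lower central series: gamma 0 = L and *)
(* gamma n.+1 is the submodule spanned by the brackets [x, y] with x in      *)
(* gamma n and y in L.                                                       *)
Fixpoint gamma (n : nat) : set L :=
  if n is m.+1 then
    smallest submodule [set z | exists2 x, gamma m x & exists y, z = lie x y]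
  else setT.

Definition lcs n : {pred L} := [pred x | x \in gamma n].

Lemma lcs_submod n : GRing.submod_closed (lcs n).
Proof.
case: n => [|n]; first by split=> [|a x y _ _]; rewrite !inE.
split=> [|a x y]; rewrite !inE /=.
  by move=> A [[A0 _] _]; rewrite inE in A0.
move=> gx gy A AP; have [[_ AS] _] := AP.
by have := AS a x y; rewrite !inE; apply; [apply: gx|apply: gy].
Qed.

HB.instance Definition _ n := GRing.isSubmodClosed.Build R L (lcs n) (lcs_submod n).

Lemma lcs_lieS n x y : x \in lcs n -> lie x y \in lcs n.+1.
Proof. by rewrite !inE => gx A [_]; apply; exists x => //; exists y. Qed.

Lemma lcsS_ind n (S : submodClosed L) :
  (forall x y, x \in lcs n -> lie x y \in S) -> {subset lcs n.+1 <= S}.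
Proof.
move=> HS x; rewrite inE /= => /(_ [set` S]); apply; split.
  split=> [|a u v]; rewrite !inE; first exact: rpred0.
  by move=> Su Sv; apply: rpredD => //; apply: rpredZ.
by move=> _ [u gu [v ->]] /=; apply: HS; rewrite inE.
Qed.

Lemma lcsS_sub n : {subset lcs n.+1 <= lcs n}.
Proof.
elim: n => [|n IHn]; first by move=> x _; rewrite inE.
by apply: lcsS_ind => x y /IHn; apply: lcs_lieS.
Qed.

Lemma lcs_ideal n (x y : L) : y \in lcs n -> lie x y \in lcs n.
Proof. by move=> gy; rewrite lieC; apply/submodN/lcsS_sub/lcs_lieS. Qed.

HB.instance Definition _ n := isLieIdeal.Build R L (lcs n) (@lcs_ideal n).

End LowerCentralSeries.
Arguments lcs {R} L n.

Section Graded.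
Variables (R : comNzRingType) (L : lieAlgType R).
Implicit Types x y z : L.

Lemma lcsS_ind_set n (A : set L) : submodule A ->
  (forall x y, x \in lcs L n -> A (lie x y)) ->
  forall x, x \in lcs L n.+1 -> A x.
Proof.
move=> sA HA x; rewrite inE /= => /(_ A); apply; split => //.
by move=> _ [u gu [v ->]] /=; apply: HA; rewrite inE.
Qed.

Lemma lcs_lie i j x y : x \in lcs L i -> y \in lcs L j ->
  lie x y \in lcs L (i + j).+1.
Proof.
elim: j i x y => [|j IHj] i x y Lx.
  by move=> _; rewrite addn0; apply: lcs_lieS.
pose A : set L :=
  [set y | forall i x, x \in lcs L i -> lie x y \in lcs L (i + j.+1).+1].
move=> Ly; suff: A y by apply.
apply: (@lcsS_ind_set j) Ly => [|u v Lu k w Lw].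
  split=> [|a u v]; rewrite !inE.
    by move=> k w _; rewrite lie0r rpred0.
  move=> Au Av k w Lw; rewrite lieDr lieZr; apply: rpredD; last exact: Av.
  by apply: rpredZ; apply: Au.
rewrite lieJ'; apply: rpredD; first by rewrite addnS; apply/lcs_lieS/IHj.
by rewrite lieC; apply: submodN; rewrite addnS -addSn; apply: IHj => //; apply: lcs_lieS.
Qed.

Record lcs_type n := LcsElt { lcs_val :> L; _ : lcs_val \in lcs L n }.
HB.instance Definition _ n := [isSub for @lcs_val n].
HB.instance Definition _ n := [Choice of lcs_type n by <:].
HB.instance Definition _ n := [SubChoice_isSubLmodule of lcs_type n by <:].

Definition lcs_next n : {pred lcs_type n} := [pred x | val x \in lcs L n.+1].

Fact lcs_next_submod n : GRing.submod_closed (@lcs_next n).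
Proof.
have E (x : lcs_type n) : (x \in @lcs_next n) = (val x \in lcs L n.+1) by [].
split=> [|a x y]; rewrite !E ?raddf0 ?rpred0 // linearP => Sx Sy.
by apply: rpredD => //; apply: rpredZ.
Qed.

HB.instance Definition _ n :=
  GRing.isSubmodClosed.Build R (lcs_type n) (@lcs_next n) (@lcs_next_submod n).

Definition grade n : Type := lmod_quot (@lcs_next n).
HB.instance Definition _ n := GRing.Lmodule.on (grade n).

(* The class of x in grade n = gamma n / gamma n.+1; it is the class of 0    *)
(* when x does not lie in gamma n.                                           *)
Definition grade_class n x : grade n := lmod_pi (@lcs_next n) (insubd 0 x).

Definition grade_repr n (a : grade n) : L := val (lmod_repr a).

Lemma grade_reprP n (a : grade n) : grade_repr a \in lcs L n.
Proof. exact: valP. Qed.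

Lemma grade_reprK n : cancel (@grade_repr n) (@grade_class n).
Proof. by move=> a; rewrite /grade_class /grade_repr valKd lmod_reprK. Qed.

Lemma grade_classP n x y : x \in lcs L n -> y \in lcs L n ->
  reflect (grade_class n x = grade_class n y) (x - y \in lcs L n.+1).
Proof.
move=> Lx Ly; rewrite /grade_class.
have -> : (x - y \in lcs L n.+1) =
   (insubd (0 : lcs_type n) x - insubd (0 : lcs_type n) y \in @lcs_next n).
  by rewrite [RHS]inE /= !insubdK.
exact: lmod_piP.
Qed.

Lemma grade_class_linear n a x y : x \in lcs L n -> y \in lcs L n ->
  grade_class n (a *: x + y) = a *: grade_class n x + grade_class n y.
Proof.
move=> Lx Ly; rewrite /grade_class -linearP; congr lmod_pi.
apply: val_inj; rewrite /= !insubdK //.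
by apply: rpredD => //; apply: rpredZ.
Qed.

(* The direct sum of the first c graded pieces, which is the whole associated *)
(* graded algebra when L is nilpotent of class at most c.                     *)
Definition gr (c : nat) : Type := forall i : 'I_c, grade i.

HB.instance Definition _ c := Choice.copy (gr c) (forall i : 'I_c, grade i).

Section GrLmod.
Variable c : nat.
Implicit Types f g h : gr c.

Definition gr_add f g : gr c := fun i => f i + g i.
Definition gr_opp f : gr c := fun i => - f i.
Definition gr_zero : gr c := fun=> 0.
Definition gr_scale a f : gr c := fun i => a *: f i.

Fact gr_addA : associative gr_add.
Proof. by move=> f g h; apply: functional_extensionality_dep => i; apply: addrA. Qed.
Fact gr_addC : commutative gr_add.
Proof. by move=> f g; apply: functional_extensionality_dep => i; apply: addrC. Qed.
Fact gr_add0 : left_id gr_zero gr_add.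
Proof. by move=> f; apply: functional_extensionality_dep => i; apply: add0r. Qed.
Fact gr_addN : left_inverse gr_zero gr_opp gr_add.
Proof. by move=> f; apply: functional_extensionality_dep => i; apply: addNr. Qed.

HB.instance Definition _ := GRing.isZmodule.Build (gr c)
  gr_addA gr_addC gr_add0 gr_addN.

Fact gr_scaleA a b f : gr_scale a (gr_scale b f) = gr_scale (a * b) f.
Proof. by apply: functional_extensionality_dep => i; apply: scalerA. Qed.
Fact gr_scale1 : left_id 1 gr_scale.
Proof. by move=> f; apply: functional_extensionality_dep => i; apply: scale1r. Qed.
Fact gr_scaleDr : right_distributive gr_scale +%R.
Proof. by move=> a f g; apply: functional_extensionality_dep => i; apply: scalerDr. Qed.
Fact gr_scaleDl f : {morph gr_scale^~ f : a b / a + b}.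
Proof. by move=> a b; apply: functional_extensionality_dep => i; apply: scalerDl. Qed.

HB.instance Definition _ := GRing.Zmodule_isLmodule.Build R (gr c)
  gr_scaleA gr_scale1 gr_scaleDr gr_scaleDl.

Lemma gr_sumE I (r : seq I) (P : pred I) (F : I -> gr c) i :
  (\sum_(k <- r | P k) F k) i = \sum_(k <- r | P k) F k i.
Proof. by elim/big_rec2: _ => [//|k u v _ <-]. Qed.

End GrLmod.

(* Because of the shift in gamma, the bracket maps grade i and grade j to    *)
(* grade (i + j).+1; see grade_lieE for its independence of representatives. *)
Definition grade_lie i j k (a : grade i) (b : grade j) : grade k :=
  grade_class k (lie (grade_repr a) (grade_repr b)).

Definition gr_lie c (f g : gr c) : gr c := fun k =>
  \sum_(i < c) \sum_(j < c | (i + j).+1 == k) grade_lie k (f i) (g j).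

Lemma grade_lieE i j k x y : (i + j).+1 = k ->
  x \in lcs L i -> y \in lcs L j ->
  grade_lie k (grade_class i x) (grade_class j y) = grade_class k (lie x y).
Proof.
move=> <- Lx Ly; rewrite /grade_lie.
set x' := grade_repr _; set y' := grade_repr _.
have Lx' : x' \in lcs L i := grade_reprP _.
have Ly' : y' \in lcs L j := grade_reprP _.
apply/grade_classP; [exact: lcs_lie|exact: lcs_lie|].
rewrite -(subrKA (lie x' y)) -lieBr -lieBl; apply: rpredD.
  rewrite -addnS; apply: lcs_lie => //.
  by apply/grade_classP; rewrite ?grade_reprK.
rewrite -addSn; apply: lcs_lie => //.
by apply/grade_classP; rewrite ?grade_reprK.
Qed.

Section GradeLieTheory.
Variables (i j k : nat).
Hypothesis ijk : (i + j).+1 = k.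

Lemma grade_lieP a (f f' : grade i) (g : grade j) :
  grade_lie k (a *: f + f') g = a *: grade_lie k f g + grade_lie k f' g.
Proof.
rewrite -[f]grade_reprK -[f']grade_reprK -[g]grade_reprK.
have Lf := grade_reprP f; have Lf' := grade_reprP f'; have Lg := grade_reprP g.
rewrite -(grade_class_linear a Lf Lf').
rewrite (grade_lieE ijk Lf Lg) (grade_lieE ijk Lf' Lg) (grade_lieE ijk _ Lg).
  by rewrite lieDl lieZl grade_class_linear // -ijk; apply: lcs_lie.
by apply: rpredD => //; apply: rpredZ.
Qed.

Lemma grade_liePr a (f : grade i) (g g' : grade j) :
  grade_lie k f (a *: g + g') = a *: grade_lie k f g + grade_lie k f g'.
Proof.
rewrite -[f]grade_reprK -[g]grade_reprK -[g']grade_reprK.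
have Lf := grade_reprP f; have Lg := grade_reprP g; have Lg' := grade_reprP g'.
rewrite -(grade_class_linear a Lg Lg').
rewrite (grade_lieE ijk Lf Lg) (grade_lieE ijk Lf Lg') (grade_lieE ijk Lf).
  by rewrite lieDr lieZr grade_class_linear // -ijk; apply: lcs_lie.
by apply: rpredD => //; apply: rpredZ.
Qed.

End GradeLieTheory.

Lemma grade_class0 n : grade_class n 0 = 0.
Proof.
have L0 : (0 : L) \in lcs L n by apply: rpred0.
have := grade_class_linear (-1) L0 L0.
by rewrite !scaleN1r oppr0 addr0 addNr.
Qed.

Lemma grade_lie0 i j k (f : grade i) : (i + j).+1 = k ->
  grade_lie k f (0 : grade j) = 0.
Proof.
move=> ijk; have := grade_liePr ijk (-1) f 0 0.
by rewrite !scaleN1r oppr0 addr0 addNr.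
Qed.

Lemma grade_lie_sum i j k (f : grade i) I (r : seq I) (P : pred I)
  (F : I -> grade j) : (i + j).+1 = k ->
  grade_lie k f (\sum_(l <- r | P l) F l) = \sum_(l <- r | P l) grade_lie k f (F l).
Proof.
move=> ijk; apply: (big_morph (grade_lie k f)); last exact: grade_lie0.
by move=> u v; have := grade_liePr ijk 1 f u v; rewrite !scale1r.
Qed.

Lemma grade_lieC i j k (f : grade i) (g : grade j) : (i + j).+1 = k ->
  grade_lie k f g = - grade_lie k g f.
Proof.
move=> ijk; rewrite /grade_lie lieC -scaleN1r -[-1 *: lie _ _]addr0.
rewrite grade_class_linear ?grade_class0 ?addr0 ?scaleN1r ?rpred0 //.
by rewrite -ijk addnC; apply: lcs_lie; apply: grade_reprP.
Qed.

Lemma grade_liexx i k (f : grade i) : grade_lie k f f = 0.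
Proof. by rewrite /grade_lie liexx grade_class0. Qed.

Section GrLie.
Variable c : nat.
Implicit Types f g h : gr c.

Fact gr_lieDl : left_distributive (@gr_lie c) +%R.
Proof.
move=> f g h; apply: functional_extensionality_dep => k.
rewrite /gr_lie -[RHS]big_split /=; apply: eq_bigr => i _.
rewrite -big_split; apply: eq_bigr => j /eqP ijk.
by have := grade_lieP ijk 1 (f i) (g i) (h j); rewrite !scale1r.
Qed.

Fact gr_lieDr : right_distributive (@gr_lie c) +%R.
Proof.
move=> f g h; apply: functional_extensionality_dep => k.
rewrite /gr_lie -[RHS]big_split /=; apply: eq_bigr => i _.
rewrite -big_split; apply: eq_bigr => j /eqP ijk.
by have := grade_liePr ijk 1 (f i) (g j) (h j); rewrite !scale1r.
Qed.

Fact gr_lieZl a f g : gr_lie (a *: f) g = a *: gr_lie f g.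
Proof.
apply: functional_extensionality_dep => k.
rewrite /gr_lie [RHS]scaler_sumr; apply: eq_bigr => i _.
rewrite scaler_sumr; apply: eq_bigr => j /eqP ijk.
have := grade_lieP ijk a (f i) 0 (g j); rewrite addr0 => ->.
by rewrite [grade_lie k 0 _]grade_lieC // grade_lie0 ?oppr0 ?addr0 // addnC.
Qed.

Fact gr_lieZr a f g : gr_lie f (a *: g) = a *: gr_lie f g.
Proof.
apply: functional_extensionality_dep => k.
rewrite /gr_lie [RHS]scaler_sumr; apply: eq_bigr => i _.
rewrite scaler_sumr; apply: eq_bigr => j /eqP ijk.
have := grade_liePr ijk a (f i) (g j) 0; rewrite addr0 => ->.
by rewrite grade_lie0 ?addr0.
Qed.

Fact gr_liexx f : gr_lie f f = 0.
Proof.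
apply: functional_extensionality_dep => k; rewrite /gr_lie /=.
rewrite pair_big_dep /=.
rewrite (bigID (fun p : 'I_c * 'I_c => (p.1 < p.2)%N)) /=.
rewrite [X in _ + X](bigID (fun p : 'I_c * 'I_c => p.1 == p.2)) /=.
rewrite [X in _ + (X + _)]big1 ?add0r; last first.
  by move=> [i j] /= /andP[_ /eqP ->]; apply: grade_liexx.
rewrite [X in _ + X](reindex_inj (inv_inj (@swap_pairK _ _))) /=.
apply/eqP; rewrite addr_eq0 -sumrN; apply/eqP.
apply: eq_big => [[i j]|[i j] /= /andP[/eqP ijk _]] /=; last first.
  exact: grade_lieC.
by rewrite [(j + i)%N]addnC -leqNgt -val_eqE /=; case: eqP => //= _; case: ltngtP.
Qed.

Fact gr_lie_assoc f g h k : gr_lie f (gr_lie g h) k =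
  \sum_(i < c) \sum_(j < c) \sum_(l < c | (i + j + l).+2 == k)
    grade_class k (lie (grade_repr (f i)) (lie (grade_repr (g j)) (grade_repr (h l)))).
Proof.
rewrite /gr_lie; apply: eq_bigr => i _.
under eq_bigr => m /eqP imk.
  rewrite grade_lie_sum //; under eq_bigr => j _.
    rewrite grade_lie_sum //; under eq_bigr => l /eqP jlm.
      rewrite [X in grade_lie k X _](_ : f i = grade_class i (grade_repr (f i))); last first.
        by rewrite grade_reprK.
      rewrite /grade_lie -/(grade_lie _ _ _) grade_lieE ?grade_reprP //; last first.
        by rewrite -jlm; apply: lcs_lie; apply: grade_reprP.
    over.
  over.
over.
rewrite /= exchange_big /=; apply: eq_bigr => j _.
rewrite (exchange_big_dep xpredT) //=.
rewrite [RHS]big_mkcond; apply: eq_bigr => l _.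
case: ifP => [/eqP ijl|ijl]; last first.
  rewrite big1 // => m /andP[/eqP imk /eqP jlm].
  by case/eqP: ijl; rewrite -imk -jlm addnS addnA.
have mc : ((j + l).+1 < c)%N.
  by rewrite (leq_ltn_trans _ (ltn_ord k)) // -ijl leqW // ltnS -addnA leq_addl.
rewrite (big_pred1 (Ordinal mc)) // => m.
rewrite /= -!val_eqE /= -ijl; apply/andP/eqP => [[_ /eqP <-] //|->].
by rewrite addnS addnA.
Qed.

Fact gr_lieJ f g h :
  gr_lie f (gr_lie g h) + gr_lie g (gr_lie h f) + gr_lie h (gr_lie f g) = 0.
Proof.
apply: functional_extensionality_dep => k.
rewrite -[LHS]/(gr_lie f (gr_lie g h) k + gr_lie g (gr_lie h f) k
                + gr_lie h (gr_lie f g) k) !gr_lie_assoc.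
have rot (A : 'I_c -> 'I_c -> 'I_c -> grade k) :
    \sum_i \sum_j \sum_l A i j l = \sum_i \sum_j \sum_l A j l i.
  by under eq_bigr do rewrite exchange_big /=; rewrite exchange_big.
under eq_bigr do under eq_bigr do rewrite big_mkcond /=.
under [X in _ + X + _]eq_bigr do under eq_bigr do rewrite big_mkcond /=.
under [X in _ + _ + X]eq_bigr do under eq_bigr do rewrite big_mkcond /=.
rewrite [X in _ + X + _]rot [X in _ + _ + X]rot [X in _ + _ + X]rot.
rewrite -!big_split big1 // => i _; rewrite -!big_split big1 // => j _.
rewrite -!big_split big1 // => l _ /=.
rewrite [(j + l + i)%N]addnC addnA [(l + i + j)%N]addnC addnA [(j + l + i)%N]addnC addnA.
case: eqP => [ijl|_]; last by rewrite !addr0.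
set x := grade_repr (f i); set y := grade_repr (g j); set z := grade_repr (h l).
have [Lx Ly] : x \in lcs L i /\ y \in lcs L j by split; apply: grade_reprP.
have Lz : z \in lcs L l by apply: grade_reprP.
have D u v : u \in lcs L k -> v \in lcs L k ->
    grade_class k u + grade_class k v = grade_class k (u + v).
  by move=> Lu Lv; rewrite -[u + v](congr1 (+%R^~ v) (scale1r u)) grade_class_linear ?scale1r.
have L1 : lie x (lie y z) \in lcs L k.
  by rewrite -ijl -addnA -addnS; apply: lcs_lie => //; apply: lcs_lie.
have L2 : lie y (lie z x) \in lcs L k.
  rewrite -ijl -addnA [(i + _)%N]addnC -addnA -addnS.
  by apply: lcs_lie => //; apply: lcs_lie.
have L3 : lie z (lie x y) \in lcs L k.
  by rewrite -ijl [(_ + l)%N]addnC -addnS; apply: lcs_lie => //; apply: lcs_lie.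
by rewrite !D ?rpredD // lieJ grade_class0.
Qed.

HB.instance Definition _ := Lmodule_isLie.Build R (gr c)
  gr_lieDl gr_lieDr gr_lieZl gr_lieZr gr_liexx gr_lieJ.

End GrLie.

End Graded.

Section FreeLie.
Variables (R : comNzRingType) (X : Type).

Inductive lie_term : Type :=
| LGen of X
| LZero
| LOpp of lie_term
| LAdd of lie_term & lie_term
| LScale of R & lie_term
| LLie of lie_term & lie_term.

Inductive lie_eqv : lie_term -> lie_term -> Prop :=
| lie_eqv_refl t : lie_eqv t t
| lie_eqv_sym t u : lie_eqv t u -> lie_eqv u t
| lie_eqv_trans t u v : lie_eqv t u -> lie_eqv u v -> lie_eqv t v
| lie_eqv_opp t t' : lie_eqv t t' -> lie_eqv (LOpp t) (LOpp t')
| lie_eqv_add t t' u u' : lie_eqv t t' -> lie_eqv u u' ->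
    lie_eqv (LAdd t u) (LAdd t' u')
| lie_eqv_scale a t t' : lie_eqv t t' -> lie_eqv (LScale a t) (LScale a t')
| lie_eqv_lie t t' u u' : lie_eqv t t' -> lie_eqv u u' ->
    lie_eqv (LLie t u) (LLie t' u')
| lie_eqv_addA t u v : lie_eqv (LAdd t (LAdd u v)) (LAdd (LAdd t u) v)
| lie_eqv_addC t u : lie_eqv (LAdd t u) (LAdd u t)
| lie_eqv_add0 t : lie_eqv (LAdd LZero t) t
| lie_eqv_addN t : lie_eqv (LAdd (LOpp t) t) LZero
| lie_eqv_scaleA a b t : lie_eqv (LScale a (LScale b t)) (LScale (a * b) t)
| lie_eqv_scale1 t : lie_eqv (LScale 1 t) t
| lie_eqv_scaleDr a t u :
    lie_eqv (LScale a (LAdd t u)) (LAdd (LScale a t) (LScale a u))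
| lie_eqv_scaleDl a b t :
    lie_eqv (LScale (a + b) t) (LAdd (LScale a t) (LScale b t))
| lie_eqv_lieDl t u v :
    lie_eqv (LLie (LAdd t u) v) (LAdd (LLie t v) (LLie u v))
| lie_eqv_lieDr t u v :
    lie_eqv (LLie t (LAdd u v)) (LAdd (LLie t u) (LLie t v))
| lie_eqv_lieZl a t u : lie_eqv (LLie (LScale a t) u) (LScale a (LLie t u))
| lie_eqv_lieZr a t u : lie_eqv (LLie t (LScale a u)) (LScale a (LLie t u))
| lie_eqv_liexx t : lie_eqv (LLie t t) LZero
| lie_eqv_lieJ t u v :
    lie_eqv (LAdd (LAdd (LLie t (LLie u v)) (LLie u (LLie v t)))
                  (LLie v (LLie t u))) LZero.

HB.instance Definition _ := gen_eqMixin lie_term.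
HB.instance Definition _ := gen_choiceMixin lie_term.

Definition lie_eqvb (t u : lie_term) : bool := `[< lie_eqv t u >].

Fact lie_eqvb_equiv : equiv_class_of lie_eqvb.
Proof.
split=> [t|t u|u t v].
- exact/asboolP/lie_eqv_refl.
- by apply/asboolP/asboolP => /lie_eqv_sym.
- by move=> /asboolP tu /asboolP uv; apply/asboolP/(lie_eqv_trans tu).
Qed.

Canonical lie_eqvb_equiv_rel := EquivRelPack lie_eqvb_equiv.

Definition free_lie : Type := {eq_quot lie_eqvb}.
HB.instance Definition _ := Choice.on free_lie.

Definition fl_pi (t : lie_term) : free_lie := \pi_({eq_quot lie_eqvb}) t.
Definition fl_repr (a : free_lie) : lie_term := repr (a : {eq_quot lie_eqvb}).

Lemma fl_reprK : cancel fl_repr fl_pi.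
Proof. by move=> a; rewrite /fl_pi /fl_repr reprK. Qed.

Lemma fl_piP t u : fl_pi t = fl_pi u <-> lie_eqv t u.
Proof.
by rewrite /fl_pi; split=> [/eqquotP/asboolP //|tu]; apply/eqquotP/asboolP.
Qed.

Lemma fl_reprP t : lie_eqv (fl_repr (fl_pi t)) t.
Proof. by apply/fl_piP; rewrite fl_reprK. Qed.

Definition fl_gen (x : X) : free_lie := fl_pi (LGen x).
Definition fl_zero : free_lie := fl_pi LZero.
Definition fl_opp (a : free_lie) := fl_pi (LOpp (fl_repr a)).
Definition fl_add (a b : free_lie) := fl_pi (LAdd (fl_repr a) (fl_repr b)).
Definition fl_scale c (a : free_lie) := fl_pi (LScale c (fl_repr a)).
Definition fl_lie (a b : free_lie) := fl_pi (LLie (fl_repr a) (fl_repr b)).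

Lemma fl_oppE t : fl_opp (fl_pi t) = fl_pi (LOpp t).
Proof. exact/fl_piP/lie_eqv_opp/fl_reprP. Qed.
Lemma fl_addE t u : fl_add (fl_pi t) (fl_pi u) = fl_pi (LAdd t u).
Proof. by apply/fl_piP/lie_eqv_add; apply: fl_reprP. Qed.
Lemma fl_scaleE c t : fl_scale c (fl_pi t) = fl_pi (LScale c t).
Proof. exact/fl_piP/lie_eqv_scale/fl_reprP. Qed.
Lemma fl_lieE t u : fl_lie (fl_pi t) (fl_pi u) = fl_pi (LLie t u).
Proof. by apply/fl_piP/lie_eqv_lie; apply: fl_reprP. Qed.

Lemma fl_ind (P : free_lie -> Prop) : (forall t, P (fl_pi t)) -> forall a, P a.
Proof. by move=> HP a; rewrite -[a]fl_reprK. Qed.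

Local Ltac fl_axiom c :=
  repeat (elim/fl_ind=> ?);
  rewrite ?(fl_oppE, fl_addE, fl_scaleE, fl_lieE); apply/fl_piP; apply: c.

Fact fl_addA : associative fl_add. Proof. fl_axiom lie_eqv_addA. Qed.
Fact fl_addC : commutative fl_add. Proof. fl_axiom lie_eqv_addC. Qed.
Fact fl_add0 : left_id fl_zero fl_add. Proof. fl_axiom lie_eqv_add0. Qed.
Fact fl_addN : left_inverse fl_zero fl_opp fl_add.
Proof. fl_axiom lie_eqv_addN. Qed.

HB.instance Definition _ := GRing.isZmodule.Build free_lie
  fl_addA fl_addC fl_add0 fl_addN.

Lemma fl_addE' t u : fl_pi t + fl_pi u = fl_pi (LAdd t u).
Proof. exact: fl_addE. Qed.

Fact fl_scaleA c d a : fl_scale c (fl_scale d a) = fl_scale (c * d) a.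
Proof. move: a; fl_axiom lie_eqv_scaleA. Qed.
Fact fl_scale1 : left_id 1 fl_scale.
Proof. fl_axiom lie_eqv_scale1. Qed.
Fact fl_scaleDr : right_distributive fl_scale +%R.
Proof.
move=> c; elim/fl_ind=> t; elim/fl_ind=> u; rewrite fl_addE' !fl_scaleE fl_addE'.
exact/fl_piP/lie_eqv_scaleDr.
Qed.
Fact fl_scaleDl a : {morph fl_scale^~ a : c d / c + d}.
Proof.
move=> c d; elim/fl_ind: a => t; rewrite !fl_scaleE fl_addE'.
exact/fl_piP/lie_eqv_scaleDl.
Qed.

HB.instance Definition _ := GRing.Zmodule_isLmodule.Build R free_lie
  fl_scaleA fl_scale1 fl_scaleDr fl_scaleDl.

Lemma fl_scaleE' c t : c *: fl_pi t = fl_pi (LScale c t).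
Proof. exact: fl_scaleE. Qed.

Local Ltac fl_axiom' c :=
  repeat (elim/fl_ind=> ?);
  rewrite ?(fl_addE', fl_scaleE', fl_lieE); apply/fl_piP; apply: c.

Fact fl_lieDl : left_distributive fl_lie +%R.
Proof. fl_axiom' lie_eqv_lieDl. Qed.
Fact fl_lieDr : right_distributive fl_lie +%R.
Proof. fl_axiom' lie_eqv_lieDr. Qed.
Fact fl_lieZl c a b : fl_lie (c *: a) b = c *: fl_lie a b.
Proof. move: a b; fl_axiom' lie_eqv_lieZl. Qed.
Fact fl_lieZr c a b : fl_lie a (c *: b) = c *: fl_lie a b.
Proof. move: a b; fl_axiom' lie_eqv_lieZr. Qed.
Fact fl_liexx a : fl_lie a a = 0.
Proof. move: a; fl_axiom' lie_eqv_liexx. Qed.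
Fact fl_lieJ a b c :
  fl_lie a (fl_lie b c) + fl_lie b (fl_lie c a) + fl_lie c (fl_lie a b) = 0.
Proof. move: a b c; fl_axiom' lie_eqv_lieJ. Qed.

HB.instance Definition _ := Lmodule_isLie.Build R free_lie
  fl_lieDl fl_lieDr fl_lieZl fl_lieZr fl_liexx fl_lieJ.

Section Lift.
Variables (L : lieAlgType R) (f : X -> L).

Fixpoint lie_eval (t : lie_term) : L :=
  match t with
  | LGen x => f x
  | LZero => 0
  | LOpp t => - lie_eval t
  | LAdd t u => lie_eval t + lie_eval u
  | LScale a t => a *: lie_eval t
  | LLie t u => lie (lie_eval t) (lie_eval u)
  end.

Lemma lie_eval_eqv t u : lie_eqv t u -> lie_eval t = lie_eval u.
Proof.
elim=> //=; do ?by move=> *; congruence.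
- by move=> *; rewrite addrA.
- by move=> *; rewrite addrC.
- by move=> *; rewrite add0r.
- by move=> *; rewrite addNr.
- by move=> *; rewrite scalerA.
- by move=> *; rewrite scale1r.
- by move=> *; rewrite scalerDr.
- by move=> *; rewrite scalerDl.
- by move=> *; rewrite lieDl.
- by move=> *; rewrite lieDr.
- by move=> *; rewrite lieZl.
- by move=> *; rewrite lieZr.
- by move=> *; rewrite liexx.
- by move=> *; rewrite lieJ.
Qed.

Definition fl_lift (a : free_lie) : L := lie_eval (fl_repr a).

Lemma fl_lift_pi t : fl_lift (fl_pi t) = lie_eval t.
Proof. exact/lie_eval_eqv/fl_reprP. Qed.

Lemma fl_lift_gen x : fl_lift (fl_gen x) = f x.
Proof. exact: fl_lift_pi. Qed.

Lemma fl_lift_linear : linear fl_lift.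
Proof.
move=> a; elim/fl_ind=> t; elim/fl_ind=> u.
rewrite -[a *: fl_pi t]/(fl_scale a (fl_pi t)) fl_scaleE.
by rewrite -[X in fl_lift X]/(fl_add _ _) fl_addE !fl_lift_pi.
Qed.

Lemma fl_lift_lie : {morph fl_lift : a b / lie a b}.
Proof.
elim/fl_ind=> t; elim/fl_ind=> u.
by rewrite -[X in fl_lift X]/(fl_lie _ _) fl_lieE !fl_lift_pi.
Qed.

End Lift.

End FreeLie.

Section Tensor.
Variables (L : lieAlgType int) (R : comNzRingType).

(* The list [:: (x1, r1); ...; (xn, rn)] denotes the sum of the pure tensors *)
(* xi (x) ri. Two such sums are equal in the tensor product over Z exactly   *)
(* when every biadditive map into an abelian group takes the same value on   *)
(* them.                                                                     *)
Definition formal_tensor : Type := seq (L * R).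
HB.instance Definition _ := Choice.on formal_tensor.

Definition biadditive (A : zmodType) (b : L -> R -> A) : Prop :=
  (forall r, {morph b^~ r : x y / x + y}) /\ (forall x, {morph b x : r s / r + s}).

Definition tensor_eval (A : zmodType) (b : L -> R -> A) (s : formal_tensor) : A :=
  \sum_(p <- s) b p.1 p.2.

Definition tensor_eqv (s t : formal_tensor) : Prop :=
  forall (A : zmodType) (b : L -> R -> A),
    biadditive b -> tensor_eval b s = tensor_eval b t.

Definition tensor_eqvb (s t : formal_tensor) : bool := `[< tensor_eqv s t >].

Fact tensor_eqvb_equiv : equiv_class_of tensor_eqvb.
Proof.
split=> [t|t u|u t v].
- by apply/asboolP.
- by apply/asboolP/asboolP => tu A b bA; rewrite tu.
- by move=> /asboolP tu /asboolP uv; apply/asboolP => A b bA; rewrite tu // uv.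
Qed.

Canonical tensor_eqvb_equiv_rel := EquivRelPack tensor_eqvb_equiv.

Definition tensor : Type := {eq_quot tensor_eqvb}.
HB.instance Definition _ := Choice.on tensor.

Definition ts_pi (s : formal_tensor) : tensor := \pi_({eq_quot tensor_eqvb}) s.
Definition ts_repr (a : tensor) : formal_tensor := repr (a : {eq_quot tensor_eqvb}).

Lemma ts_reprK : cancel ts_repr ts_pi.
Proof. by move=> a; rewrite /ts_pi /ts_repr reprK. Qed.

Lemma ts_piP s t : ts_pi s = ts_pi t <-> tensor_eqv s t.
Proof.
by rewrite /ts_pi; split=> [/eqquotP/asboolP //|tu]; apply/eqquotP/asboolP.
Qed.

Lemma ts_reprP t : tensor_eqv (ts_repr (ts_pi t)) t.
Proof. by apply/ts_piP; rewrite ts_reprK. Qed.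

Lemma ts_ind (P : tensor -> Prop) : (forall t, P (ts_pi t)) -> forall a, P a.
Proof. by move=> HP a; rewrite -[a]ts_reprK. Qed.

Definition pure_tensor (x : L) (r : R) : tensor := ts_pi [:: (x, r)].

Definition ft_opp (s : formal_tensor) : formal_tensor :=
  [seq (- p.1, p.2) | p <- s].
Definition ft_scale (a : R) (s : formal_tensor) : formal_tensor :=
  [seq (p.1, a * p.2) | p <- s].
Definition ft_lie (s t : formal_tensor) : formal_tensor :=
  [seq (lie p.1 q.1, p.2 * q.2) | p <- s, q <- t].

Definition ts_add (a b : tensor) : tensor := ts_pi (ts_repr a ++ ts_repr b).
Definition ts_opp (a : tensor) : tensor := ts_pi (ft_opp (ts_repr a)).
Definition ts_scale c (a : tensor) : tensor := ts_pi (ft_scale c (ts_repr a)).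
Definition ts_lie (a b : tensor) : tensor :=
  ts_pi (ft_lie (ts_repr a) (ts_repr b)).

Section Eval.
Variables (A : zmodType) (b : L -> R -> A).
Hypothesis bA : biadditive b.

Lemma biadd0l r : b 0 r = 0.
Proof. by have /eqP := bA.1 r 0 0; rewrite addr0 -subr_eq0 opprD addNKr oppr_eq0 => /eqP. Qed.

Lemma biadd0r x : b x 0 = 0.
Proof. by have /eqP := bA.2 x 0 0; rewrite addr0 -subr_eq0 opprD addNKr oppr_eq0 => /eqP. Qed.

Lemma biaddNl x r : b (- x) r = - b x r.
Proof. by apply/eqP; rewrite -addr_eq0 -bA.1 addNr biadd0l. Qed.

Lemma tensor_eval_cat s t : tensor_eval b (s ++ t) = tensor_eval b s + tensor_eval b t.
Proof. exact: big_cat. Qed.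

Lemma tensor_eval_opp s : tensor_eval b (ft_opp s) = - tensor_eval b s.
Proof.
rewrite /tensor_eval big_map -sumrN; apply: eq_bigr => p _.
exact: biaddNl.
Qed.

Lemma tensor_eval_scale c s :
  tensor_eval b (ft_scale c s) = tensor_eval (fun x r => b x (c * r)) s.
Proof. by rewrite /tensor_eval big_map. Qed.

Lemma tensor_eval_lie s t :
  tensor_eval b (ft_lie s t) =
  \sum_(p <- s) \sum_(q <- t) b (lie p.1 q.1) (p.2 * q.2).
Proof. by rewrite /tensor_eval big_allpairs_dep. Qed.

Lemma biadditive_scale c : biadditive (fun x r => b x (c * r)).
Proof. by split=> [r x y|x r s]; rewrite ?bA.1 // mulrDr bA.2. Qed.

Lemma biadditive_liel t :
  biadditive (fun x r => \sum_(q <- t) b (lie x q.1) (r * q.2)).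
Proof.
split=> [r x y|x r s]; rewrite -big_split; apply: eq_bigr => q _.
  by rewrite lieDl bA.1.
by rewrite mulrDl bA.2.
Qed.

Lemma biadditive_lier s :
  biadditive (fun y r => \sum_(p <- s) b (lie p.1 y) (p.2 * r)).
Proof.
split=> [r x y|x r r']; rewrite -big_split; apply: eq_bigr => q _.
  by rewrite lieDr bA.1.
by rewrite mulrDr bA.2.
Qed.

End Eval.

Lemma ts_addE s t : ts_add (ts_pi s) (ts_pi t) = ts_pi (s ++ t).
Proof.
by apply/ts_piP => A b bA; rewrite !tensor_eval_cat !(ts_reprP _ bA).
Qed.
Lemma ts_oppE s : ts_opp (ts_pi s) = ts_pi (ft_opp s).
Proof. by apply/ts_piP => A b bA; rewrite !tensor_eval_opp // (ts_reprP _ bA). Qed.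
Lemma ts_scaleE c s : ts_scale c (ts_pi s) = ts_pi (ft_scale c s).
Proof.
apply/ts_piP => A b bA; rewrite !tensor_eval_scale.
exact: ts_reprP (biadditive_scale bA c).
Qed.
Lemma ts_lieE s t : ts_lie (ts_pi s) (ts_pi t) = ts_pi (ft_lie s t).
Proof.
apply/ts_piP => A b bA; rewrite !tensor_eval_lie.
rewrite [LHS](ts_reprP _ (biadditive_liel bA (ts_repr (ts_pi t)))) /tensor_eval /=.
rewrite exchange_big [RHS]exchange_big.
exact: ts_reprP (biadditive_lier bA s).
Qed.

Local Ltac ts_start :=
  repeat (elim/ts_ind=> ?);
  rewrite ?(ts_addE, ts_oppE, ts_scaleE, ts_lieE); apply/ts_piP => A b bA.

Fact ts_addA : associative ts_add. Proof. by ts_start; rewrite catA. Qed.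
Fact ts_addC : commutative ts_add.
Proof. by ts_start; rewrite !tensor_eval_cat addrC. Qed.
Fact ts_add0 : left_id (ts_pi [::]) ts_add. Proof. by ts_start. Qed.
Fact ts_addN : left_inverse (ts_pi [::]) ts_opp ts_add.
Proof.
ts_start; rewrite tensor_eval_cat tensor_eval_opp // addNr.
by rewrite /tensor_eval big_nil.
Qed.

HB.instance Definition _ := GRing.isZmodule.Build tensor
  ts_addA ts_addC ts_add0 ts_addN.

Lemma ts_addE' s t : ts_pi s + ts_pi t = ts_pi (s ++ t).
Proof. exact: ts_addE. Qed.

Fact ts_scaleA c d a : ts_scale c (ts_scale d a) = ts_scale (c * d) a.
Proof.
move: a; ts_start; rewrite !tensor_eval_scale.
by apply: eq_bigr => p _; rewrite mulrA.
Qed.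
Fact ts_scale1 : left_id 1 ts_scale.
Proof.
ts_start; rewrite tensor_eval_scale.
by apply: eq_bigr => p _; rewrite mul1r.
Qed.
Fact ts_scaleDr : right_distributive ts_scale +%R.
Proof.
move=> c; elim/ts_ind=> s; elim/ts_ind=> t.
by rewrite ts_addE' !ts_scaleE ts_addE' /ft_scale map_cat.
Qed.
Fact ts_scaleDl a : {morph ts_scale^~ a : c d / c + d}.
Proof.
move=> c d; elim/ts_ind: a => s; rewrite !ts_scaleE ts_addE'.
apply/ts_piP => A b bA; rewrite tensor_eval_cat !tensor_eval_scale -big_split.
by apply: eq_bigr => p _; rewrite mulrDl bA.2.
Qed.

HB.instance Definition _ := GRing.Zmodule_isLmodule.Build R tensor
  ts_scaleA ts_scale1 ts_scaleDr ts_scaleDl.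

Fact ts_lieDl : left_distributive ts_lie +%R.
Proof.
elim/ts_ind=> s; elim/ts_ind=> t; elim/ts_ind=> u.
rewrite ts_addE' !ts_lieE ts_addE'; apply/ts_piP => A b bA.
by rewrite tensor_eval_cat !tensor_eval_lie big_cat.
Qed.
Fact ts_lieDr : right_distributive ts_lie +%R.
Proof.
elim/ts_ind=> s; elim/ts_ind=> t; elim/ts_ind=> u.
rewrite ts_addE' !ts_lieE ts_addE'; apply/ts_piP => A b bA.
rewrite tensor_eval_cat !tensor_eval_lie -big_split; apply: eq_bigr => p _.
by rewrite big_cat.
Qed.
Fact ts_lieZl c x y : ts_lie (c *: x) y = c *: ts_lie x y.
Proof.
elim/ts_ind: x => s; elim/ts_ind: y => t.
rewrite -[c *: ts_pi s]/(ts_scale c _) -[RHS]/(ts_scale c _).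
rewrite !(ts_lieE, ts_scaleE); apply/ts_piP => A b bA.
rewrite tensor_eval_scale tensor_eval_lie /tensor_eval big_allpairs_dep big_map.
by apply: eq_bigr => p _; apply: eq_bigr => q _ /=; rewrite mulrA.
Qed.
Fact ts_lieZr c x y : ts_lie x (c *: y) = c *: ts_lie x y.
Proof.
elim/ts_ind: x => s; elim/ts_ind: y => t.
rewrite -[c *: ts_pi t]/(ts_scale c _) -[RHS]/(ts_scale c _).
rewrite !(ts_lieE, ts_scaleE); apply/ts_piP => A b bA.
rewrite tensor_eval_scale tensor_eval_lie /tensor_eval big_allpairs_dep.
apply: eq_bigr => p _; rewrite big_map.
by apply: eq_bigr => q _ /=; rewrite mulrCA.
Qed.
Fact ts_liexx x : ts_lie x x = 0.
Proof.
elim/ts_ind: x => s; rewrite ts_lieE; apply/ts_piP => A b bA.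
rewrite tensor_eval_lie [RHS]big_nil.
elim: s => [|p s IHs]; first by rewrite big_nil.
rewrite big_cons big_cons liexx biadd0l // add0r.
under [X in _ + X]eq_bigr do rewrite big_cons.
rewrite big_split /= IHs addr0 -big_split big1 //= => q _.
by rewrite lieC biaddNl // mulrC addNr.
Qed.
Fact ts_lieJ x y z :
  ts_lie x (ts_lie y z) + ts_lie y (ts_lie z x) + ts_lie z (ts_lie x y) = 0.
Proof.
elim/ts_ind: x => s; elim/ts_ind: y => t; elim/ts_ind: z => u.
rewrite !ts_lieE !ts_addE'; apply/ts_piP => A b bA.
have E (v w k : formal_tensor) : tensor_eval b (ft_lie v (ft_lie w k)) =
    \sum_(p <- v) \sum_(q <- w) \sum_(r <- k)
       b (lie p.1 (lie q.1 r.1)) (p.2 * (q.2 * r.2)).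
  by rewrite tensor_eval_lie; apply: eq_bigr => p _; rewrite big_allpairs_dep.
have rot (v w k : formal_tensor) (F : L * R -> L * R -> L * R -> A) :
    \sum_(p <- v) \sum_(q <- w) \sum_(r <- k) F p q r =
    \sum_(q <- w) \sum_(r <- k) \sum_(p <- v) F p q r.
  by rewrite exchange_big; apply: eq_bigr => q _; rewrite exchange_big.
rewrite !tensor_eval_cat !E [RHS]big_nil (rot u s t) (rot t u s) (rot u s t).
rewrite -!big_split big1 // => p _; rewrite -!big_split big1 // => q _.
rewrite -!big_split big1 // => r _ /=.
rewrite [q.2 * (r.2 * p.2)]mulrA [r.2 * (p.2 * q.2)]mulrC.
rewrite -[p.2 * q.2 * r.2]mulrA [q.2 * r.2 * p.2]mulrC.
by rewrite -!bA.1 lieJ biadd0l.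
Qed.

HB.instance Definition _ := Lmodule_isLie.Build R tensor
  ts_lieDl ts_lieDr ts_lieZl ts_lieZr ts_liexx ts_lieJ.

End Tensor.

(* Because of the shift in gamma, lcs _ c is the (c+1)-st term of the lower  *)
(* central series.                                                           *)
Definition free_nilpotent (c d : nat) : lieAlgType int :=
  lie_quot (lcs (free_lie int 'I_d) c).

Definition free_nilpotent_over (c d : nat) (R : comNzRingType) : lieAlgType R :=
  tensor (free_nilpotent c d) R.

Section ClassicalUnits.
Variable A : comNzRingType.

Definition cl_unit : pred A := fun x => `[< exists y, y * x = 1 >].
Definition cl_inv (x : A) : A :=
  if pselect (exists y, y * x = 1) is left e then projT1 (cid e) else x.

Fact cl_mulVr : {in cl_unit, left_inverse 1 cl_inv *%R}.
Proof.
move=> x /asboolP ex; rewrite /cl_inv; case: pselect => // e.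
exact: projT2 (cid e).
Qed.
Fact cl_unitPl x y : y * x = 1 -> cl_unit x.
Proof. by move=> yx; apply/asboolP; exists y. Qed.
Fact cl_invr_out : {in [predC cl_unit], cl_inv =1 id}.
Proof. by move=> x /asboolPn nx; rewrite /cl_inv; case: pselect. Qed.

End ClassicalUnits.

Definition padic_coherent (p : nat) (x : forall n, 'Z_(p ^ n.+1)) : Prop :=
  forall n, (x n.+1 : nat)%:R = x n.

(* Z_p as the inverse limit of the rings Z / p^(n+1). The argument p_pr is   *)
(* only there for the inference of the ring structure.                       *)
Record padic_int (p : nat) (p_pr : prime p) := PadicInt {
  padic_val :> forall n, 'Z_(p ^ n.+1);
  _ : `[< padic_coherent padic_val >]
}.

Section Padic.
Variables (p : nat) (p_pr : prime p).

Local Notation Zmod n := 'Z_(p ^ n.+1).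
Local Notation padic_int := (padic_int p_pr).

Fact pexp_gt1 n : (1 < p ^ n.+1)%N.
Proof. by rewrite -(exp1n n.+1) ltn_exp2r // prime_gt1. Qed.

HB.instance Definition _ := [isSub for @padic_val p p_pr].
HB.instance Definition _ := [Choice of padic_int by <:].

Lemma padic_valP (x : padic_int) n : (x n.+1 : nat)%:R = x n.
Proof. by case: x => x /= /asboolP; apply. Qed.

Lemma padicP (x y : padic_int) : (forall n, x n = y n) -> x = y.
Proof.
move=> xy; apply: val_inj; apply: functional_extensionality_dep => n.
exact: xy.
Qed.

Lemma natr_Zmod n k : (k%:R : Zmod n) = (k %% p ^ n.+1)%N :> nat.
Proof. by rewrite val_Zp_nat ?pexp_gt1. Qed.

Lemma natr_red n k : ((k%:R : Zmod n.+1) : nat)%:R = k%:R :> Zmod n.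
Proof.
by apply: val_inj; rewrite /= !natr_Zmod modn_dvdm // [(p ^ n.+2)%N]expnS dvdn_mull.
Qed.

Lemma ZmodE n (a : Zmod n) : a = (a : nat)%:R.
Proof. by rewrite natr_Zp. Qed.

Fact padic0_subproof : @padic_coherent p (fun=> 0).
Proof. by move=> n; apply: (natr_red n 0). Qed.
Fact padic1_subproof : @padic_coherent p (fun=> 1).
Proof. by move=> n; apply: (natr_red n 1). Qed.
Fact padicD_subproof (x y : padic_int) : @padic_coherent p (fun n => x n + y n).
Proof.
move=> n; rewrite [x _]ZmodE [y _]ZmodE -natrD natr_red natrD.
by rewrite !padic_valP.
Qed.
Fact padicM_subproof (x y : padic_int) : @padic_coherent p (fun n => x n * y n).
Proof.
move=> n; rewrite [x _]ZmodE [y _]ZmodE -natrM natr_red natrM.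
by rewrite !padic_valP.
Qed.
Fact padicN_subproof (x : padic_int) : @padic_coherent p (fun n => - x n).
Proof.
move=> n; apply/eqP; rewrite -addr_eq0; apply/eqP.
rewrite -[x n]padic_valP -natrD.
rewrite -(natr_red _ (_ + _)) natrD -!ZmodE addNr.
exact: padic0_subproof.
Qed.

Definition padic_mk (x : forall n, Zmod n) (h : @padic_coherent p x) : padic_int :=
  @PadicInt p p_pr x (asboolT h).

Definition padic_zero := padic_mk padic0_subproof.
Definition padic_one := padic_mk padic1_subproof.
Definition padic_add (x y : padic_int) := padic_mk (padicD_subproof x y).
Definition padic_mul (x y : padic_int) := padic_mk (padicM_subproof x y).
Definition padic_opp (x : padic_int) := padic_mk (padicN_subproof x).

Fact padic_addA : associative padic_add.
Proof. by move=> x y z; apply: padicP => n; apply: addrA. Qed.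
Fact padic_addC : commutative padic_add.
Proof. by move=> x y; apply: padicP => n; apply: addrC. Qed.
Fact padic_add0 : left_id padic_zero padic_add.
Proof. by move=> x; apply: padicP => n; apply: add0r. Qed.
Fact padic_addN : left_inverse padic_zero padic_opp padic_add.
Proof. by move=> x; apply: padicP => n; apply: addNr. Qed.

HB.instance Definition _ := GRing.isZmodule.Build padic_int
  padic_addA padic_addC padic_add0 padic_addN.

Fact padic_mulA : associative padic_mul.
Proof. by move=> x y z; apply: padicP => n; apply: mulrA. Qed.
Fact padic_mulC : commutative padic_mul.
Proof. by move=> x y; apply: padicP => n; apply: mulrC. Qed.
Fact padic_mul1 : left_id padic_one padic_mul.
Proof. by move=> x; apply: padicP => n; apply: mul1r. Qed.
Fact padic_mulDl : left_distributive padic_mul +%R.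
Proof. by move=> x y z; apply: padicP => n; apply: mulrDl. Qed.
Fact padic_oneN0 : padic_one != 0.
Proof.
apply/eqP => /(congr1 (fun x : padic_int => x 0%N)) /eqP.
by rewrite -[_ == _]/((1 : Zmod 0) == 0) oner_eq0.
Qed.

HB.instance Definition _ := GRing.Zmodule_isComNzRing.Build padic_int
  padic_mulA padic_mulC padic_mul1 padic_mulDl padic_oneN0.

HB.instance Definition _ := GRing.ComNzRing_hasMulInverse.Build padic_int
  (@cl_mulVr padic_int) (@cl_unitPl padic_int) (@cl_invr_out padic_int).

Lemma padic_mod (x : padic_int) n m : (x (m + n)%N %% p ^ n.+1 = x n)%N.
Proof.
elim: m => [|m IHm].
  rewrite add0n modn_small //.
  by have := ltn_ord (x n); rewrite [X in (_ < X)%N]Zp_cast // pexp_gt1.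
rewrite -IHm addSn -[in RHS]padic_valP natr_Zmod modn_dvdm //.
by rewrite dvdn_exp2l // ltnS leq_addl.
Qed.

Lemma padic_mod_le (x : padic_int) n m :
  (n <= m)%N -> (x m %% p ^ n.+1 = x n)%N.
Proof. by move=> nm; have := padic_mod x n (m - n); rewrite subnK. Qed.

Lemma padic_neq0 (x : padic_int) : x != 0 -> exists n, (x n != 0%N :> nat).
Proof.
move=> /eqP x0; apply: contrapT => /forallNP xn.
apply: x0; apply: padicP => n; apply: val_inj.
by have /negP := xn n; rewrite negbK => /eqP.
Qed.

Fact padic_integral (x y : padic_int) : x * y = 0 -> (x == 0) || (y == 0).
Proof.
move=> xy0; apply: contrapT => /negP; rewrite negb_or => /andP[].
move=> /padic_neq0[n xn] /padic_neq0[m ym].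
pose N := (n + m).+1; pose a : nat := x N; pose b : nat := y N.
have pa : ~~ (p ^ n.+1 %| a)%N.
  by rewrite /dvdn padic_mod_le // leqW // leq_addr.
have pb : ~~ (p ^ m.+1 %| b)%N.
  by rewrite /dvdn padic_mod_le // leqW // leq_addl.
have a0 : (0 < a)%N by case: (posnP a) pa => // ->; rewrite dvdn0.
have b0 : (0 < b)%N by case: (posnP b) pb => // ->; rewrite dvdn0.
have : (p ^ N.+1 %| a * b)%N.
  rewrite /dvdn -natr_Zmod natrM -!ZmodE.
  by rewrite -[x N * y N]/((x * y) N) xy0.
rewrite !pfactor_dvdn ?muln_gt0 ?a0 // in pa pb *.
rewrite -!leqNgt in pa pb.
rewrite lognM // leqNgt ltnS /N; apply/negP; rewrite negbK.
by rewrite (leq_trans (leq_add pa pb)).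
Qed.

HB.instance Definition _ := GRing.ComUnitRing_isIntegral.Build padic_int
  padic_integral.

Definition padic : Type := {fraction padic_int}.
HB.instance Definition _ := GRing.Field.on padic.

End Padic.

Section Index.
Variable A : zmodType.
Implicit Type I : set A.

Definition cosets I : set (set A) := range (fun x => [set x + y | y in I]).
Definition finite_index I : Prop := finite_set (cosets I).
Definition coset_index I : nat := #|` fset_set (cosets I)|%fset.

End Index.

Section RingOfIntegers.
Variables (p : nat) (p_pr : prime p) (K : fieldExtType (padic p_pr)).

Definition padic_int_to : padic_int p_pr -> K :=
  in_alg K \o (@FracField.tofrac (padic_int p_pr)).
HB.instance Definition _ := GRing.RMorphism.on padic_int_to.

Definition integers : {pred K} := fun x => `[< integralOver padic_int_to x >].

Fact integers_subring : subring_closed integers.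
Proof.
split=> [|x y|x y]; first exact/asboolP/integral1.
  by move=> /asboolP ? /asboolP ?; apply/asboolP/integral_sub.
by move=> /asboolP ? /asboolP ?; apply/asboolP/integral_mul.
Qed.
HB.instance Definition _ := GRing.isSubringClosed.Build K integers integers_subring.

Record ring_of_integers :=
  RingOfIntegers { ring_of_integers_val :> K; _ : ring_of_integers_val \in integers }.
HB.instance Definition _ := [isSub for ring_of_integers_val].
HB.instance Definition _ := [Choice of ring_of_integers by <:].
HB.instance Definition _ := [SubChoice_isSubComNzRing of ring_of_integers by <:].

End RingOfIntegers.

(* For a local ring A, whose maximal ideal consists of the nonunits. *)
Definition residue_card (A : comNzRingType) : nat :=
  coset_index [set x : A | ~ exists y, x * y = 1].

Section GradedIdeals.
Variables (R : comNzRingType) (L : lieAlgType R) (c : nat).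

Definition homogeneous (i : 'I_c) : set (gr L c) :=
  [set f | forall j, j != i -> f j = 0].

Definition gr_ideal (I : set (gr L c)) : Prop :=
  submodule I /\ forall f g, I g -> I (lie f g).

Definition gr_graded (I : set (gr L c)) : Prop :=
  I = [set \sum_(i < c) h i | h in
         [set h : 'I_c -> gr L c | forall i, (I `&` homogeneous i) (h i)]].

Record graded_ideal := GradedIdeal {
  graded_ideal_set :> set (gr L c);
  _ : `[< [/\ gr_ideal graded_ideal_set, gr_graded graded_ideal_set
            & finite_index graded_ideal_set] >]
}.
HB.instance Definition _ := [isSub for graded_ideal_set].
HB.instance Definition _ := [Choice of graded_ideal by <:].

End GradedIdeals.

Section ComplexPowers.
Variable R : realType.

Definition cexp (z : R[i]) : R[i] :=
  (expR (complex.Re z) * cos (complex.Im z)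
   +i* (expR (complex.Re z) * sin (complex.Im z)))%C.

Definition natpow (n : nat) (s : R[i]) : R[i] := cexp (s * (ln n%:R)%:C%C).

(* The family |gr L : I|^{-s}, indexed by the graded ideals I of finite      *)
(* index of gr L, is summable with sum z.                                    *)
Definition graded_ideal_zeta (A : comNzRingType) (L : lieAlgType A) (c : nat)
    (s z : R[i]) : Prop :=
  summability.partial_sum
    (fun I : graded_ideal L c => natpow (coset_index I) (- s) : R[i]^o)
    @ summability.totally --> (z : R[i]^o).

End ComplexPowers.

(* Elements of {fraction {poly {poly rat}}} are rational functions of X and  *)
(* Y, where X is the outer and Y is the inner variable.                      *)
Definition bieval (K : fieldType) (P : {poly {poly rat}}) (x y : K) : K :=
  (map_poly (map_poly (ratr : rat -> K)) P).[x%:P].[y].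

(* W is defined at (x, y), with value z. *)
Definition rat_value (K : fieldType) (W : {fraction {poly {poly rat}}})
    (x y z : K) : Prop :=
  exists P Q : {poly {poly rat}},
    [/\ W = FracField.tofrac P / FracField.tofrac Q,
        bieval Q x y != 0 & z = bieval P x y / bieval Q x y].

Section PowerSeries.
Variable F : fieldType.

Record fps := FPS { fps_coef :> nat -> F }.
HB.instance Definition _ := [isNew for fps_coef].
HB.instance Definition _ := [Choice of fps by <:].
Implicit Types f g h : fps.

Lemma fpsP f g : f =1 g -> f = g.
Proof. by move=> fg; apply: val_inj; apply: funext. Qed.

Definition fps_zero := FPS (fun=> 0).
Definition fps_one := FPS (fun n => (n == 0%N)%:R).
Definition fps_opp f := FPS (fun n => - f n).
Definition fps_add f g := FPS (fun n => f n + g n).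
Definition fps_mul f g := FPS (fun n => \sum_(i < n.+1) f i * g (n - i)%N).

Fact fps_addA : associative fps_add.
Proof. by move=> f g h; apply: fpsP => n; apply: addrA. Qed.
Fact fps_addC : commutative fps_add.
Proof. by move=> f g; apply: fpsP => n; apply: addrC. Qed.
Fact fps_add0 : left_id fps_zero fps_add.
Proof. by move=> f; apply: fpsP => n; apply: add0r. Qed.
Fact fps_addN : left_inverse fps_zero fps_opp fps_add.
Proof. by move=> f; apply: fpsP => n; apply: addNr. Qed.
HB.instance Definition _ := GRing.isZmodule.Build fps
  fps_addA fps_addC fps_add0 fps_addN.

Let trunc n f : {poly F} := \poly_(i < n) f i.

Let coef_mul n f g k : (k < n)%N -> (trunc n f * trunc n g)`_k = fps_mul f g k.
Proof.
move=> kn; rewrite coefM /=; apply: eq_bigr => i _.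
rewrite !coef_poly (leq_trans (ltn_ord i) kn).
by rewrite (leq_ltn_trans (leq_subr _ _) kn).
Qed.

Let coef_mulr n (q : {poly F}) f g k : (k < n)%N ->
  (forall i, (i < n)%N -> q`_i = g i) -> (trunc n f * q)`_k = fps_mul f g k.
Proof.
move=> kn qg; rewrite coefM /=; apply: eq_bigr => i _.
rewrite coef_poly (leq_trans (ltn_ord i) kn) qg //.
by rewrite (leq_ltn_trans (leq_subr _ _) kn).
Qed.

Fact fps_mulC : commutative fps_mul.
Proof.
by move=> f g; apply: fpsP => n; rewrite -!(coef_mul _ _ (ltnSn n)) mulrC.
Qed.
Fact fps_mulA : associative fps_mul.
Proof.
move=> f g h; apply: fpsP => n; rewrite [in RHS]fps_mulC.
rewrite -(coef_mulr (q := trunc n.+1 g * trunc n.+1 h) _ (ltnSn n)); last first.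
  by move=> i; apply: coef_mul.
rewrite -(coef_mulr (q := trunc n.+1 f * trunc n.+1 g) _ (ltnSn n)); last first.
  by move=> i; apply: coef_mul.
by rewrite mulrA mulrC.
Qed.
Fact fps_mul1 : left_id fps_one fps_mul.
Proof.
move=> f; apply: fpsP => n /=; rewrite big_ord_recl subn0 mul1r big1 ?addr0 //.
by move=> i _; rewrite mul0r.
Qed.
Fact fps_mulDl : left_distributive fps_mul +%R.
Proof.
move=> f g h; apply: fpsP => n; rewrite /= -big_split; apply: eq_bigr => i _.
exact: mulrDl.
Qed.
Fact fps_oneN0 : fps_one != 0.
Proof.
apply/eqP => /(congr1 (fun f : fps => f 0%N)) /eqP.
by rewrite -[_ == _]/((1 : F) == 0) oner_eq0.
Qed.
HB.instance Definition _ := GRing.Zmodule_isComNzRing.Build fps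
  fps_mulA fps_mulC fps_mul1 fps_mulDl fps_oneN0.
HB.instance Definition _ := GRing.ComNzRing_hasMulInverse.Build fps
  (@cl_mulVr fps) (@cl_unitPl fps) (@cl_invr_out fps).

Lemma fps_order f : f != 0 ->
  exists n, f n != 0 /\ forall m, (m < n)%N -> f m = 0.
Proof.
move=> f0; have ex : exists n, f n != 0.
  apply: contrapT => /forallNP fn; case/eqP: f0; apply: fpsP => n.
  by have /negP := fn n; rewrite negbK => /eqP.
exists (ex_minn ex); case: ex_minnP => n fn min; split=> // m mn.
by apply/eqP; apply: contraTT mn => /min; rewrite -leqNgt.
Qed.

Fact fps_integral f g : f * g = 0 -> (f == 0) || (g == 0).
Proof.
move=> fg0; apply: contrapT => /negP; rewrite negb_or => /andP[].
move=> /fps_order[n [fn ltn]] /fps_order[m [gm ltm]].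
have : (f * g) (n + m)%N = 0 by rewrite fg0.
have nnm : (n < (n + m).+1)%N by rewrite ltnS leq_addr.
rewrite /= (bigD1 (Ordinal nnm)) //= addKn big1 => [/eqP|i].
  by rewrite addr0 mulf_eq0 (negPf fn) (negPf gm).
rewrite -val_eqE /= neq_ltn => /orP[/ltn ->|ni]; first by rewrite mul0r.
rewrite [g _]ltm ?mulr0 // ltn_subLR ?ltn_add2r //.
by rewrite -ltnS ltn_ord.
Qed.
HB.instance Definition _ := GRing.ComUnitRing_isIntegral.Build fps fps_integral.

Definition fps_u : fps := FPS (fun n => (n == 1%N)%:R).

(* A Laurent series over F is an element of the fraction field of F[[u]]: it *)
(* can be written g / u^N with g a power series. The coefficient of u^k in   *)
(* f is a.                                                                   *)
Definition laurent_coef (f : {fraction fps}) (k : int) (a : F) : Prop :=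
  exists (N : nat) (g : fps),
    f = FracField.tofrac g / FracField.tofrac (fps_u ^+ N) /\
    a = match k + N%:Z with Posz n => g n | Negz _ => 0 end.

End PowerSeries.

Definition Qs : Type := {fraction {poly rat}}.
HB.instance Definition _ := GRing.Field.on Qs.

Definition svar : Qs := FracField.tofrac 'X.

Definition gbinom (F : fieldType) (a : F) (k : nat) : F :=
  (\prod_(i < k) (a - i%:R)) / k`!%:R.

(* The expansions of q and q^{-s} in u = q - 1. *)
Definition q_series : fps Qs := 1 + fps_u Qs.
Definition q_pow_Ns_series : fps Qs := FPS (gbinom (- svar)).

(* z is the coefficient of (q - 1)^k in the expansion of W(q, q^{-s}). *)
Definition expansion_coef (W : {fraction {poly {poly rat}}}) (k : int) (z : Qs) :
  Prop :=
  exists2 f : {fraction fps Qs},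
    rat_value W (FracField.tofrac q_series) (FracField.tofrac q_pow_Ns_series) f
    & laurent_coef f k z.

(* Main.v *)
Require Import Defs.
From HB Require Import structures.
From mathcomp Require Import all_boot all_order all_algebra all_field.
From mathcomp Require Import finmap.
From mathcomp Require Import all_classical all_reals all_analysis.
From mathcomp Require Import complex.
From mathcomp Require Import ring lra zify.

Import Order.TTheory GRing.Theory Num.Theory.
Local Open Scope ring_scope.

Set Implicit Arguments. Unset Strict Implicit. Unset Printing Implicit Defensive.

(** Let [o] be the ring of p-adic integers, with residue field of [q = p] elements.
The graded Lie algebra of the free nilpotent one has pieces [o^3], [o^3] and
[o^8]: the bracket of two elements of degree 1 is their cross product, and
degree 3 consists of the 3 x 3 matrices modulo scalars, with the class of
[e^T *m x] as the bracket of [x] in degree 2 and [e] in degree 1. So a graded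
ideal of finite index is a triple of lattices [(Lam1, Lam2, Lam3)] such that
the brackets of [Lam1] with degree 1 lie in [Lam2] and those of [Lam2] with
degree 1 lie in [Lam3] ([ideal_prod]). The first condition says that [Lam1] is
contained in a lattice [center Lam2]; summing over [Lam1] splits off the zeta
function of [o^3] and leaves a sum over the pairs [(Lam2, Lam3)] with the
weight [(o^3 : center Lam2) (o^3 : Lam2) (o^8 : Lam3)] to the power [-s].

Both sums are computed by one recursion ([state_sum_rec]). The map
[der Lam = {x | pi x in Lam}] commutes with the conditions and divides the
index of [Lam] by [q ^ rk Lam], where [rk Lam] is the codimension of [Lam]
modulo [pi]. The state of a pair is [(rk Lam2, rk Lam3)]; it determines the
codimension of the brackets of [Lam2] ([rank_bracket_span]) and the rank of the
center ([rk_center]). The pairs over a given one are counted by subspaces over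
the residue field ([fiber_bij], [card_subspaces_over]). This gives a
triangular linear system with coefficients in [q] and [t = q ^ -s], indexed by
the 19 states [(a, b)] with [a <= 3] and [b <= c a], where [c] takes the values
0, 2, 5, 8. Its unique solution is a rational function of [q] and [t], and [W]
is equal to it because the points [(p, p ^ -s)] are dense
([graded_zeta_unique]).

At [q = 1] the transition from a state to itself is a power of [q], so the
denominator [1 - t ^ m q ^ e] of a state is [(m s - e) (q - 1)] up to higher
order, and the other transitions tend to products of quotients of integers. The
solution at the state [(a, b)] has a pole of order [a + b], and only the steps
that lower [a] or [b] by 1 contribute to its leading coefficient ([topE]). The
leading coefficient at [(3, 8)], of order 11, times that of the zeta function
of [o^3], of order 3, is the stated function. *)

(** * Cosets and indices *)

Section Index.
Local Open Scope classical_set_scope.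
Variable A : zmodType.
Implicit Types I J : set A.

Definition subgroup I := I 0 /\ forall x y, I x -> I y -> I (x - y).

Lemma subgroupN I x : subgroup I -> I x -> I (- x).
Proof. by move=> [I0 IB] Ix; rewrite -sub0r; apply: IB. Qed.

Lemma subgroupD I x y : subgroup I -> I x -> I y -> I (x + y).
Proof. by move=> sI Ix Iy; rewrite -(opprK y); apply: sI.2 => //; apply: subgroupN. Qed.

(** Coset representatives are indexed by a finite type, because those of
products and of extensions are then indexed by products of types, and indices
become cardinals. *)
Definition transversal (T : finType) (f : T -> A) I :=
  (forall x, exists t, I (x - f t)) /\ (forall s t, I (f s - f t) -> s = t).

Lemma coset_eqP I x y : subgroup I ->
  ([set x + z | z in I] = [set y + z | z in I]) <-> I (x - y).
Proof.
move=> sI; split=> [xy|xy].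
  have : [set x + z | z in I] x by exists 0; rewrite ?addr0 //; apply: sI.1.
  by rewrite xy => -[z Iz <-]; rewrite addrC addKr.
apply/seteqP; split=> z /= [w Iw <-].
  by exists (x - y + w); [apply: subgroupD|rewrite addrA [y + _]addrC subrK].
exists (y - x + w); last by rewrite addrA [x + _]addrC subrK.
by apply: subgroupD => //; rewrite -opprB; apply: subgroupN.
Qed.

Lemma transversal_index T f I : subgroup I -> @transversal T f I ->
  finite_index I /\ coset_index I = #|T|.
Proof.
move=> sI [fex finj].
pose g t := [set f t + z | z in I].
have E : cosets I = [set g t | t in [set: T]].
  apply/seteqP; split=> _ [x _ <-]; last by exists (f x).
  by have [t It] := fex x; exists t => //; apply/esym/coset_eqP.
have fin : finite_set (cosets I) by rewrite E; apply: finite_image; apply: finite_finset.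
split=> //; rewrite /coset_index.
have -> : fset_set (cosets I) = [fset g t | t in T]%fset.
  apply/fsetP => X; rewrite in_fset_set //; apply/idP/imfsetP => [|[t _ ->]].
    by rewrite E inE => -[t _ <-]; exists t.
  by rewrite E inE; exists t.
rewrite card_imfset /=; last by move=> s t /coset_eqP h; apply/finj/h.
by rewrite -cardE.
Qed.

Lemma index_transversal I : subgroup I -> finite_index I ->
  exists (T : finType) (f : T -> A), transversal f I.
Proof.
move=> sI fin.
have ex (X : fset_set (cosets I)) : exists x, val X = [set x + z | z in I].
  by case: X => X /= Xin; move: (Xin); rewrite in_fset_set // inE => -[x _ <-]; exists x.
pose f X := sval (cid (ex X)).
have fP X : val X = [set f X + z | z in I] by rewrite /f; case: cid.
exists (fset_set (cosets I)), f; split=> [x|s t /coset_eqP st].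
  have Xin : [set x + z | z in I] \in fset_set (cosets I).
    by rewrite in_fset_set // inE; exists x.
  by exists [` Xin]%fset; apply/coset_eqP => //; rewrite -fP.
by apply: val_inj; rewrite !fP st.
Qed.

End Index.

(** * Sums of non-negative terms *)

Section ESum.
Local Open Scope classical_set_scope.
Local Open Scope ereal_scope.
Variables (R : realType) (T : choiceType).
Implicit Types (S : set T) (a : T -> \bar R).

Lemma esumZl S a (x : R) : (0 <= x)%R -> (forall i, 0 <= a i) ->
  \esum_(i in S) (x%:E * a i) = x%:E * \esum_(i in S) a i.
Proof.
rewrite le_eqVlt => /predU1P[<- _|x0 a0].
  by rewrite mul0e esum1 // => i _; rewrite mul0e.
have le (y : R) b : (0 < y)%R -> (forall i, 0 <= b i) ->
    \esum_(i in S) (y%:E * b i) <= y%:E * \esum_(i in S) b i.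
  move=> y0 b0; apply: ge_ereal_sup => _ [X [finX XS] <-].
  rewrite -ge0_mule_fsumr; last by [].
  rewrite lee_pmul2l // ereal_sup_ubound //; by exists X.
apply/eqP; rewrite eq_le le //= -lee_pdivlMl //.
apply: le_trans (le _ _ _ _); rewrite ?invr_gt0 //; last first.
  by move=> i; rewrite mule_ge0 ?a0 // lee_fin ltW.
by apply: le_esum => i Si; rewrite muleA -EFinM mulVf ?gt_eqF // mul1e.
Qed.

Lemma esum_card_const (F : finType) (A : {set F}) (x : R) : (0 <= x)%R ->
  \esum_(i in [set` A]) x%:E = (#|A|%:R * x)%:E.
Proof.
move=> x0; rewrite esum_fset // fsbig_finite //=.
rewrite (perm_big (enum A)) /= ?big_enum /= ?sumEFin ?sumr_const ?mulr_natl //.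
apply: uniq_perm; rewrite ?enum_uniq ?fset_uniq // => i.
by rewrite in_fset_set // mem_enum; apply/idP/idP; rewrite inE.
Qed.

Lemma esum_fibration (T' : choiceType) (f : T -> T') S (S' : set T') a :
  (forall i, S i -> S' (f i)) -> (forall i, S i -> 0 <= a i) ->
  \esum_(i in S) a i = \esum_(j in S') \esum_(i in S `&` [set i | f i = j]) a i.
Proof.
move=> fS a0; rewrite esum_esum; last by move=> j i _ [Si _]; apply: a0.
apply/esym; apply: (@reindex_esum _ _ _ S _ (fun i => (f i, i))); split.
- by move=> i Si; split; [apply: fS|].
- by move=> i j _ _ [_ ->].
- by move=> [j i] /= [_ [Si <-]]; exists i.
Qed.

Lemma esum_partition (L : choiceType) (r : seq L) (f : T -> L) S a :
  uniq r -> (forall i, S i -> f i \in r) -> (forall i, S i -> 0 <= a i) ->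
  \esum_(i in S) a i = \sum_(l <- r) \esum_(i in S `&` [set i | f i = l]) a i.
Proof.
move=> ur fr a0; under eq_bigr do rewrite esum_mkcondr.
have -> : forall F : L -> \bar R, \sum_(l <- r) F l = \sum_(l <- r | xpredT l) F l by [].
rewrite -esum_sum; last by move=> i l Si _; case: ifP => // _; apply: a0.
apply: eq_esum => i Si; rewrite (bigD1_seq (f i)) ?fr //= mem_set //.
rewrite big1 ?adde0 // => l lf; rewrite ifF //; apply/negP; rewrite inE /= => fl.
by rewrite fl eqxx in lf.
Qed.

End ESum.

(** * Counting subspaces over a finite field *)

Section SubspaceCounting.
Variable F : finFieldType.
Local Notation q := #|F|.

Lemma card_rV_sub m n (A : 'M[F]_(m, n)) :
  #|[set v : 'rV[F]_n | (v <= A)%MS]| = (q ^ \rank A)%N.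
Proof.
rewrite -(mul1n (\rank A)) -card_mx.
rewrite -(@card_imset _ _ (fun v => v *m row_base A)); last first.
  exact/row_free_inj/row_base_free.
apply: eq_card => v; rewrite !inE; apply/idP/imsetP => [|[u _ ->]].
  by rewrite -(eq_row_base A) => /submxP[u ->]; exists u.
by rewrite -(eq_row_base A) submxMl.
Qed.

Lemma rank_adds_leq m1 m2 n (A : 'M[F]_(m1, n)) (B : 'M[F]_(m2, n)) :
  (\rank (A + B)%MS <= \rank A + m2)%N.
Proof.
by apply: leq_trans (mxrank_adds_leqif _ _).1 _; rewrite leq_add2l rank_leq_row.
Qed.

Lemma rank_adds_row m n (A : 'M[F]_(m, n)) (v : 'rV[F]_n) :
  ~~ (v <= A)%MS -> \rank (A + v)%MS = (\rank A).+1.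
Proof.
move=> vA; apply/eqP; rewrite eqn_leq rank_ltmx ?andbT.
  by have := rank_adds_leq A v; rewrite addn1.
by rewrite ltmxE addsmxSl addsmx_sub (negPf vA) andbF.
Qed.

(** The rows of [C] are chosen one after the other: the [i]-th one has to
avoid the span of [S] and of the rows before it, which has rank [\rank S + i].
*)
Lemma card_independent_mod m n s k (W : 'M[F]_(m, n)) (S : 'M[F]_(s, n)) :
  (S <= W)%MS ->
  #|[set C : 'M[F]_(k, n) | (C <= W)%MS & \rank (S + C)%MS == (\rank S + k)%N]|
  = (\prod_(i < k) (q ^ \rank W - q ^ (\rank S + i)))%N.
Proof.
elim: k s S => [|k IHk] s S SW.
  rewrite big_ord0; apply/eqP/cards1P; exists 0.
  apply/setP => C; rewrite !inE; have -> : C = 0 by apply/matrixP => -[].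
  by rewrite sub0mx addn0 addsmx0 !eqxx.
rewrite -sum1_card (reindex (fun p : 'rV[F]_n * 'M[F]_(k, n) => col_mx p.1 p.2)) /=;
  last first.
  exists (fun C : 'M[F]_(1 + k, n) => (usubmx C, dsubmx C)) => [[c C] _|C _] /=.
    by rewrite col_mxKu col_mxKd.
  by rewrite vsubmxK.
rewrite (eq_bigl (fun p : 'rV[F]_n * 'M[F]_(k, n) =>
   ((p.1 <= W)%MS && ~~ (p.1 <= S)%MS) && ((p.2 <= W)%MS &&
     (\rank ((S + p.1) + p.2)%MS == (\rank (S + p.1)%MS + k)%N)))); last first.
  case=> c C; rewrite !inE /=.
  have -> : (col_mx c C <= W)%MS = (c <= W)%MS && (C <= W)%MS by exact: col_mx_sub.
  have -> : \rank (S + col_mx c C)%MS = \rank ((S + c) + C)%MS.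
    by rewrite -addsmxA (adds_eqmx (eqmx_refl S) (addsmxE c C)).
  case: (c <= W)%MS => //=; case: (C <= W)%MS; rewrite /= ?andbF //=.
  case: (boolP (c <= S)%MS) => cS /=.
    apply/negbTE; rewrite neq_ltn; apply/orP; left.
    have /leq_ltn_trans-> // := rank_adds_leq (S + c)%MS C.
    have -> : \rank (S + c)%MS = \rank S by have /addsmx_idPl-> := cS.
    by rewrite addnS.
  by rewrite rank_adds_row // addSnnS.
rewrite -(pair_big_dep (fun c : 'rV[F]_n => (c <= W)%MS && ~~ (c <= S)%MS)
  (fun c (C : 'M[F]_(k, n)) => (C <= W)%MS &&
     (\rank ((S + c) + C)%MS == (\rank (S + c)%MS + k)%N)) (fun _ _ => 1%N)) /=.
transitivity (\sum_(c : 'rV[F]_n | (c <= W)%MS && ~~ (c <= S)%MS)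
   \prod_(i < k) (q ^ \rank W - q ^ ((\rank S).+1 + i)))%N.
  apply: eq_bigr => c /andP[cW cS]; rewrite -(rank_adds_row cS) -IHk ?addsmx_sub ?SW //.
  by rewrite -sum1_card; apply: eq_bigl => C; rewrite inE.
rewrite sum_nat_const big_ord_recl addn0; congr (_ * _)%N; last first.
  by apply: eq_bigr => i _; rewrite addSnnS.
rewrite -!card_rV_sub -cardsDS; last first.
  by apply/fintype.subsetP => v; rewrite !inE => /submx_trans; apply.
by rewrite -cardsE; apply: eq_card => v; rewrite !inE andbC.
Qed.

(** A subspace is represented by its canonical matrix [<<U>>], so that this
set counts each of them once. The last condition says that [U] and [R]
intersect trivially. *)
Definition subspaces_over b n (B : 'M[F]_(b, n)) r (R : 'M[F]_(r, n)) d :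
    {set 'M[F]_n} :=
  [set U | [&& <<U>>%MS == U, (B <= U)%MS, \rank U == d
             & \rank (U + R)%MS == (\rank U + \rank R)%N]].

(** Both sides count the [k]-tuples of vectors that are independent modulo [B
+ R]: together with [B] such a tuple spans one of the subspaces, and each of
these subspaces arises from its bases modulo [B]. *)
Lemma card_subspaces_over b n (B : 'M[F]_(b, n)) r (R : 'M[F]_(r, n)) k :
  \rank (B + R)%MS = (\rank B + \rank R)%N ->
  (#|subspaces_over B R (\rank B + k)%N|
     * \prod_(i < k) (q ^ (\rank B + k) - q ^ (\rank B + i))
   = \prod_(i < k) (q ^ n - q ^ (\rank B + \rank R + i)))%N.
Proof.
move=> BR; rewrite -BR; have := @card_independent_mod _ _ _ k 1%:M (B + R)%MS (submx1 _).
rewrite mxrank1 => <-; rewrite -[RHS]sum1_card.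
have rk (C : 'M[F]_(k, n)) : \rank ((B + R) + C)%MS = (\rank B + \rank R + k)%N ->
    \rank (B + C)%MS = (\rank B + k)%N.
  rewrite [(B + R)%MS]addsmxC -addsmxA => h; apply/eqP; rewrite eqn_leq rank_adds_leq.
  rewrite -(leq_add2r (\rank R)) addnAC -h addsmxC.
  exact: (mxrank_adds_leqif (B + C)%MS R).1.
rewrite (partition_big (fun C : 'M[F]_(k, n) => <<(B + C)%MS>>%MS)
   (mem (subspaces_over B R (\rank B + k)%N))) /=; last first.
  move=> C; rewrite !inE submx1 BR => /eqP h.
  rewrite genmx_id eqxx !genmxE addsmxSl /= (rk _ h) eqxx /=.
  rewrite (adds_eqmx (genmxE (B + C)%MS) (eqmx_refl R)).
  by rewrite addnAC -h addsmxC addsmxA [(R + B)%MS]addsmxC.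
rewrite -[LHS]sum_nat_const.
apply: eq_bigr => U; rewrite inE => /and4P[/eqP gU BU /eqP dU /eqP UR].
rewrite -dU -card_independent_mod // -[LHS]sum1_card; apply: eq_bigl => C.
rewrite !inE submx1 BR /=; apply/andP/andP => [[CU /eqP rC]|[/eqP rC /eqP <-]].
  have eU : (B + C :=: U)%MS.
    apply/eqmxP; rewrite -(geq_leqif (mxrank_leqif_eq _)) ?addsmx_sub ?BU //.
    by rewrite rC dU.
  split; last by rewrite (eq_genmx eU) gU.
  rewrite addsmxC addsmxA [(C + B)%MS]addsmxC (adds_eqmx eU (eqmx_refl R)).
  by rewrite UR dU addnAC.
by rewrite genmxE addsmxSr (rk _ rC).
Qed.
End SubspaceCounting.

(** * The brackets of degree 2 and 3 *)

Section CrossProduct.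
Variable R : comNzRingType.
Implicit Types x y z : 'rV[R]_3.

(** The indices are taken in the cyclic group ['I_3]. *)
Definition cross x y : 'rV[R]_3 :=
  \row_i (x 0 (i + 1) * y 0 (i + 2%:R) - x 0 (i + 2%:R) * y 0 (i + 1)).

Definition dot x y : R := \sum_i x 0 i * y 0 i.

(** Coordinates on the quotient of the 3 x 3 matrices by the scalar ones: the
first eight entries of the representative whose last entry vanishes; [mat8] is
this representative. *)
Definition vec8 (A : 'M[R]_3) : 'rV[R]_8 :=
  \row_(j < 8) (A (inord (j %/ 3)%N) (inord (j %% 3)%N) - ((j %/ 3)%N == (j %% 3)%N)%:R * A
    ord_max ord_max).

Definition mat8 (v : 'rV[R]_8) : 'M[R]_3 :=
  \matrix_(i, j) if (3 * i + j < 8)%N then v 0 (inord (3 * i + j)%N) else 0.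

Lemma ord3_cases (P : 'I_3 -> Prop) : P 0 -> P 1 -> P ord_max -> forall i, P i.
Proof.
move=> P0 P1 P2 [[|[|[|//]]] i]; [move: P0|move: P1|move: P2];
  by congr P; apply: val_inj.
Qed.

Lemma ord3E : ((0 + 1 = 1 :> 'I_3)%R * (0 + 2%:R = ord_max :> 'I_3)%R
  * (1 + 1 = ord_max :> 'I_3)%R * (1 + 2%:R = 0 :> 'I_3)%R
  * (ord_max + 1 = 0 :> 'I_3)%R * (ord_max + 2%:R = 1 :> 'I_3)%R)%type.
Proof. by do !split; apply: val_inj. Qed.

Lemma crossE x y : ((cross x y 0 0 = x 0 1 * y 0 ord_max - x 0 ord_max * y 0 1)%R
  * (cross x y 0 1 = x 0 ord_max * y 0 0 - x 0 0 * y 0 ord_max)%R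
  * (cross x y 0 ord_max = x 0 0 * y 0 1 - x 0 1 * y 0 0)%R)%type.
Proof. by rewrite !mxE !ord3E. Qed.

Lemma sum3 (V : nmodType) (F : 'I_3 -> V) : \sum_i F i = F 0 + F 1 + F ord_max.
Proof.
by rewrite !big_ord_recr big_ord0 /= add0r; congr (F _ + F _ + F _); apply: val_inj.
Qed.

Lemma dotE x y : dot x y = x 0 0 * y 0 0 + x 0 1 * y 0 1 + x 0 ord_max * y 0 ord_max.
Proof. exact: sum3. Qed.

Lemma row3P x y : x 0 0 = y 0 0 -> x 0 1 = y 0 1 -> x 0 ord_max = y 0 ord_max -> x = y.
Proof. by move=> h0 h1 h2; apply/rowP; apply: ord3_cases. Qed.

Lemma crossxx x : cross x x = 0.
Proof. by apply: row3P; rewrite crossE mxE; ring. Qed.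

Lemma crossPl a x y z : cross (a *: x + y) z = a *: cross x z + cross y z.
Proof. by apply: row3P; rewrite !(crossE, mxE) ?ord3E; ring. Qed.

Lemma crossPr a x y z : cross z (a *: x + y) = a *: cross z x + cross z y.
Proof. by apply: row3P; rewrite !(crossE, mxE) ?ord3E; ring. Qed.

Lemma cross_cross x y z : cross (cross x y) z = dot x z *: y - dot y z *: x.
Proof. by apply: row3P; rewrite !(crossE, dotE, mxE) ?ord3E; ring. Qed.

Lemma dot_cross x y z : dot x (cross y z) = dot z (cross x y).
Proof. by rewrite !dotE !crossE; ring. Qed.

Lemma dotC x y : dot x y = dot y x.
Proof. by apply: eq_bigr => i _; rewrite mulrC. Qed.

Lemma dotPl a x y z : dot (a *: x + y) z = a * dot x z + dot y z.
Proof. by rewrite !dotE !mxE; ring. Qed.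

Lemma dotZ a x y : dot (a *: x) y = a * dot x y.
Proof. by rewrite !dotE !mxE; ring. Qed.

Lemma dot_delta i x : dot (delta_mx 0 i) x = x 0 i.
Proof.
rewrite /dot (bigD1 i) //= big1 ?addr0 => [|j ji]; first by rewrite mxE !eqxx mul1r.
by rewrite mxE eqxx (negPf ji) mul0r.
Qed.

Lemma crossZl a x y : cross (a *: x) y = a *: cross x y.
Proof. by apply/rowP => i; rewrite !mxE; ring. Qed.

Lemma dot_crossl x y : dot (cross x y) x = 0.
Proof. by rewrite !dotE !crossE; ring. Qed.

Lemma dot_crossr x y : dot (cross x y) y = 0.
Proof. by rewrite !dotE !crossE; ring. Qed.

Lemma mat8K : cancel mat8 vec8.
Proof.
move=> v; apply/rowP => j; rewrite !mxE.
have m3 : (j %% 3 < 3)%N by rewrite ltn_mod.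
have d3 : (j %/ 3 < 3)%N by rewrite ltn_divLR // (leq_trans (ltn_ord j)).
rewrite /= !inordK // mulnC -divn_eq ltn_ord mulr0 subr0.
by congr (v 0 _); apply: val_inj; rewrite /= inordK.
Qed.

Lemma vec8K A : mat8 (vec8 A) = A - (A ord_max ord_max)%:M.
Proof.
apply/matrixP => i j; rewrite !mxE; case: ifP => [lt8|/negbT]; last first.
  have := leq_ord i; have := leq_ord j; rewrite -leqNgt => j2 i2 ij.
  have -> : i = ord_max by apply: val_inj => /=; lia.
  have -> : j = ord_max by apply: val_inj => /=; lia.
  by rewrite eqxx subrr.
rewrite inordK // mulnC divnMDl // modnMDl (divn_small (ltn_ord j)).
by rewrite (modn_small (ltn_ord j)) addn0 !inord_val mulr_natl.
Qed.

Lemma vec8P a A B : vec8 (a *: A + B) = a *: vec8 A + vec8 B.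
Proof. by apply/rowP => j; rewrite !mxE; ring. Qed.

Lemma vec8_0 : vec8 0 = 0.
Proof. by apply/rowP => j; rewrite !mxE mulr0 subrr. Qed.

Lemma vec8_sum (I : Type) (r : seq I) (F : I -> 'M[R]_3) :
  vec8 (\sum_(i <- r) F i) = \sum_(i <- r) vec8 (F i).
Proof.
elim: r => [|i r IH]; first by rewrite !big_nil vec8_0.
by rewrite !big_cons -[F i]scale1r vec8P IH !scale1r.
Qed.

Lemma vec8_scalar a : vec8 a%:M = 0.
Proof.
by rewrite -[LHS]mat8K vec8K !mxE eqxx subrr vec8_0.
Qed.

Lemma vec8_eq0 A : vec8 A = 0 -> A = (A ord_max ord_max)%:M.
Proof.
move=> A0; apply/eqP; rewrite -subr_eq0 -vec8K A0; apply/eqP/matrixP => i j.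
by rewrite !mxE; case: ifP.
Qed.

(** The brackets of a vector [x] of degree 2 with a vector [e] of degree 1
form the tensor product of two free modules of rank 3, here the 3 x 3
matrices, and the Jacobi identity of the three generators annihilates the
identity matrix; hence the quotient by the scalar matrices. *)
Definition bracket23 (x e : 'rV[R]_3) : 'rV[R]_8 := vec8 (e^T *m x).

Lemma bracket23Pl a x y e :
  bracket23 (a *: x + y) e = a *: bracket23 x e + bracket23 y e.
Proof. by rewrite /bracket23 mulmxDr -scalemxAr vec8P. Qed.

Lemma bracket23Pr a x e f :
  bracket23 x (a *: e + f) = a *: bracket23 x e + bracket23 x f.
Proof. by rewrite /bracket23 linearP mulmxDl -scalemxAl vec8P. Qed.

(** The three matrices add up to the scalar matrix of the triple product. *)
Lemma bracket23_jacobi x y z :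
  bracket23 (cross x y) z + bracket23 (cross y z) x + bracket23 (cross z x) y = 0.
Proof.
have E A B : vec8 A + vec8 B = vec8 (A + B) by rewrite -[A in RHS]scale1r vec8P scale1r.
rewrite /bracket23 !E -(vec8_scalar (dot (cross x y) z)); congr vec8.
apply/matrixP; do 2![elim/ord3_cases]; rewrite !mxE !big_ord1 !mxE ?crossE dotE ?crossE ?mulr1n
  ?mulr0n /= ?ord3E; ring.
Qed.

End CrossProduct.

Lemma map_cross (R S : comNzRingType) (f : {rmorphism R -> S}) (x y : 'rV[R]_3) :
  map_mx f (cross x y) = cross (map_mx f x) (map_mx f y).
Proof. by apply/rowP => i; rewrite !mxE rmorphB !rmorphM. Qed.

Lemma map_vec8 (R S : comNzRingType) (f : {rmorphism R -> S}) (A : 'M[R]_3) :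
  map_mx f (vec8 A) = vec8 (map_mx f A).
Proof. by apply/rowP => i; rewrite !mxE rmorphB rmorphM rmorph_nat. Qed.

Lemma map_bracket23 (R S : comNzRingType) (f : {rmorphism R -> S}) (x e : 'rV[R]_3) :
  map_mx f (bracket23 x e) = bracket23 (map_mx f x) (map_mx f e).
Proof. by rewrite /bracket23 map_vec8 map_mxM map_trmx. Qed.

Section Submodules.
Local Open Scope classical_set_scope.
Variable o : comNzRingType.

Lemma scale_scaleC (V : lmodType o) (a b : o) (v : V) : a *: (b *: v) = b *: (a *: v).
Proof. by rewrite !scalerA mulrC. Qed.

Definition submod n (I : set 'rV[o]_n) :=
  I 0 /\ forall a x y, I x -> I y -> I (a *: x + y).

Section Submod.
Variables (n : nat) (I : set 'rV[o]_n).
Hypothesis sI : submod I.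

Lemma submodD x y : I x -> I y -> I (x + y).
Proof. by move=> Ix Iy; rewrite -(scale1r x); apply: sI.2. Qed.

Lemma submodZ a x : I x -> I (a *: x).
Proof. by move=> Ix; rewrite -[_ *: _]addr0; apply: sI.2 => //; apply: sI.1. Qed.

Lemma submodBr x y : I x -> I y -> I (x - y).
Proof. by move=> Ix Iy; rewrite -scaleN1r addrC; apply: sI.2. Qed.

Lemma submod_sum J (r : seq J) (P : pred J) F :
  (forall j, P j -> I (F j)) -> I (\sum_(j <- r | P j) F j).
Proof. by move=> IF; elim/big_ind: _ => //; [apply: sI.1|apply: submodD]. Qed.

Lemma submod_subgroup : subgroup I.
Proof. by split; [apply: sI.1|apply: submodBr]. Qed.

End Submod.

End Submodules.

(** * The free nilpotent Lie algebra in coordinates *)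

Section Model.
Variable R : comNzRingType.

(** A graded Lie algebra with pieces of rank 3, 3 and 8, generated by the
first piece. It is shown below to be the graded Lie algebra of the free
nilpotent one. *)
Definition model : Type := ('rV[R]_3 * 'rV[R]_3 * 'rV[R]_8)%type.
HB.instance Definition _ := GRing.Lmodule.on model.

Definition mk_model (a b : 'rV[R]_3) (c : 'rV[R]_8) : model := (a, b, c).
Definition part1 (u : model) : 'rV[R]_3 := u.1.1.
Definition part2 (u : model) : 'rV[R]_3 := u.1.2.
Definition part3 (u : model) : 'rV[R]_8 := u.2.

Lemma modelP u v : part1 u = part1 v -> part2 u = part2 v -> part3 u = part3 v -> u = v.
Proof. by case: u v => [[? ?] ?] [[? ?] ?]; rewrite /part1 /part2 /part3 /= => -> -> ->. Qed.

Lemma part1P a u v : part1 (a *: u + v) = a *: part1 u + part1 v. Proof. by []. Qed.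
Lemma part2P a u v : part2 (a *: u + v) = a *: part2 u + part2 v. Proof. by []. Qed.
Lemma part3P a u v : part3 (a *: u + v) = a *: part3 u + part3 v. Proof. by []. Qed.

Definition model_lie (u v : model) : model :=
  mk_model 0 (cross (part1 u) (part1 v))
    (bracket23 (part2 u) (part1 v) - bracket23 (part2 v) (part1 u)).

Lemma model_liePl a u v x : model_lie (a *: u + v) x = a *: model_lie u x + model_lie v x.
Proof.
apply: modelP; rewrite /part1 /part2 /part3 /=; first by rewrite scaler0 addr0.
  exact: crossPl.
by rewrite bracket23Pl bracket23Pr scalerBr opprD addrACA.
Qed.

Lemma model_liePr a u v x : model_lie x (a *: u + v) = a *: model_lie x u + model_lie x v.
Proof.
apply: modelP; rewrite /part1 /part2 /part3 /=; first by rewrite scaler0 addr0.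
  exact: crossPr.
by rewrite bracket23Pl bracket23Pr scalerBr opprD addrACA.
Qed.

Lemma model_lie0l u : model_lie 0 u = 0.
Proof. by have := model_liePl (-1) 0 0 u; rewrite scaler0 addr0 scaleN1r addNr. Qed.
Lemma model_lie0r u : model_lie u 0 = 0.
Proof. by have := model_liePr (-1) 0 0 u; rewrite scaler0 addr0 scaleN1r addNr. Qed.

Fact model_lieDl : left_distributive model_lie +%R.
Proof. by move=> u v x; rewrite -[u]scale1r model_liePl !scale1r. Qed.
Fact model_lieDr : right_distributive model_lie +%R.
Proof. by move=> x u v; rewrite -[u]scale1r model_liePr !scale1r. Qed.
Fact model_lieZl a u v : model_lie (a *: u) v = a *: model_lie u v.
Proof. by rewrite -[a *: u]addr0 model_liePl model_lie0l addr0. Qed.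
Fact model_lieZr a u v : model_lie u (a *: v) = a *: model_lie u v.
Proof. by rewrite -[a *: v]addr0 model_liePr model_lie0r addr0. Qed.
Fact model_liexx u : model_lie u u = 0.
Proof. by apply: modelP => //; [exact: crossxx|exact: subrr]. Qed.

Lemma bracket230l e : bracket23 0 e = 0 :> 'rV[R]_8.
Proof. by rewrite /bracket23 mulmx0 vec8_0. Qed.
Lemma bracket230r x : bracket23 x 0 = 0 :> 'rV[R]_8.
Proof. by rewrite /bracket23 trmx0 mul0mx vec8_0. Qed.

Lemma cross0l (x : 'rV[R]_3) : cross 0 x = 0.
Proof. by apply/rowP => i; rewrite !mxE !mul0r subrr. Qed.

Lemma cross0r (x : 'rV[R]_3) : cross x 0 = 0.
Proof. by apply/rowP => i; rewrite !mxE !mulr0 subrr. Qed.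

Fact model_lieJ u v x : model_lie u (model_lie v x) + model_lie v (model_lie x u)
  + model_lie x (model_lie u v) = 0.
Proof.
apply: modelP; rewrite /part1 /part2 /part3 /= ?cross0r ?addr0 //.
rewrite !bracket230r !sub0r -!opprD; apply/eqP; rewrite oppr_eq0; apply/eqP.
exact: (bracket23_jacobi (part1 v) (part1 x) (part1 u)).
Qed.

HB.instance Definition _ := Lmodule_isLie.Build R model
  model_lieDl model_lieDr model_lieZl model_lieZr model_liexx model_lieJ.

End Model.

(** The bracket raises degrees, so these submodules bound the lower central
series from above. *)
Definition model_low (R : comNzRingType) n (u : model R) : Prop :=
  [/\ (0 < n)%N -> part1 u = 0, (1 < n)%N -> part2 u = 0 & (2 < n)%N -> part3 u = 0].

Lemma model_low_lie (R : comNzRingType) n (u v : model R) :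
  model_low n u -> model_low n.+1 (lie u v).
Proof.
move=> [u1 u2 u3]; split=> // n1; rewrite /part2 /part3 /=.
  by rewrite u1 // cross0l.
by rewrite u1 1?ltnW // u2 // bracket230l bracket230r subrr.
Qed.

Lemma lcs_low (R : comNzRingType) (L : lieAlgType R) (f : L -> model R) n x :
  linear f -> {morph f : x y / lie x y} -> x \in lcs L n -> model_low n (f x).
Proof.
move=> fl fm; have f0 : f 0 = 0.
  by have := fl (-1) 0 0; rewrite scaler0 addr0 scaleN1r addNr.
elim: n x => [|n IHn] x; first by [].
apply: (@lcsS_ind_set _ _ n [set x | model_low n.+1 (f x)]%classic) => [|u v /IHn]; last first.
  by rewrite /= fm; apply: model_low_lie.
split=> [|a u v]; rewrite !inE /=; first by rewrite f0.
by move=> [u1 u2 u3] [v1 v2 v3]; rewrite fl; split=> h;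
  rewrite ?part1P ?part2P ?part3P ?u1 ?v1 ?u2 ?v2 ?u3 ?v3 // scaler0 addr0.
Qed.

Definition model_map (R S : comNzRingType) (f : {rmorphism R -> S}) (u : model R) : model S :=
  mk_model (map_mx f (part1 u)) (map_mx f (part2 u)) (map_mx f (part3 u)).

Lemma model_mapD (R S : comNzRingType) (f : {rmorphism R -> S}) :
  {morph model_map f : u v / u + v}.
Proof. by move=> u v; apply: modelP; apply: map_mxD. Qed.

Lemma model_map_lie (R S : comNzRingType) (f : {rmorphism R -> S}) :
  {morph model_map f : u v / lie u v}.
Proof.
move=> u v; apply: modelP; rewrite /part1 /part2 /part3 /=; first exact: map_mx0.
  exact: map_cross.
by rewrite map_mxB !map_bracket23.
Qed.

Section FreeNilpotent.
Variable o : comNzRingType.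
Local Notation N := (free_nilpotent 3 3).
Local Notation L := (free_nilpotent_over 3 3 o).
Local Notation FL := (free_lie int 'I_3).

Definition free_model : FL -> model int :=
  @fl_lift int 'I_3 (model int) (fun i => mk_model (delta_mx 0 i) 0 0).

Lemma model_low3 (R : comNzRingType) (u : model R) n : model_low n.+3 u -> u = 0.
Proof. by case=> h1 h2 h3; apply: modelP; rewrite ?h1 ?h2 ?h3. Qed.

Lemma free_model_lcs x y : x - y \in lcs FL 3 -> free_model x = free_model y.
Proof.
have lin : linear free_model := @fl_lift_linear _ _ _ _.
move=> xy; apply/eqP; rewrite -subr_eq0; apply/eqP.
have -> : free_model x - free_model y = free_model (x - y).
  by rewrite [x - y]addrC -[- y]scaleN1r lin scaleN1r addrC.
by apply: (@model_low3 _ _ 0); apply: lcs_low xy => // u v; apply: fl_lift_lie.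
Qed.

Definition nil_model (x : N) : model int := free_model (lmod_repr (x : lmod_quot (lcs FL 3))).

Definition nil_pi (x : FL) : N := lmod_pi (lcs FL 3) x.

Lemma nil_model_pi x : nil_model (nil_pi x) = free_model x.
Proof. exact/free_model_lcs/lmod_piB. Qed.

Lemma nil_piP (P : N -> Prop) : (forall x, P (nil_pi x)) -> forall x, P x.
Proof. by move=> h x; rewrite -[x](@lmod_reprK _ _ (lcs FL 3)); apply: h. Qed.

Lemma nil_piD x y : nil_pi (x + y) = nil_pi x + nil_pi y.
Proof. exact: lmod_piD. Qed.

Lemma nil_pi_lie x y : nil_pi (lie x y) = lie (nil_pi x) (nil_pi y).
Proof. exact/esym/lie_quot_lieE. Qed.

Lemma nil_modelD : {morph nil_model : x y / x + y}.
Proof.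
elim/nil_piP=> x; elim/nil_piP=> y; rewrite -nil_piD !nil_model_pi.
by have := @fl_lift_linear _ _ _ (fun i => mk_model (delta_mx 0 i) 0 0) 1 x y; rewrite !scale1r.
Qed.

Lemma nil_model_lie : {morph nil_model : x y / lie x y}.
Proof.
elim/nil_piP=> x; elim/nil_piP=> y; rewrite -nil_pi_lie !nil_model_pi.
exact: fl_lift_lie.
Qed.

Definition int_o : {rmorphism int -> o} := intmul 1.

Definition tensor_model (x : N) (r : o) : model o := r *: model_map int_o (nil_model x).

Lemma tensor_modelB : biadditive tensor_model.
Proof.
split=> [r x y|x r s]; last exact: scalerDl.
by rewrite /tensor_model nil_modelD model_mapD scalerDr.
Qed.

(** Sending the generators to the unit vectors of degree 1 extends to a Lie
morphism by the universal properties of the free Lie algebra, of its nilpotent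
quotient and of the tensor product in turn. *)
Definition over_model (x : L) : model o := tensor_eval tensor_model (ts_repr x).

Lemma over_model_pi s : over_model (ts_pi s) = tensor_eval tensor_model s.
Proof. exact: ts_reprP tensor_modelB. Qed.

Lemma over_model_linear : linear over_model.
Proof.
move=> a; elim/ts_ind=> s; elim/ts_ind=> t.
rewrite -[a *: ts_pi s]/(ts_scale a _) ts_scaleE ts_addE' !over_model_pi.
rewrite tensor_eval_cat tensor_eval_scale; congr (_ + _).
rewrite /tensor_eval scaler_sumr; apply: eq_bigr => p _.
by rewrite /tensor_model scalerA.
Qed.

Lemma lie_sumlr (R : comNzRingType) (M : lieAlgType R) (I J : Type) (r : seq I) (s : seq J)
   (F : I -> M) (G : J -> M) :
  lie (\sum_(i <- r) F i) (\sum_(j <- s) G j) = \sum_(i <- r) \sum_(j <- s) lie (F i) (G j).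
Proof.
rewrite (big_morph (fun x => lie x _) (fun x y => lieDl x y _) (lie0l _)).
apply: eq_bigr => i _.
by rewrite (big_morph (lie (F i)) (fun x y => lieDr (F i) x y) (lie0r _)).
Qed.

Lemma over_model_lie : {morph over_model : x y / lie x y}.
Proof.
elim/ts_ind=> s; elim/ts_ind=> t.
rewrite -[lie (ts_pi s) (ts_pi t)]/(ts_lie _ _) ts_lieE !over_model_pi.
rewrite tensor_eval_lie lie_sumlr; apply: eq_bigr => p _; apply: eq_bigr => r _.
by rewrite /tensor_model lieZl lieZr scalerA nil_model_lie model_map_lie.
Qed.

Definition egen (i : 'I_3) : L := pure_tensor (nil_pi (fl_gen int i)) 1.

Lemma over_model_gen i : over_model (egen i) = mk_model (delta_mx 0 i) 0 0.
Proof.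
rewrite /egen over_model_pi /tensor_eval big_seq1 /tensor_model /= scale1r nil_model_pi.
rewrite /free_model fl_lift_gen; apply: modelP; rewrite /part1 /part2 /part3 /= ?map_mx0 //.
by apply/rowP => j; rewrite !mxE rmorph_nat.
Qed.

Lemma pure_tensorD (x y : N) (r : o) :
  pure_tensor (x + y) r = pure_tensor x r + pure_tensor y r.
Proof.
rewrite /pure_tensor ts_addE'; apply/ts_piP => A b bA.
by rewrite /tensor_eval /= !(big_cons, big_nil) !addr0 bA.1.
Qed.

Lemma pure_tensorN (x : N) (r : o) : pure_tensor (- x) r = - pure_tensor x r.
Proof.
apply/eqP; rewrite -addr_eq0 -pure_tensorD addNr; apply/eqP/ts_piP => A b bA.
by rewrite /tensor_eval big_seq1 big_nil biadd0l.
Qed.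

Lemma pure_tensor0 (r : o) : pure_tensor (0 : N) r = 0.
Proof. by rewrite -[0 in LHS](subrr 0) pure_tensorD pure_tensorN subrr. Qed.

Lemma pure_tensor_lie (x y : N) (r s : o) :
  pure_tensor (lie x y) (r * s) = lie (pure_tensor x r) (pure_tensor y s).
Proof. by rewrite -[RHS]/(ts_lie _ _) /pure_tensor ts_lieE. Qed.

Lemma pure_tensor_scale (x : N) (r : o) : pure_tensor x r = r *: pure_tensor x 1.
Proof.
by rewrite -[RHS]/(ts_scale _ _) /pure_tensor ts_scaleE /ft_scale /= mulr1.
Qed.

Lemma pure_tensorZ (x : N) (n : int) (r : o) :
  exists m : o, pure_tensor (n *: x) r = m *: pure_tensor x r.
Proof.
have E (k : nat) : exists m : o, pure_tensor (k%:Z *: x) r = m *: pure_tensor x r.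
  exists k%:R; elim: k => [|k IHk]; first by rewrite !scale0r pure_tensor0.
  by rewrite intS scalerDl scale1r pure_tensorD IHk mulrS scalerDl scale1r.
case: n => k; first exact: E.
by have [m h] := E k.+1; exists (- m); rewrite NegzE scaleNr pure_tensorN h scaleNr.
Qed.

(** Induction over the terms of the free Lie algebra: the Lie algebra is
generated by the [egen i]. *)
Lemma over_ind (A : L -> Prop) : A 0 -> (forall a x y, A x -> A y -> A (a *: x + y)) ->
  (forall x y, A x -> A y -> A (lie x y)) -> (forall i, A (egen i)) -> forall x, A x.
Proof.
move=> A0 AP Al Ag; have AD x y : A x -> A y -> A (x + y).
  by move=> Ax Ay; rewrite -[x]scale1r; apply: AP.
have AZ a x : A x -> A (a *: x) by move=> Ax; rewrite -[_ *: _]addr0; apply: AP.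
have pure (t : lie_term int 'I_3) (r : o) : A (pure_tensor (nil_pi (fl_pi t)) r).
  elim: t r => [i||t IHt|t IHt u IHu|a t IHt|t IHt u IHu] r.
  - by rewrite pure_tensor_scale; apply: AZ; apply: Ag.
  - have -> : nil_pi (fl_pi (LZero int 'I_3)) = 0 by exact: (raddf0 (lmod_pi (lcs FL 3))).
    by rewrite pure_tensor0.
  - have -> : nil_pi (fl_pi (LOpp t)) = - nil_pi (fl_pi t).
      by rewrite -fl_oppE; exact: (raddfN (lmod_pi (lcs FL 3)) (fl_pi t)).
    by rewrite pure_tensorN -scaleN1r; apply: AZ.
  - by rewrite -fl_addE' nil_piD pure_tensorD; apply: AD.
  - have -> : nil_pi (fl_pi (LScale a t)) = a *: nil_pi (fl_pi t).
      by rewrite -fl_scaleE'; exact: lmod_piZ.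
    by have [m ->] := pure_tensorZ (nil_pi (fl_pi t)) a r; apply: AZ.
  - have -> : nil_pi (fl_pi (LLie t u)) = lie (nil_pi (fl_pi t)) (nil_pi (fl_pi u)).
      by rewrite -nil_pi_lie -fl_lieE.
    by rewrite -[r]mulr1 pure_tensor_lie; apply: Al.
elim/ts_ind; elim=> [|[x r] s IHs]; first exact: A0.
rewrite -cat1s -ts_addE'; apply: AD IHs.
by elim/nil_piP: x => x; elim/fl_ind: x => t; apply: pure.
Qed.

Definition span0 (v : 'rV[o]_3) : L := \sum_i v 0 i *: egen i.
(** The order of the indices makes the map to the model send [egen2 i] to a
unit vector. *)
Definition egen2 (i : 'I_3) : L := lie (egen (i + 1)) (egen (i + 2%:R)).
Definition span1 (v : 'rV[o]_3) : L := \sum_i v 0 i *: egen2 i.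
Definition span2m (A : 'M[o]_3) : L := \sum_i \sum_j A i j *: lie (egen2 j) (egen i).
Definition span2 (v : 'rV[o]_8) : L := span2m (mat8 v).

Lemma span0P a u v : span0 (a *: u + v) = a *: span0 u + span0 v.
Proof.
rewrite /span0 scaler_sumr -big_split; apply: eq_bigr => i _.
by rewrite !mxE scalerDl scalerA.
Qed.

Lemma span1P a u v : span1 (a *: u + v) = a *: span1 u + span1 v.
Proof.
rewrite /span1 scaler_sumr -big_split; apply: eq_bigr => i _.
by rewrite !mxE scalerDl scalerA.
Qed.

Lemma span2mP a A B : span2m (a *: A + B) = a *: span2m A + span2m B.
Proof.
rewrite /span2m scaler_sumr -big_split; apply: eq_bigr => i _.
rewrite scaler_sumr -big_split; apply: eq_bigr => j _.
by rewrite !mxE scalerDl scalerA.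
Qed.

Lemma mat8P (a : o) u v : mat8 (a *: u + v) = a *: mat8 u + mat8 v.
Proof.
by apply/matrixP => i j; rewrite !mxE; case: ifP; rewrite ?mxE // mulr0 addr0.
Qed.

Lemma span2P a u v : span2 (a *: u + v) = a *: span2 u + span2 v.
Proof. by rewrite /span2 mat8P span2mP. Qed.

(** This is the Jacobi identity of the three generators. *)
Lemma span2m_scalar a : span2m a%:M = 0.
Proof.
rewrite /span2m (eq_bigr (fun i => a *: lie (egen2 i) (egen i))) => [|i _]; last first.
  rewrite (bigD1 i) //= big1 ?addr0 => [|j ji]; first by rewrite mxE eqxx.
  by rewrite mxE eq_sym (negPf ji) scale0r.
rewrite -scaler_sumr sum3 /egen2 !ord3E.
apply/eqP; rewrite -oppr_eq0 -scalerN !opprD -!lieC; apply/eqP.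
by rewrite lieJ scaler0.
Qed.

Lemma span2_vec8 A : span2 (vec8 A) = span2m A.
Proof.
rewrite /span2 vec8K -[A in RHS](subrK (A ord_max ord_max)%:M) -[_ - _ in RHS]scale1r.
by rewrite span2mP scale1r span2m_scalar addr0.
Qed.

Lemma span0_lie u v : lie (span0 u) (span0 v) = span1 (cross u v).
Proof.
rewrite /span0 /span1 !sum3 !lieDl !lieDr !lieZl !lieZr !liexx !scaler0 !crossE /egen2 !ord3E.
rewrite (lieC (egen 1) (egen 0)) (lieC (egen ord_max) (egen 1)) (lieC (egen 0) (egen ord_max)).
rewrite !scalerN !scalerBl !scalerA !addr0 !add0r.
by rewrite [LHS](AC (2*2*2) ((4*6)*(5*2)*(1*3))).
Qed.

Lemma span1_lie u v : lie (span1 u) (span0 v) = span2 (bracket23 u v).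
Proof.
rewrite span2_vec8 /span1 /span0 lie_sumlr exchange_big; apply: eq_bigr => i _.
by apply: eq_bigr => j _; rewrite lieZl lieZr scalerA mulrC mxE big_ord1 mxE.
Qed.

Lemma lcs_sub2 n x y z : x - y \in lcs L n -> y - z \in lcs L n -> x - z \in lcs L n.
Proof. by move=> xy yz; rewrite -(subrKA y); apply: rpredD. Qed.

Lemma submodZ_lcs n a (x : L) : x \in lcs L n -> a *: x \in lcs L n.
Proof. exact: rpredZ. Qed.

(** The brackets of generators span the graded pieces. The morphism to the
model reads off their coefficients, so they are bases, and the coordinates
below are isomorphisms. *)
Lemma lcs0_span x : exists v, x - span0 v \in lcs L 1.
Proof.
elim/over_ind: x => [|a x y [u xu] [v yv]|x y _ _|i].
- by exists 0; rewrite /span0 big1 ?subrr ?rpred0 // => i _; rewrite mxE scale0r.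
- exists (a *: u + v); rewrite span0P opprD addrACA -scalerBr.
  by apply: rpredD => //; apply: submodZ_lcs.
- exists 0; rewrite /span0 big1 ?subr0 => [|i _]; last by rewrite mxE scale0r.
  by apply: lcs_lieS; rewrite inE.
- exists (delta_mx 0 i); rewrite /span0 (bigD1 i) //= big1 => [|j ji].
    by rewrite mxE !eqxx scale1r addr0 subrr rpred0.
  by rewrite mxE eqxx (negPf ji) scale0r.
Qed.

Lemma lcs1_span x : x \in lcs L 1 -> exists v, x - span1 v \in lcs L 2.
Proof.
apply: (@lcsS_ind_set _ _ 0 [set x | exists v, x - span1 v \in lcs L 2]%classic).
  split=> [|a u v]; rewrite !inE /=.
    by exists 0; rewrite /span1 big1 ?subrr ?rpred0 // => i _; rewrite mxE scale0r.
  move=> [u' uu] [v' vv]; exists (a *: u' + v'); rewrite span1P opprD addrACA -scalerBr.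
  by apply: rpredD => //; apply: submodZ_lcs.
move=> {}x y _ /=; have [[u xu] [v yv]] := (lcs0_span x, lcs0_span y).
exists (cross u v); rewrite -span0_lie; apply: (@lcs_sub2 _ _ (lie (span0 u) y)).
  by rewrite -lieBl; apply: lcs_lieS.
rewrite -lieBr lieC; apply: submodN; exact: lcs_lieS.
Qed.

Lemma lcs2_span x : x \in lcs L 2 -> exists v, x - span2 v \in lcs L 3.
Proof.
apply: (@lcsS_ind_set _ _ 1 [set x | exists v, x - span2 v \in lcs L 3]%classic).
  split=> [|a u v]; rewrite !inE /=.
    by exists (vec8 0%:M); rewrite span2_vec8 span2m_scalar subrr rpred0.
  move=> [u' uu] [v' vv]; exists (a *: u' + v'); rewrite span2P opprD addrACA -scalerBr.
  by apply: rpredD => //; apply: submodZ_lcs.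
move=> {}x y x1 /=; have [[u xu] [v yv]] := (lcs1_span x1, lcs0_span y).
exists (bracket23 u v); rewrite -span1_lie; apply: (@lcs_sub2 _ _ (lie (span1 u) y)).
  by rewrite -lieBl; apply: lcs_lieS.
rewrite -lieBr; apply: (@lcs_lie _ _ 1 1) => //.
rewrite /span1; apply: rpred_sum => i _; apply: submodZ_lcs.
by apply: lcs_lieS; rewrite inE.
Qed.

Lemma over_modelD x y : over_model (x + y) = over_model x + over_model y.
Proof. by have := over_model_linear 1 x y; rewrite !scale1r. Qed.

Lemma over_model0 : over_model (0 : L) = 0.
Proof. by have := over_model_linear (-1) 0 0; rewrite scaler0 addr0 scaleN1r addNr. Qed.

Lemma over_modelZ a x : over_model (a *: x) = a *: over_model x.
Proof. by have := over_model_linear a x 0; rewrite addr0 over_model0 addr0. Qed.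

Lemma over_modelB x y : over_model (x - y) = over_model x - over_model y.
Proof. by rewrite over_modelD -scaleN1r over_modelZ scaleN1r. Qed.

Lemma over_model_low n x : x \in lcs L n -> model_low n (over_model x).
Proof. exact: lcs_low over_model_linear over_model_lie. Qed.

Lemma over_model_sum (I : Type) (r : seq I) (F : I -> L) :
  over_model (\sum_(i <- r) F i) = \sum_(i <- r) over_model (F i).
Proof. by apply: big_morph; [exact: over_modelD|exact: over_model0]. Qed.

Lemma over_model_span0 v : part1 (over_model (span0 v)) = v.
Proof.
rewrite /span0 over_model_sum (big_morph (@part1 o) (fun _ _ => erefl) erefl).
rewrite [RHS]row_sum_delta; apply: eq_bigr => i _.
by rewrite over_modelZ over_model_gen.
Qed.

Lemma over_model_egen2 i : over_model (egen2 i) = mk_model 0 (delta_mx 0 i) 0.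
Proof.
rewrite /egen2 over_model_lie !over_model_gen; apply: modelP => //; last first.
  by rewrite /part3 /= !bracket230l subrr.
by elim/ord3_cases: i; apply: row3P; rewrite /part2 /= !ord3E crossE !mxE -!val_eqE /=; ring.
Qed.

Lemma over_model_span1 v : part2 (over_model (span1 v)) = v.
Proof.
rewrite /span1 over_model_sum (big_morph (@part2 o) (fun _ _ => erefl) erefl).
rewrite [RHS]row_sum_delta; apply: eq_bigr => i _.
by rewrite over_modelZ over_model_egen2.
Qed.

Lemma over_model_span2 v : part3 (over_model (span2 v)) = v.
Proof.
rewrite /span2 /span2m over_model_sum (big_morph (@part3 o) (fun _ _ => erefl) erefl).
rewrite -[RHS]mat8K [in RHS](matrix_sum_delta (mat8 v)) vec8_sum; apply: eq_bigr => i _.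
rewrite over_model_sum (big_morph (@part3 o) (fun _ _ => erefl) erefl) vec8_sum.
apply: eq_bigr => j _; rewrite over_modelZ over_model_lie over_model_egen2 over_model_gen.
rewrite -[_ *: delta_mx i j]addr0 vec8P vec8_0 addr0.
rewrite /part3 /= bracket230l subr0 /bracket23; congr (_ *: vec8 _).
by rewrite trmx_delta mul_delta_mx.
Qed.

(** Independent of the representative, because the morphism to the model
respects the filtrations; see [coord0E], [coord1E] and [coord2E]. *)
Definition coord0 (a : grade L 0) : 'rV[o]_3 := part1 (over_model (grade_repr a)).
Definition coord1 (a : grade L 1) : 'rV[o]_3 := part2 (over_model (grade_repr a)).
Definition coord2 (a : grade L 2) : 'rV[o]_8 := part3 (over_model (grade_repr a)).

Lemma grade_repr_class n x : x \in lcs L n ->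
  model_low n.+1 (over_model (grade_repr (grade_class n x) - x)).
Proof.
move=> Lx; apply: over_model_low; apply/grade_classP => //; first exact: grade_reprP.
by rewrite grade_reprK.
Qed.

Lemma coord0E x : x \in lcs L 0 -> coord0 (grade_class 0 x) = part1 (over_model x).
Proof.
move=> /grade_repr_class[/(_ isT) + _ _]; rewrite over_modelB => /eqP.
by rewrite subr_eq0 => /eqP.
Qed.

Lemma coord1E x : x \in lcs L 1 -> coord1 (grade_class 1 x) = part2 (over_model x).
Proof.
move=> /grade_repr_class[_ /(_ isT) + _]; rewrite over_modelB => /eqP.
by rewrite subr_eq0 => /eqP.
Qed.

Lemma coord2E x : x \in lcs L 2 -> coord2 (grade_class 2 x) = part3 (over_model x).
Proof.
move=> /grade_repr_class[_ _ /(_ isT)]; rewrite over_modelB => /eqP.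
by rewrite subr_eq0 => /eqP.
Qed.

Lemma lcs_span0 v : span0 v \in lcs L 0. Proof. by rewrite inE. Qed.

Lemma lcs_span1 v : span1 v \in lcs L 1.
Proof.
by apply: rpred_sum => i _; apply: submodZ_lcs; apply: lcs_lieS; rewrite inE.
Qed.

Lemma lcs_span2 v : span2 v \in lcs L 2.
Proof.
apply: rpred_sum => i _; apply: rpred_sum => j _; apply: submodZ_lcs.
by apply: lcs_lieS; apply: lcs_lieS; rewrite inE.
Qed.

Definition uncoord0 v : grade L 0 := grade_class 0 (span0 v).
Definition uncoord1 v : grade L 1 := grade_class 1 (span1 v).
Definition uncoord2 v : grade L 2 := grade_class 2 (span2 v).

Lemma coord0K : cancel coord0 uncoord0.
Proof.
move=> a; have [v av] := lcs0_span (grade_repr a).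
have -> : a = uncoord0 v.
  by rewrite -[a]grade_reprK; apply/grade_classP; rewrite ?grade_reprP ?lcs_span0.
by rewrite {2}/uncoord0 coord0E ?lcs_span0 // over_model_span0.
Qed.

Lemma coord1K : cancel coord1 uncoord1.
Proof.
move=> a; have [v av] := lcs1_span (grade_reprP a).
have -> : a = uncoord1 v.
  by rewrite -[a]grade_reprK; apply/grade_classP; rewrite ?grade_reprP ?lcs_span1.
by rewrite {2}/uncoord1 coord1E ?lcs_span1 // over_model_span1.
Qed.

Lemma coord2K : cancel coord2 uncoord2.
Proof.
move=> a; have [v av] := lcs2_span (grade_reprP a).
have -> : a = uncoord2 v.
  by rewrite -[a]grade_reprK; apply/grade_classP; rewrite ?grade_reprP ?lcs_span2.
by rewrite {2}/uncoord2 coord2E ?lcs_span2 // over_model_span2.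
Qed.

Lemma uncoord0K : cancel uncoord0 coord0.
Proof. by move=> v; rewrite coord0E ?lcs_span0 // over_model_span0. Qed.
Lemma uncoord1K : cancel uncoord1 coord1.
Proof. by move=> v; rewrite coord1E ?lcs_span1 // over_model_span1. Qed.
Lemma uncoord2K : cancel uncoord2 coord2.
Proof. by move=> v; rewrite coord2E ?lcs_span2 // over_model_span2. Qed.

Lemma coord0P a x y : coord0 (a *: x + y) = a *: coord0 x + coord0 y.
Proof.
rewrite -[x]coord0K -[y]coord0K /uncoord0 -grade_class_linear ?lcs_span0 //.
by rewrite -span0P !coord0E ?lcs_span0 // !over_model_span0.
Qed.
Lemma coord1P a x y : coord1 (a *: x + y) = a *: coord1 x + coord1 y.
Proof.
rewrite -[x]coord1K -[y]coord1K /uncoord1 -grade_class_linear ?lcs_span1 //.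
by rewrite -span1P !coord1E ?lcs_span1 // !over_model_span1.
Qed.
Lemma coord2P a x y : coord2 (a *: x + y) = a *: coord2 x + coord2 y.
Proof.
rewrite -[x]coord2K -[y]coord2K /uncoord2 -grade_class_linear ?lcs_span2 //.
by rewrite -span2P !coord2E ?lcs_span2 // !over_model_span2.
Qed.

Lemma coord_lie00 x y : coord1 (grade_lie 1 x y) = cross (coord0 x) (coord0 y).
Proof.
by rewrite /grade_lie coord1E ?over_model_lie //; apply: lcs_lieS; rewrite inE.
Qed.

Lemma coord_lie10 (x : grade L 1) (y : grade L 0) :
  coord2 (grade_lie 2 x y) = bracket23 (coord1 x) (coord0 y).
Proof.
have [/(_ isT) x0 _ _] := over_model_low (grade_reprP x).
rewrite /grade_lie coord2E; last exact/lcs_lieS/grade_reprP.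
by rewrite over_model_lie /part3 /= x0 bracket230r subr0.
Qed.

Lemma coord_lie01 (x : grade L 1) (y : grade L 0) :
  coord2 (grade_lie 2 y x) = - bracket23 (coord1 x) (coord0 y).
Proof.
have c0 : coord2 0 = 0.
  by have := coord2P (-1) 0 0; rewrite scaler0 addr0 scaleN1r addNr.
rewrite grade_lieC // -[- grade_lie 2 x y]scaleN1r -[_ *: _]addr0 coord2P c0.
by rewrite coord_lie10 scaleN1r addr0.
Qed.

(** * Graded ideals as triples of submodules *)

Definition mk_gr (a : grade L 0) (b : grade L 1) (c : grade L 2) : gr L 3 :=
  fun i => match i as i0 return grade L i0 with Ordinal m p =>
    match m as m0 return (m0 < 3)%N -> grade L m0 with
    | 0 => fun _ => a | 1 => fun _ => b | 2 => fun _ => c | _ => fun _ => 0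
    end p end.

Definition gr_part1 (f : gr L 3) : 'rV[o]_3 := coord0 (f (@Ordinal 3 0 isT)).
Definition gr_part2 (f : gr L 3) : 'rV[o]_3 := coord1 (f (@Ordinal 3 1 isT)).
Definition gr_part3 (f : gr L 3) : 'rV[o]_8 := coord2 (f (@Ordinal 3 2 isT)).

Definition gr_mk (a b : 'rV[o]_3) (c : 'rV[o]_8) : gr L 3 :=
  mk_gr (uncoord0 a) (uncoord1 b) (uncoord2 c).

Lemma gr_part1_mk a b c : gr_part1 (gr_mk a b c) = a.
Proof. exact: uncoord0K. Qed.
Lemma gr_part2_mk a b c : gr_part2 (gr_mk a b c) = b.
Proof. exact: uncoord1K. Qed.
Lemma gr_part3_mk a b c : gr_part3 (gr_mk a b c) = c.
Proof. exact: uncoord2K. Qed.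

Lemma gr_partP (f g : gr L 3) : gr_part1 f = gr_part1 g -> gr_part2 f = gr_part2 g ->
  gr_part3 f = gr_part3 g -> f = g.
Proof.
move=> /(can_inj coord0K) h0 /(can_inj coord1K) h1 /(can_inj coord2K) h2.
apply: functional_extensionality_dep => -[[|[|[|//]]] i].
- by rewrite (bool_irrelevance i isT).
- by rewrite (bool_irrelevance i isT).
- by rewrite (bool_irrelevance i isT).
Qed.

Lemma gr_mkK f : gr_mk (gr_part1 f) (gr_part2 f) (gr_part3 f) = f.
Proof. by apply: gr_partP; rewrite ?gr_part1_mk ?gr_part2_mk ?gr_part3_mk. Qed.

Lemma gr_part1P a f g : gr_part1 (a *: f + g) = a *: gr_part1 f + gr_part1 g.
Proof. exact: coord0P. Qed.
Lemma gr_part2P a f g : gr_part2 (a *: f + g) = a *: gr_part2 f + gr_part2 g.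
Proof. exact: coord1P. Qed.
Lemma gr_part3P a f g : gr_part3 (a *: f + g) = a *: gr_part3 f + gr_part3 g.
Proof. exact: coord2P. Qed.

Lemma gr_part1_0 : gr_part1 0 = 0.
Proof. by have := gr_part1P (-1) 0 0; rewrite scaler0 addr0 scaleN1r addNr. Qed.
Lemma gr_part2_0 : gr_part2 0 = 0.
Proof. by have := gr_part2P (-1) 0 0; rewrite scaler0 addr0 scaleN1r addNr. Qed.
Lemma gr_part3_0 : gr_part3 0 = 0.
Proof. by have := gr_part3P (-1) 0 0; rewrite scaler0 addr0 scaleN1r addNr. Qed.

Lemma gr_mkP s a b c a' b' c' : gr_mk (s *: a + a') (s *: b + b') (s *: c + c') =
  s *: gr_mk a b c + gr_mk a' b' c'.
Proof.
by apply: gr_partP; rewrite ?gr_part1P ?gr_part2P ?gr_part3P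
  ?gr_part1_mk ?gr_part2_mk ?gr_part3_mk.
Qed.

Lemma gr_part1_lie f g : gr_part1 (lie f g) = 0.
Proof.
rewrite /gr_part1 [lie f g _]big1 => [|i _]; last by rewrite big1.
exact: gr_part1_0.
Qed.

Lemma gr_part2_lie f g : gr_part2 (lie f g) = cross (gr_part1 f) (gr_part1 g).
Proof.
rewrite /gr_part2 -coord_lie00; congr coord1.
rewrite -[LHS]/(\sum_(i < 3) \sum_(j < 3 | (i + j).+1 == 1) grade_lie 1 (f i) (g j)).
rewrite (bigD1 (@Ordinal 3 0 isT)) //= [X in _ + X]big1 ?addr0 => [|i i0].
  by rewrite (big_pred1 (@Ordinal 3 0 isT)).
rewrite big_pred0 // => j; apply/negbTE; move: i0; rewrite -val_eqE /=.
by case: (nat_of_ord i).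
Qed.

Lemma gr_part3_lie f g : gr_part3 (lie f g) =
  bracket23 (gr_part2 f) (gr_part1 g) - bracket23 (gr_part2 g) (gr_part1 f).
Proof.
rewrite /gr_part3 -coord_lie10 -coord_lie01.
rewrite -[lie f g _]/(\sum_(i < 3) \sum_(j < 3 | (i + j).+1 == 2) grade_lie 2 (f i) (g j)).
rewrite (bigD1 (@Ordinal 3 1 isT)) //= addrC (bigD1 (@Ordinal 3 0 isT)) //=.
rewrite [X in _ + X + _]big1 ?addr0 => [|i /andP[i1 i0]]; last first.
  rewrite big_pred0 // => j; apply/negbTE; move: i1 i0; rewrite -!val_eqE /=.
  by case: (nat_of_ord i) => [|[|]].
rewrite (big_pred1 (@Ordinal 3 1 isT)) //.
rewrite (big_pred1 (@Ordinal 3 0 isT)) //.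
by rewrite addrC -[grade_lie _ _ _ in LHS]scale1r coord2P scale1r.
Qed.

Lemma homogeneous_sum (h : 'I_3 -> gr L 3) j : (forall i, homogeneous i (h i)) ->
  (\sum_(i < 3) h i) j = h j j.
Proof.
move=> hh; rewrite gr_sumE (bigD1 j) //= big1 ?addr0 // => i ij.
by apply: hh; rewrite eq_sym.
Qed.

Local Open Scope classical_set_scope.

Definition gr_prod (A B : set 'rV[o]_3) (C : set 'rV[o]_8) : set (gr L 3) :=
  [set f | [/\ A (gr_part1 f), B (gr_part2 f) & C (gr_part3 f)]].

Definition slice1 (I : set (gr L 3)) := [set a | I (gr_mk a 0 0)].
Definition slice2 (I : set (gr L 3)) := [set b | I (gr_mk 0 b 0)].
Definition slice3 (I : set (gr L 3)) := [set c | I (gr_mk 0 0 c)].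

Lemma submoduleP (I : set (gr L 3)) : submodule I <->
  I 0 /\ forall a f g, I f -> I g -> I (a *: f + g).
Proof.
split=> [[I0 IP]|[I0 IP]]; split; rewrite ?inE // in I0 *.
  by move=> a f g; have := IP a f g; rewrite !inE.
by move=> a f g; rewrite !inE; apply: IP.
Qed.

Lemma gr_mk0 : gr_mk 0 0 0 = 0.
Proof.
by apply: gr_partP; rewrite ?gr_part1_mk ?gr_part2_mk ?gr_part3_mk
  ?gr_part1_0 ?gr_part2_0 ?gr_part3_0.
Qed.

Lemma submod_slices I : submodule I ->
  [/\ submod (slice1 I), submod (slice2 I) & submod (slice3 I)].
Proof.
move=> /submoduleP[I0 IP]; split; split; rewrite /slice1 /slice2 /slice3 /= ?gr_mk0 //.
- by move=> a x y Ix Iy; have := IP a _ _ Ix Iy; rewrite -gr_mkP !scaler0 !addr0.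
- by move=> a x y Ix Iy; have := IP a _ _ Ix Iy; rewrite -gr_mkP !scaler0 !addr0.
- by move=> a x y Ix Iy; have := IP a _ _ Ix Iy; rewrite -gr_mkP !scaler0 !addr0.
Qed.

Lemma gr_graded_slices I : submodule I -> gr_graded I ->
  I = gr_prod (slice1 I) (slice2 I) (slice3 I).
Proof.
move=> /submoduleP[I0 IP] gI; apply/seteqP; split=> f; last first.
  move=> [f1 f2 f3]; have := IP 1 _ _ f1 (IP 1 _ _ f2 f3).
  by rewrite -!gr_mkP !scale1r !addr0 !add0r gr_mkK.
rewrite [in I f]gI => -[h hI <-].
have hh i : homogeneous i (h i) := (hI i).2.
have E j := homogeneous_sum j hh.
have c00 : coord0 0 = 0 := gr_part1_0.
have c10 : coord1 0 = 0 := gr_part2_0.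
have c20 : coord2 0 = 0 := gr_part3_0.
split; rewrite /slice1 /slice2 /slice3 /= /gr_part1 /gr_part2 /gr_part3 E.
- have := (hI (@Ordinal 3 0 isT)).1; congr I; apply: gr_partP;
    rewrite ?gr_part1_mk ?gr_part2_mk ?gr_part3_mk /gr_part1 /gr_part2 /gr_part3 //.
    by rewrite hh.
  by rewrite hh.
- have := (hI (@Ordinal 3 1 isT)).1; congr I; apply: gr_partP;
    rewrite ?gr_part1_mk ?gr_part2_mk ?gr_part3_mk /gr_part1 /gr_part2 /gr_part3 //.
    by rewrite hh.
  by rewrite hh.
- have := (hI (@Ordinal 3 2 isT)).1; congr I; apply: gr_partP;
    rewrite ?gr_part1_mk ?gr_part2_mk ?gr_part3_mk /gr_part1 /gr_part2 /gr_part3 //.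
    by rewrite hh.
  by rewrite hh.
Qed.

Section Product.
Variables (A B : set 'rV[o]_3) (C : set 'rV[o]_8).
Hypotheses (sA : submod A) (sB : submod B) (sC : submod C).

Lemma submodule_prod : submodule (gr_prod A B C).
Proof.
apply/submoduleP; split=> [|a f g [f1 f2 f3] [g1 g2 g3]].
  by split; rewrite ?gr_part1_0 ?gr_part2_0 ?gr_part3_0;
    [apply: sA.1|apply: sB.1|apply: sC.1].
by split; rewrite ?gr_part1P ?gr_part2P ?gr_part3P; [apply: sA.2|apply: sB.2|apply: sC.2].
Qed.

Lemma slices_prod : [/\ slice1 (gr_prod A B C) = A, slice2 (gr_prod A B C) = B
  & slice3 (gr_prod A B C) = C].
Proof.
have [A0 B0 C0] := And3 sA.1 sB.1 sC.1.
split; apply/seteqP; split=> x; rewrite /slice1 /slice2 /slice3 /gr_prod /=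
  gr_part1_mk gr_part2_mk gr_part3_mk; by [case|split].
Qed.

Lemma graded_prod : gr_graded (gr_prod A B C).
Proof.
have /submoduleP[I0 IP] := submodule_prod.
have c00 : coord0 0 = 0 := gr_part1_0.
have c10 : coord1 0 = 0 := gr_part2_0.
have c20 : coord2 0 = 0 := gr_part3_0.
apply/seteqP; split=> [f [f1 f2 f3]|_ [h hI <-]]; last first.
  elim/big_ind: _ => [|f g If Ig|i _]; [exact: I0| |exact: (hI i).1].
  by rewrite -[f]scale1r; apply: IP.
pose h (i : 'I_3) : gr L 3 := fun j => if j == i then f j else 0.
have hh i : homogeneous i (h i) by move=> j /negPf ji; rewrite /h ji.
exists h; last first.
  by apply: functional_extensionality_dep => j; rewrite homogeneous_sum // /h eqxx.
move=> i; split; last exact: hh.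
by split; rewrite /gr_part1 /gr_part2 /gr_part3 /h; case: ifP => _ //;
  rewrite ?c00 ?c10 ?c20; [apply: sA.1|apply: sB.1|apply: sC.1].
Qed.

Lemma cross_span (b : 'rV[o]_3) :
  b = \sum_i b 0 i *: cross (delta_mx 0 (i + 1)) (delta_mx 0 (i + 2%:R)).
Proof.
rewrite [LHS]row_sum_delta; apply: eq_bigr => i _; congr (_ *: _).
by elim/ord3_cases: i; apply: row3P; rewrite !ord3E crossE !mxE -!val_eqE /=; ring.
Qed.

(** Closure under brackets with degree 1 is all that an ideal requires: degree
2 is spanned by brackets of degree 1, so the brackets of [A] with degree 2 are
covered by the Jacobi identity. *)
Lemma ideal_prod : gr_ideal (gr_prod A B C) <->
  (forall a x, A a -> B (cross a x)) /\ (forall b x, B b -> C (bracket23 b x)).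
Proof.
have A0 := sA.1; have B0 := sB.1; have C0 := sC.1.
split=> [[_ IP]|[AB BC]].
  split=> [a x Aa|b x Bb].
    have /(IP (gr_mk (- x) 0 0)) : gr_prod A B C (gr_mk a 0 0).
      by split; rewrite ?gr_part1_mk ?gr_part2_mk ?gr_part3_mk.
    move=> [_ + _]; rewrite gr_part2_lie !gr_part1_mk.
    by congr B; apply: row3P; rewrite !crossE !mxE; ring.
  have /(IP (gr_mk (- x) 0 0)) : gr_prod A B C (gr_mk 0 b 0).
    by split; rewrite ?gr_part1_mk ?gr_part2_mk ?gr_part3_mk.
  move=> [_ _]; rewrite gr_part3_lie !gr_part1_mk !gr_part2_mk.
  by rewrite bracket230l sub0r -[- x]scaleN1r -[_ *: x]addr0 bracket23Pr bracket230r addr0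
    scaleN1r opprK.
split=> [|f g [Ag Bg Cg]]; first exact: submodule_prod.
split; rewrite ?gr_part1_lie ?gr_part2_lie ?gr_part3_lie //.
  have := AB _ (- gr_part1 f) Ag.
  by congr B; apply: row3P; rewrite !crossE !mxE; ring.
apply: submodBr => //; last exact: BC.
rewrite (cross_span (gr_part2 f)).
have BrP a u v e : bracket23 (a *: u + v) e = a *: bracket23 u e + bracket23 v e by exact: bracket23Pl.
elim/big_rec: _ => [|i u _ Cu]; first by rewrite bracket230l.
rewrite BrP; apply: sC.2 => //.
(* Jacobi: the bracket with [cross y z] is a sum of brackets with [y] and [z]. *)
set y := delta_mx _ _; set z := delta_mx _ _.
have := bracket23_jacobi y z (gr_part1 g).
move/eqP; rewrite -addrA addr_eq0 => /eqP ->; rewrite -scaleN1r; apply: submodZ => //.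
apply: submodD => //; apply: BC; last exact: AB.
have := AB _ (- z) Ag.
by congr B; apply: row3P; rewrite !crossE !mxE; ring.
Qed.

Lemma transversal_prod (S T U : finType) (f : S -> 'rV[o]_3) (g : T -> 'rV[o]_3)
    (h : U -> 'rV[o]_8) :
  transversal f A -> transversal g B -> transversal h C ->
  transversal (fun p : S * T * U => gr_mk (f p.1.1) (g p.1.2) (h p.2)) (gr_prod A B C).
Proof.
have BE (x y : gr L 3) : [/\ gr_part1 (x - y) = gr_part1 x - gr_part1 y,
    gr_part2 (x - y) = gr_part2 x - gr_part2 y & gr_part3 (x - y) = gr_part3 x - gr_part3 y].
  by rewrite -scaleN1r addrC gr_part1P gr_part2P gr_part3P !scaleN1r;
    split; rewrite addrC.
move=> [fex finj] [gex ginj] [hex hinj]; split=> [x|[[s t] u] [[s' t'] u']].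
  have [s As] := fex (gr_part1 x); have [t Bt] := gex (gr_part2 x).
  have [u Cu] := hex (gr_part3 x); exists (s, t, u).
  have [h1 h2 h3] := BE x (gr_mk (f s) (g t) (h u)).
  by split; rewrite ?h1 ?h2 ?h3 /= ?gr_part1_mk ?gr_part2_mk ?gr_part3_mk.
have [h1 h2 h3] := BE (gr_mk (f s) (g t) (h u)) (gr_mk (f s') (g t') (h u')).
rewrite /= => -[]; rewrite h1 h2 h3 !gr_part1_mk !gr_part2_mk !gr_part3_mk.
by move=> /finj -> /ginj -> /hinj ->.
Qed.

End Product.

Lemma finite_index_preim (V W : zmodType) (f : V -> W) (I : set W) :
  {morph f : x y / x + y} -> finite_index I -> finite_index (f @^-1` I).
Proof.
move=> fD fin; apply: (sub_finite_set _ (finite_image (fun X => f @^-1` X) fin)).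
move=> _ [x _ <-]; exists [set f x + y | y in I]; first by exists (f x).
apply/seteqP; split=> z /=.
  case=> y Iy xy; exists (z - x); last by rewrite addrC subrK.
  rewrite /=; suff -> : f (z - x) = y by [].
  by apply: (addrI (f x)); rewrite -fD xy addrC subrK.
by case=> y Iy <-; exists (f y); rewrite ?fD.
Qed.

Lemma gr_mkD a b c a' b' c' :
  gr_mk (a + a') (b + b') (c + c') = gr_mk a b c + gr_mk a' b' c'.
Proof. by have := gr_mkP 1 a b c a' b' c'; rewrite !scale1r. Qed.

Lemma finite_index_slices I : finite_index I ->
  [/\ finite_index (slice1 I), finite_index (slice2 I) & finite_index (slice3 I)].
Proof.
by split; apply: finite_index_preim => // x y; rewrite -gr_mkD !addr0.
Qed.

End FreeNilpotent.

(** * Lattices over a discrete valuation ring *)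

(** The features of a discrete valuation ring with uniformizer [pi] and
residue field [k] that lattices see: a lattice contains [pi ^+ N o^n] for some
[N], so all that matters are the quotients [o / pi ^+ N]. *)
Record uniformizer (o : comNzRingType) (k : finFieldType) (rho : {rmorphism o -> k})
    (pi : o) : Prop := Uniformizer {
  res_surj : forall a, exists x, rho x = a;
  res_ker : forall x, (rho x = 0) <-> (exists y, x = pi * y);
  pi_reg : forall x, pi * x = 0 -> x = 0;
  res_unit : forall x, rho x != 0 -> exists y, x * y = 1
}.

Section Lattice.
Local Open Scope classical_set_scope.
Variables (o : comNzRingType) (k : finFieldType) (rho : {rmorphism o -> k}) (pi : o).
Hypothesis uP : uniformizer rho pi.
Local Notation q := #|k|.
Local Notation "v ^r" := (map_mx rho v) (at level 2, format "v ^r").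

Definition res_lift (a : k) : o := sval (cid (res_surj uP a)).
Lemma res_liftK : cancel res_lift rho.
Proof. by move=> a; rewrite /res_lift; case: cid. Qed.

Lemma map_res_lift m n (A : 'M[k]_(m, n)) : (map_mx res_lift A)^r = A.
Proof. by apply/matrixP => i j; rewrite !mxE res_liftK. Qed.

Lemma map_res0 m n (A : 'M[o]_(m, n)) : A^r = 0 -> exists B, A = pi *: B.
Proof.
move=> A0; have ex i j : exists y, A i j = pi * y.
  by apply/(res_ker uP); move/matrixP: A0 => /(_ i j); rewrite !mxE.
exists (\matrix_(i, j) sval (cid (ex i j))); apply/matrixP => i j; rewrite !mxE.
by case: cid.
Qed.

Lemma res_pi : rho pi = 0.
Proof. by apply/(res_ker uP); exists 1; rewrite mulr1. Qed.

Lemma map_res_pi m n (A : 'M[o]_(m, n)) : (pi *: A)^r = 0.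
Proof. by apply/matrixP => i j; rewrite !mxE rmorphM /= res_pi mul0r. Qed.

Lemma scale_pi_inj m n (A B : 'M[o]_(m, n)) : pi *: A = pi *: B -> A = B.
Proof.
move/eqP; rewrite -subr_eq0 -scalerBr => /eqP/matrixP AB; apply/eqP.
rewrite -subr_eq0; apply/eqP/matrixP => i j; rewrite [RHS]mxE.
by apply: (pi_reg uP); have := AB i j; rewrite !mxE.
Qed.

Lemma lift_unitmx n (M : 'M[k]_n) : M \in unitmx ->
  exists A B : 'M[o]_n, [/\ A^r = M, A *m B = 1%:M & B *m A = 1%:M].
Proof.
move=> Mu; pose A := map_mx res_lift M.
have AM : A^r = M by apply: map_res_lift.
have [y yA] : exists y, \det A * y = 1.
  by apply: (res_unit uP); rewrite -det_map_mx AM -unitfE.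
exists A, (y *: \adj A); split=> //.
  by rewrite -scalemxAr mul_mx_adj scale_scalar_mx mulrC yA.
by rewrite -scalemxAl mul_adj_mx scale_scalar_mx mulrC yA.
Qed.

(** Sets of row vectors that happen to be subspaces are turned into matrices,
for which there is a rank. *)
Definition span_mx n (X : set 'rV[k]_n) : 'M[k]_n :=
  <<(\sum_(u : 'rV[k]_n | `[< X u >]) <<u>>)%MS>>%MS.

Lemma span_mxP n (X : set 'rV[k]_n) (u : 'rV[k]_n) :
  X 0 -> (forall a x y, X x -> X y -> X (a *: x + y)) ->
  (u <= span_mx X)%MS <-> X u.
Proof.
move=> X0 XP; rewrite /span_mx genmxE; split=> [/sub_sumsmxP[w ->]|Xu]; last first.
  apply: (submx_trans _ (sumsmx_sup u _ _)); last exact: submx_refl.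
    by rewrite genmxE.
  exact/asboolP.
elim/big_ind: _ => // [x y Xx Xy|v /asboolP Xv].
  by rewrite -(scale1r x); apply: XP.
have : (w v *m <<v>>%MS <= v)%MS by apply: (submx_trans (submxMl _ _)); rewrite genmxE.
by case/sub_rVP => a ->; rewrite -[_ *: _]addr0; apply: XP.
Qed.

Definition red n (I : set 'rV[o]_n) : 'M[k]_n := span_mx [set v^r | v in I].

Lemma redP n (I : set 'rV[o]_n) (u : 'rV[k]_n) : submod I ->
  (u <= red I)%MS <-> exists2 v, I v & v^r = u.
Proof.
move=> sI; apply: span_mxP => [|a _ _ [x Ix <-] [y Iy <-]].
  by exists 0; [apply: sI.1|apply: map_mx0].
exists (res_lift a *: x + y); first exact: sI.2.
by rewrite map_mxD map_mxZ res_liftK.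
Qed.

(** The dimension of [o^n / (I + pi o^n)] over the residue field. *)
Definition rk n (I : set 'rV[o]_n) := (n - \rank (red I))%N.

Lemma rk_le n (I : set 'rV[o]_n) : (rk I <= n)%N.
Proof. exact: leq_subr. Qed.

Lemma rank_red n (I : set 'rV[o]_n) : \rank (red I) = (n - rk I)%N.
Proof. by rewrite /rk subKn // rank_leq_row. Qed.

(** The submodules of finite index: see [lattice_index] and
[finite_index_lattice]. *)
Definition lattice n (I : set 'rV[o]_n) :=
  submod I /\ exists N, forall v, I (pi ^+ N *: v).

(** The step of the recursion. It enlarges a lattice, and repeated it leads to
the whole module. The lattices with a given image correspond to certain
subspaces of [k^n] by [fiber_bij]. *)
Definition der n (I : set 'rV[o]_n) : set 'rV[o]_n := [set x | I (pi *: x)].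

Lemma submod_der n (I : set 'rV[o]_n) : submod I -> submod (der I).
Proof.
move=> sI; split=> [|a x y Ix Iy]; rewrite /der /=; first by rewrite scaler0; apply: sI.1.
by rewrite scalerDr (scale_scaleC pi); apply: sI.2.
Qed.

Lemma sub_der n (I : set 'rV[o]_n) : submod I -> I `<=` der I.
Proof. by move=> sI x Ix; apply: submodZ. Qed.

Lemma red_mono n (I J : set 'rV[o]_n) : submod I -> submod J ->
  I `<=` J -> (red I <= red J)%MS.
Proof.
move=> sI sJ IJ; apply/row_subP => i; apply/redP => //.
have /redP : (row i (red I) <= red I)%MS by apply: row_sub.
by case=> // v Iv vi; exists v => //; apply: IJ.
Qed.

Lemma rk_der n (I : set 'rV[o]_n) : submod I -> (rk (der I) <= rk I)%N.
Proof.
move=> sI; apply: leq_sub2l; apply/mxrankS/red_mono => //.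
  exact: submod_der.
exact: sub_der.
Qed.

Lemma lattice_setT n : lattice [set: 'rV[o]_n].
Proof. by split; [split|exists 0]. Qed.

Lemma lattice_der n (I : set 'rV[o]_n) : lattice I -> lattice (der I).
Proof.
move=> [sI [N IN]]; split; first exact: submod_der.
by exists N => v; rewrite /der /= scale_scaleC; apply: IN.
Qed.

(** A Nakayama argument: if [I] maps onto [k^n], every vector is congruent
modulo [I] to a multiple of [pi ^+ N] for each [N]. *)
Lemma rk0_setT n (I : set 'rV[o]_n) : lattice I -> rk I = 0%N -> I = setT.
Proof.
move=> [sI [N IN]] r0; apply/seteqP; split=> // v _.
have full (u : 'rV_n) : (u <= red I)%MS.
  apply: submx_full; rewrite /row_full eqn_leq rank_leq_row /=.
  by rewrite -subn_eq0; apply/eqP.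
suff [w]: exists w, I (v - pi ^+ N *: w).
  by move=> h; rewrite -(subrK (pi ^+ N *: w) v); apply: submodD.
elim: N {IN} => [|N [w Iw]]; first by exists v; rewrite scale1r subrr; apply: sI.1.
have [x Ix xw] := (redP _ sI).1 (full w^r).
have [y wxy] : exists y, w - x = pi *: y.
  by apply: map_res0; rewrite map_mxB xw subrr.
exists y; rewrite exprSr -scalerA -wxy scalerBr opprB addrA addrAC.
by apply: submodD => //; apply: submodZ.
Qed.

Lemma rk_setT n : rk [set: 'rV[o]_n] = 0%N.
Proof.
apply/eqP; rewrite subn_eq0; apply: eq_leq; apply/esym/eqP.
rewrite -[_ == _]/(row_full _) -sub1mx; apply/row_subP => i.
apply/redP; first by split.
by exists (map_mx res_lift (row i 1%:M)) => //; apply: map_res_lift.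
Qed.

Definition rowspan n (g : 'M[o]_n) : set 'rV[o]_n := [set v *m g | v in setT].
Definition inj_mx n (g : 'M[o]_n) := forall v : 'rV[o]_n, v *m g = 0 -> v = 0.

(** A submodule between [pi Lam] and [Lam], where [Lam] is spanned by the rows
of [g], is given by a subspace of [Lam / pi Lam = k^n]. *)
Definition coords n (g : 'M[o]_n) (I : set 'rV[o]_n) : 'M[k]_n :=
  red [set v | I (v *m g)].

Lemma submod_pre n (g : 'M[o]_n) (I : set 'rV[o]_n) :
  submod I -> submod [set v | I (v *m g)].
Proof.
move=> sI; split=> [|a x y Ix Iy] /=; first by rewrite mul0mx; apply: sI.1.
by rewrite mulmxDl -scalemxAl; apply: sI.2.
Qed.

Lemma coordsP n (g : 'M[o]_n) (I : set 'rV[o]_n) : submod I ->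
  rowspan g `<=` der I -> forall v, I (v *m g) <-> (v^r <= coords g I)%MS.
Proof.
move=> sI gI v; split=> [Iv|/redP[|w /= Iw wv]].
- by apply/redP; [apply: submod_pre|exists v].
- exact: submod_pre.
have [y vwy] : exists y, v - w = pi *: y.
  by apply: map_res0; rewrite map_mxB wv subrr.
rewrite -(subrK w v) vwy mulmxDl -scalemxAl; apply: submodD => //.
by apply: (gI (y *m g)); exists y.
Qed.

(** By induction on [N] the lattice [der I] has a basis. As [I] lies between
[pi (der I)] and [der I], it is given by a subspace [U] of [k^n]. Lift a basis
of [k^n] adapted to [U], and multiply the vectors outside [U] by [pi]. *)
Lemma lattice_free n (I : set 'rV[o]_n) : lattice I ->
  exists2 g : 'M[o]_n, inj_mx g & I = rowspan g.
Proof.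
case=> sI [N]; elim: N I sI => [|N IHN] I sI IN.
  exists 1%:M => [v|]; first by rewrite mulmx1.
  apply/seteqP; split=> v _; first by exists v; rewrite ?mulmx1.
  by have := IN v; rewrite scale1r.
have [|g injg dI] := IHN _ (submod_der sI).
  by move=> v; rewrite /der /= scalerA -exprS; apply: IN.
have gI : rowspan g `<=` der I by rewrite dI.
pose U := coords g I.
have [A [B [AU AB BA]]] := lift_unitmx (row_ebase_unit U).
(* The rows of [A] beyond [\rank U] complete a lifted basis of [U]. *)
pose D : 'M[o]_n := diag_mx (\row_j if (j < \rank U)%N then 1 else pi).
exists (D *m A *m g) => [v|].
  rewrite !mulmxA => /injg; move/(congr1 (mulmx^~ B)).
  rewrite mul0mx -mulmxA AB mulmx1 => /matrixP vD; apply/matrixP => i j.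
  have := vD i j; rewrite mul_mx_diag !mxE.
  by case: ifP => _; rewrite ?mulr1 // mulrC; apply: (pi_reg uP).
have DE (w : 'rV[o]_n) j : (w *m D) 0 j = w 0 j * (if (j < \rank U)%N then 1 else pi).
  by rewrite mul_mx_diag !mxE.
have copE (x : 'rV[k]_n) j : (x *m copid_mx (\rank U)) 0 j = if (j < \rank U)%N then 0 else x 0 j.
  rewrite mulmxBr mulmx1 !mxE (bigD1 j) //= big1 ?addr0 => [|i ij]; last first.
    by rewrite !mxE (_ : (i == j :> nat) = false) ?mulr0 //; apply/negbTE.
  by rewrite !mxE eqxx /=; case: ifP => _; rewrite ?mulr1 ?mulr0 ?subrr ?subr0.
have BU : B^r = invmx (row_ebase U).
  by rewrite -[LHS](mulKmx (row_ebase_unit U)) -AU -map_mxM AB map_mx1 mulmx1.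
have UP (v : 'rV[o]_n) : (v^r <= U)%MS <-> exists w, v *m B = w *m D.
  rewrite submxE /cokermx mulmxA -BU -map_mxM; split=> [/eqP/matrixP h|[w ->]].
    have ex j : exists y, (v *m B) 0 j = y * (if (j < \rank U)%N then 1 else pi).
      have := h 0 j; rewrite copE; case: ifP => [_ _|_]; first by exists ((v *m B) 0 j); rewrite mulr1.
      rewrite mxE [RHS]mxE => /(res_ker uP)[y hy].
      by exists y; rewrite hy mulrC.
    exists (\row_j sval (cid (ex j))); apply/rowP => j.
    by rewrite DE [X in X * _]mxE; case: (cid (ex j)).
  apply/eqP/rowP => j; rewrite copE mxE DE [RHS]mxE; case: (j < \rank U)%N => //.
  by rewrite rmorphM /= res_pi mulr0.
apply/seteqP; split=> x /=.
  move=> Ix; have [v _ vx] : rowspan g x by rewrite -dI; apply: sub_der.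
  move: Ix; rewrite -vx => /(coordsP sI gI)/UP[w vw].
  by exists w => //; rewrite !mulmxA -vw -(mulmxA v) BA mulmx1.
case=> w _ <-; rewrite !mulmxA; apply/(coordsP sI gI)/UP; exists w.
by rewrite -mulmxA AB mulmx1.
Qed.

Lemma lattice_submod n (I : set 'rV[o]_n) : lattice I -> submod I.
Proof. by case. Qed.

Lemma submod_rowspan n (g : 'M[o]_n) : submod (rowspan g).
Proof.
split=> [|a _ _ [x _ <-] [y _ <-]]; first by exists 0; rewrite ?mul0mx.
by exists (a *: x + y); rewrite // mulmxDl -scalemxAl.
Qed.

Section Basis.
Variables (n : nat) (g : 'M[o]_n).
Hypothesis injg : inj_mx g.

Lemma inj_mxP (v w : 'rV[o]_n) : v *m g = w *m g -> v = w.
Proof.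
by move/eqP; rewrite -subr_eq0 -mulmxBl => /eqP/injg/eqP; rewrite subr_eq0 => /eqP.
Qed.

Lemma red_sub (I : set 'rV[o]_n) : submod I -> I `<=` rowspan g ->
  (red I :=: coords g I *m g^r)%MS.
Proof.
move=> sI Ig; apply/eqmxP/andP; split.
  apply/row_subP => i; have /redP : (row i (red I) <= red I)%MS by apply: row_sub.
  case=> // x Ix <-; have [v _ vx] := Ig x Ix; rewrite -vx map_mxM submxMr //.
  by apply/redP; [apply: submod_pre|exists v => //=; rewrite vx].
apply/row_subP => i; rewrite row_mul.
have /redP : (row i (coords g I) <= coords g I)%MS by apply: row_sub.
by case=> [|v /= Iv <-]; [apply: submod_pre|apply/redP => //; exists (v *m g) => //; rewrite map_mxM].
Qed.

Lemma kermx_rowP (A : 'M[k]_n) : (A :&: kermx g^r = 0)%MS <->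
  (forall u : 'rV_n, (u <= A)%MS -> u *m g^r = 0 -> u = 0).
Proof.
split=> [A0 u uA ug|h]; first by apply/eqP; rewrite -submx0 -A0 sub_capmx uA sub_kermx ug eqxx.
apply/eqP/rowV0P => u; rewrite sub_capmx sub_kermx => /andP[uA /eqP ug]; exact: h.
Qed.

(** If [v] is in the kernel, then [v *m g = pi *: x] for some [x]; when this
lies in [I], the hypothesis makes [v] a multiple of [pi]. *)
Lemma coords_ker (I : set 'rV[o]_n) : submod I ->
  (forall x, I (pi *: x) -> rowspan g x) -> (coords g I :&: kermx g^r = 0)%MS.
Proof.
move=> sI Ig; apply/kermx_rowP => _ /redP[|v /= Iv <-]; first exact: submod_pre.
rewrite -map_mxM => /map_res0[x vx].
have [w _ wx] : rowspan g x by apply: Ig; rewrite -vx.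
have -> : v = pi *: w by apply: inj_mxP; rewrite vx -wx -scalemxAl.
exact: map_res_pi.
Qed.

(** Inverse to [coords] on the submodules between [pi Lam] and [Lam]. *)
Definition lat_of (U : 'M[k]_n) : set 'rV[o]_n :=
  [set v *m g | v in [set v : 'rV[o]_n | (v^r <= U)%MS]].

Lemma lat_ofP U v : lat_of U (v *m g) <-> (v^r <= U)%MS.
Proof. by split=> [[w /= wU /inj_mxP <-]|vU] //; exists v. Qed.

Lemma submod_lat_of U : submod (lat_of U).
Proof.
split=> [|a _ _ [x /= Ux <-] [y /= Uy <-]].
  by exists 0; rewrite /= ?mul0mx // map_mx0 sub0mx.
exists (a *: x + y); last by rewrite mulmxDl -scalemxAl.
by rewrite /= map_mxD map_mxZ addmx_sub ?scalemx_sub.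
Qed.

Lemma lat_of_rowspan U : lat_of U `<=` rowspan g.
Proof. by move=> _ [v _ <-]; exists v. Qed.

Lemma rowspan_der_lat_of U : rowspan g `<=` der (lat_of U).
Proof.
by move=> _ [v _ <-]; exists (pi *: v); rewrite ?scalemxAl //= map_res_pi sub0mx.
Qed.

Lemma coords_lat_of U : (coords g (lat_of U) :=: U)%MS.
Proof.
apply/eqmxP/andP; split; apply/row_subP => i.
  have /redP : (row i (coords g (lat_of U)) <= coords g (lat_of U))%MS by apply: row_sub.
  by case=> [|v /= /lat_ofP vU <- //]; apply/submod_pre/submod_lat_of.
apply/redP; first by apply/submod_pre/submod_lat_of.
exists (map_mx res_lift (row i U)); last exact: map_res_lift.
by apply/lat_ofP; rewrite map_res_lift row_sub.
Qed.

Lemma der_lat_of U : (U :&: kermx g^r = 0)%MS -> der (lat_of U) = rowspan g.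
Proof.
move=> /kermx_rowP U0; apply/seteqP; split; last exact: rowspan_der_lat_of.
move=> x [v /= Uv vx]; have /map_res0[w vw] : v^r = 0.
  by apply: U0 => //; rewrite -map_mxM vx map_res_pi.
exists w => //; apply: scale_pi_inj; by rewrite scalemxAl -vw.
Qed.

Lemma lat_of_coords (I : set 'rV[o]_n) : submod I -> I `<=` rowspan g ->
  rowspan g `<=` der I -> lat_of (coords g I) = I.
Proof.
move=> sI Ig gI; apply/seteqP; split=> x.
  by case=> v /= /(coordsP sI gI) ? <-.
by move=> Ix; have [v _ vx] := Ig x Ix; rewrite -vx lat_ofP -coordsP // vx.
Qed.

Lemma rk_rowspan : rk (rowspan g) = \rank (kermx g^r).
Proof.
rewrite mxrank_ker /rk; congr (_ - _)%N; apply: eqmx_rank; apply/eqmxP.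
apply: eqmx_trans (red_sub (submod_rowspan g) (fun _ => id)) _.
apply/eqmxMfull; rewrite -sub1mx; apply/row_subP => i; apply/redP.
  exact/submod_pre/submod_rowspan.
exists (map_mx res_lift (row i 1%:M)); last exact: map_res_lift.
by eexists.
Qed.

Lemma rank_coords (I : set 'rV[o]_n) : submod I -> I `<=` rowspan g ->
  (coords g I :&: kermx g^r = 0)%MS -> \rank (coords g I) = \rank (red I).
Proof.
by move=> sI Ig I0; rewrite (red_sub sI Ig) -[LHS](mxrank_mul_ker _ g^r) I0 mxrank0 addn0.
Qed.

End Basis.

Lemma lat_of_lattice n (g : 'M[o]_n) U : lattice (rowspan g) -> lattice (lat_of g U).
Proof.
move=> [_ [N gN]]; split; first exact: submod_lat_of.
exists N.+1 => v; rewrite exprS -scalerA.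
by have := gN v; apply: rowspan_der_lat_of.
Qed.

Definition fiber n (J B : set 'rV[o]_n) r : set (set 'rV[o]_n) :=
  [set I | [/\ lattice I, der I = J, rk I = r & B `<=` I]].

(** In the coordinates of [J], a lattice [I] with [der I = J] is a subspace of
[k^n] that meets the kernel of the map to [o^n / pi o^n] trivially. This
kernel has dimension [rk J], the subspace has dimension [n - rk I], and [B]
gives a subspace that it has to contain. *)
Lemma fiber_bij n (J B : set 'rV[o]_n) r d :
  lattice J -> submod B -> B `<=` J -> (forall x, B (pi *: x) -> J x) ->
  n = (\rank (red B) + d + r)%N ->
  exists (S : {set 'M[k]_n}) (f : 'M[k]_n -> set 'rV[o]_n),
    set_bij [set` S] (fiber J B r) f /\
    (#|S| * \prod_(i < d) (q ^ (\rank (red B) + d) - q ^ (\rank (red B) + i))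
     = \prod_(i < d) (q ^ n - q ^ (\rank (red B) + rk J + i)))%N.
Proof.
move=> lJ sB BJ piB nE; have [g injg gJ] := lattice_free lJ.
rewrite gJ in lJ BJ piB *.
have BU0 := coords_ker injg sB piB.
have nr : (n - r)%N = (\rank (red B) + d)%N by rewrite {1}nE addnK.
exists (subspaces_over (coords g B) (kermx g^r) (\rank (red B) + d)%N), (lat_of g); split.
  split.
  - move=> U; rewrite /= inE => /and4P[_ BU /eqP dU /eqP UR].
    have U0 : (U :&: kermx g^r = 0)%MS.
      by apply/eqP; rewrite -mxrank_eq0 -(eqn_add2l (\rank (U + kermx g^r)%MS)) mxrank_sum_cap UR addn0.
    split; [exact: lat_of_lattice|exact: der_lat_of| |].
      have cU := coords_lat_of injg U.
      have := rank_coords (submod_lat_of g U) (@lat_of_rowspan _ g U).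
      rewrite cU => /(_ _); rewrite /rk => <-.
        by rewrite dU {1}nE addKn.
      by apply/eqP; rewrite -submx0 -U0; apply: capmxS => //; rewrite cU.
    move=> x Bx; have [v _ vx] := BJ x Bx; rewrite -vx lat_ofP //.
    apply: submx_trans BU; apply/redP; first exact: submod_pre.
    by exists v => //=; rewrite vx.
  - move=> U V; rewrite !in_setE /= !inE => /andP[/eqP gU _] /andP[/eqP gV _] UV.
    rewrite -gU -gV; apply/genmxP/eqmxP.
    by apply: eqmx_trans (coords_lat_of injg V); rewrite -UV; apply/eqmx_sym/coords_lat_of.
  - move=> I [lI dI rI BI]; have sI := lattice_submod lI.
    have Ig : I `<=` rowspan g by rewrite -dI; apply: sub_der.
    have gI : rowspan g `<=` der I by rewrite dI.
    have I0 : (coords g I :&: kermx g^r = 0)%MS.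
      by apply: coords_ker => // x Ix; rewrite -dI.
    exists (coords g I); last exact: lat_of_coords.
    rewrite /= inE rank_coords // rank_red rI nr eqxx genmx_id eqxx /=.
    rewrite red_mono //=; [|exact: submod_pre|exact: submod_pre|by move=> x; apply: BI].
    apply/eqP; rewrite -[LHS]addn0 -[X in (_ + X)%N](mxrank0 k n n) -I0 mxrank_sum_cap.
    by rewrite rank_coords // rank_red rI nr.
rewrite -(rank_coords sB BJ BU0) rk_rowspan card_subspaces_over //.
by rewrite -mxrank_sum_cap BU0 mxrank0 addn0.
Qed.

(** The quotient of [der I] by [I] is a vector space over [k] of dimension [rk
I]: it is [k^n] modulo the subspace [coords g I], for a basis [g] of [der I].
*)
Lemma transversal_der n (I : set 'rV[o]_n) (T : finType) (f : T -> 'rV[o]_n) :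
  lattice I -> transversal f (der I) ->
  exists f' : T * 'rV[k]_(rk I) -> 'rV[o]_n, transversal f' I.
Proof.
move=> lI [fex finj]; have sI := lattice_submod lI.
have [g injg dI] := lattice_free (lattice_der lI).
have gI : rowspan g `<=` der I by rewrite dI.
have Ig : I `<=` rowspan g by rewrite -dI; apply: sub_der.
pose U := coords g I.
have rU : \rank U = (n - rk I)%N.
  by rewrite rank_coords ?rank_red //; apply: coords_ker => // x Ix; rewrite -dI.
have rC : \rank (U^C)%MS = rk I by rewrite mxrank_compl rU subKn // rk_le.
move: (rk I) rC => r <- {rU}; pose C := row_base (U^C)%MS.
have UC (u : 'rV[k]_n) : exists w, (u - w *m C <= U)%MS.
  have : (u <= U + U^C)%MS by apply: submx_full; apply: addsmx_compl_full.
  case/sub_addsmxP=> -[a b] /= ->.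
  have /submxP[w ->] : (b *m U^C <= C)%MS by rewrite eq_row_base submxMl.
  by exists w; rewrite addrK submxMl.
have UC0 (w : 'rV_(\rank U^C)) : (w *m C <= U)%MS -> w = 0.
  move=> wU; have : (w *m C <= U :&: U^C)%MS.
    rewrite sub_capmx wU; apply: (submx_trans (submxMl _ _)).
    by rewrite eq_row_base.
  rewrite capmx_compl submx0 => /eqP; rewrite -(mul0mx _ C).
  by apply/row_free_inj/row_base_free.
pose f' p : 'rV[o]_n := f p.1 + map_mx res_lift (p.2 *m C) *m g.
exists f'; split=> [x|[s v] [t w]].
  have [t] := fex x; rewrite dI => -[v _ vx].
  have [w wU] := UC v^r; exists (t, w); rewrite /f' /= opprD addrA -vx -mulmxBl.
  by apply/(coordsP sI gI); rewrite map_mxB map_res_lift.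
rewrite /f' /= => st; have ist : I (f s - f t + map_mx res_lift (v *m C) *m g - map_mx res_lift (w
  *m C) *m g).
  by move: st; congr I; rewrite opprD addrACA -!addrA; congr (_ + _); rewrite addrCA.
have est : s = t.
  apply: finj; rewrite -[_ - _](subrK (map_mx res_lift (w *m C) *m g - map_mx res_lift (v *m C) *m g)).
  apply: submodD; [exact: submod_der| |].
    by apply: sub_der => //; move: ist; congr I; rewrite opprB -!addrA.
  by rewrite -mulmxBl; apply: gI; eexists.
congr (_, _) => //; apply/eqP; rewrite -subr_eq0; apply/eqP/UC0.
move: ist; rewrite est subrr add0r -mulmxBl => /(coordsP sI gI).
by rewrite map_mxB !map_res_lift mulmxBl.
Qed.

Lemma lattice_transversal n (I : set 'rV[o]_n) : lattice I ->
  exists (T : finType) (f : T -> 'rV[o]_n) N, transversal f I /\ #|T| = (q ^ N)%N.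
Proof.
case=> sI [N]; elim: N I sI => [|N IHN] I sI IN.
  exists unit, (fun=> 0), 0%N; split; last by rewrite card_unit.
  by split=> [x|[] [] //]; exists tt; rewrite subr0 -[x]scale1r; apply: IN.
have [|T [f [M [fI cT]]]] := IHN _ (submod_der sI).
  by move=> v; rewrite /der /= scalerA -exprS; apply: IN.
have [|f' f'I] := transversal_der _ fI; first by split=> //; exists N.+1.
exists (T * 'rV[k]_(rk I))%type, f', (M + rk I)%N; split=> //.
by rewrite card_prod card_mx mul1n cT expnD.
Qed.

Lemma lattice_index n (I : set 'rV[o]_n) : lattice I ->
  finite_index I /\ exists N, coset_index I = (q ^ N)%N.
Proof.
move=> lI; have [T [f [N [fI cT]]]] := lattice_transversal lI.
have [fin ->] := transversal_index (submod_subgroup (lattice_submod lI)) fI.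
by split=> //; exists N.
Qed.

Lemma index_der n (I : set 'rV[o]_n) : lattice I ->
  coset_index I = (q ^ rk I * coset_index (der I))%N.
Proof.
move=> lI; have lD := lattice_der lI.
have [T [f [N [fI cT]]]] := lattice_transversal lD.
have [f' f'I] := transversal_der lI fI.
rewrite (transversal_index (submod_subgroup (lattice_submod lI)) f'I).2.
rewrite (transversal_index (submod_subgroup (lattice_submod lD)) fI).2.
by rewrite card_prod card_mx mul1n mulnC.
Qed.

Lemma index_setT n : coset_index [set: 'rV[o]_n] = 1%N.
Proof.
have lT := lattice_setT n; have sT := submod_subgroup (lattice_submod lT).
have [|_ ->] := @transversal_index _ unit (fun=> 0) _ sT; last exact: card_unit.
by split=> [x|[] []//]; exists tt.
Qed.

(** Two of the vectors [pi ^+ i *: v] are congruent modulo [I], and [1 - pi ^+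
m] is a unit for [m > 0]. *)
Lemma finite_index_lattice n (I : set 'rV[o]_n) :
  submod I -> finite_index I -> lattice I.
Proof.
move=> sI fin; split=> //; have sgI := submod_subgroup sI.
have [T [f [fex finj]]] := index_transversal sgI fin.
have ex v : exists N, I (pi ^+ N *: v).
  have [t tP] : exists t : nat -> T, forall i, I (pi ^+ i *: v - f (t i)).
    by have /choice[t] := fun i => fex (pi ^+ i *: v); exists t.
  have [i [j [ij tij]]] : exists i j, (i < j)%N /\ t i = t j.
    apply: contrapT => /forallNP h.
    have inj : injective (fun i : 'I_#|T|.+1 => t i).
      move=> a b tab; apply/val_inj; case: (ltngtP a b) => // ab.
        by case: (h a); exists b.
      by case: (h b); exists a.
    by have := leq_card _ inj; rewrite card_ord ltnn.
  have : I ((pi ^+ i * (1 - pi ^+ (j - i))) *: v).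
    rewrite mulrBr mulr1 -exprD subnKC ?(ltnW ij) // scalerBl.
    have := submodBr sI (tP i) (tP j); rewrite tij.
    by congr I; rewrite opprB addrA subrK.
  (* [pi ^+ i (1 - pi ^+ (j - i)) v] lies in [I]. *)
  have [y yP] : exists y, (1 - pi ^+ (j - i)) * y = 1.
    apply: (res_unit uP); rewrite rmorphB rmorphXn /= res_pi rmorph1 expr0n.
    by rewrite subn_eq0 leqNgt ij subr0 oner_eq0.
  by move/(submodZ sI y); rewrite scalerA mulrCA [y * _]mulrC yP mulr1; exists i.
pose N j := sval (cid (ex (delta_mx 0 j))).
exists (\sum_j N j)%N => v; rewrite [v]row_sum_delta scaler_sumr.
apply: submod_sum => // j _; rewrite scale_scaleC; apply: submodZ => //.
rewrite (bigD1 j) //= addnC exprD -scalerA; apply: submodZ => //.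
by rewrite /N; case: cid.
Qed.

Lemma transversal_mulmx n (g : 'M[o]_n) (I : set 'rV[o]_n) (S T : finType) f h :
  inj_mx g -> submod I -> @transversal _ S f (rowspan g) -> @transversal _ T h I ->
  transversal (fun p : S * T => f p.1 + h p.2 *m g) [set v *m g | v in I].
Proof.
move=> injg sI [fex finj] [hex hinj]; split=> [x|[s t] [s' t']] /=.
  have [s [v _ vx]] := fex x; have [t Iv] := hex v.
  by exists (s, t) => /=; exists (v - h t); rewrite // mulmxBl vx opprD addrA.
case=> v Iv; rewrite opprD addrACA -mulmxBl => vs.
have ss : s = s'.
  apply: finj; exists (v - (h t - h t')) => //; rewrite mulmxBl vs addrK //.
rewrite ss subrr add0r in vs; congr (_, _) => //.
by apply: hinj; rewrite -(inj_mxP injg vs).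
Qed.

Lemma lattice_mulmx n (g : 'M[o]_n) (I : set 'rV[o]_n) :
  inj_mx g -> lattice I -> lattice (rowspan g) ->
  lattice [set v *m g | v in I] /\
  coset_index [set v *m g | v in I] = (coset_index I * coset_index (rowspan g))%N.
Proof.
move=> injg lI lg; have [sI [N IN]] := lI; have [sg [M gM]] := lg.
have sIg : submod [set v *m g | v in I].
  split=> [|a _ _ [v Iv <-] [w Iw <-]].
    by exists 0; [apply: sI.1|rewrite mul0mx].
  by exists (a *: v + w); [apply: sI.2|rewrite mulmxDl -scalemxAl].
split.
  split=> //; exists (N + M)%N => v; have [w _ wv] := gM v.
  by exists (pi ^+ N *: w); rewrite // -scalemxAl wv scalerA -exprD.
have [T [f [i [fg _]]]] := lattice_transversal lg.
have [S [h [j [hI _]]]] := lattice_transversal lI.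
rewrite (transversal_index (submod_subgroup sIg) (transversal_mulmx injg sI fg hI)).2.
rewrite (transversal_index (submod_subgroup sg) fg).2.
by rewrite (transversal_index (submod_subgroup sI) hI).2 card_prod mulnC.
Qed.

(** * Brackets and centers modulo the uniformizer *)

Lemma cross_eq0_colinear (F : fieldType) (a b : 'rV[F]_3) : a != 0 -> cross a b = 0 ->
  exists c, b = c *: a.
Proof.
move=> a0 ab0; have [i ai] : exists i, a 0 i != 0.
  by apply/rV0Pn.
have h : (a 0 1 * b 0 ord_max = a 0 ord_max * b 0 1) /\
    (a 0 ord_max * b 0 0 = a 0 0 * b 0 ord_max) /\ (a 0 0 * b 0 1 = a 0 1 * b 0 0).
  by have := crossE a b; rewrite ab0 !mxE => -[[h0 h1] h2];
    do !split; apply/eqP; rewrite -subr_eq0 -?h0 -?h1 -?h2.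
have P j l : a 0 j * b 0 l = a 0 l * b 0 j.
  by case: h => h0 [h1 h2]; elim/ord3_cases: j; elim/ord3_cases: l; rewrite ?h0 ?h1 ?h2.
exists (b 0 i / a 0 i); apply/rowP => j; apply: (mulfI ai).
by rewrite P mxE mulrA [a 0 i * _]mulrC divfK // mulrC.
Qed.

(** The span of the vectors [bracket23 x e] with [x] in [I]: a sum of matrices
[e^T *m x] is an arbitrary matrix with rows in [I]. This form avoids linear
combinations. *)
Definition bracket_span (I : set 'rV[o]_3) : set 'rV[o]_8 :=
  [set vec8 A | A in [set A | forall i, I (row i A)]].

Lemma submod_bracket_span I : submod I -> submod (bracket_span I).
Proof.
move=> sI; split=> [|a _ _ [A IA <-] [B IB <-]].
  exists 0 => [i|]; first by rewrite row0; apply: sI.1.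
  exact: vec8_0.
exists (a *: A + B); last exact: vec8P.
by move=> i; rewrite linearP; apply: sI.2; [apply: IA|apply: IB].
Qed.

Lemma bracket_spanP (I : set 'rV[o]_3) (J : set 'rV[o]_8) : submod I -> submod J ->
  (forall x e, I x -> J (bracket23 x e)) <-> bracket_span I `<=` J.
Proof.
move=> sI sJ; split=> [h _ [A IA <-]|h x e Ix].
  have -> : A = \sum_i (delta_mx 0 i)^T *m row i A.
    apply/matrixP => i j; rewrite summxE (bigD1 i) //= big1 => [|l li].
      by rewrite !mxE big_ord1 !mxE !eqxx mul1r addr0.
    by rewrite !mxE big_ord1 !mxE eqxx eq_sym (negPf li) mul0r.
  by rewrite vec8_sum; apply: submod_sum => // i _; apply: h.
apply: h; exists (e^T *m x) => // i; rewrite row_mul.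
have -> : row i e^T = (e 0 i)%:M by apply/matrixP => a b; rewrite !mxE !ord1 eqxx.
by rewrite mul_scalar_mx; apply: submodZ.
Qed.

(** The values for [r = 0, 1, 2, 3] of the function in [rank_bracket_span]. *)
Definition corank_bracket r := nth 0%N [:: 0; 2; 5; 8] r.
(** The values for [r = 0, 1, 2, 3] of the function in [rk_center]. *)
Definition rank_center r := nth 0%N [:: 0; 2; 3; 3] r.

(** A nonzero scalar matrix has rank 3. *)
Lemma vec8_ker (F : fieldType) m (V : 'M[F]_(m, 3)) (A : 'M[F]_3) :
  (\rank V < 3)%N -> (A <= V)%MS -> vec8 A = 0 -> A = 0.
Proof.
move=> rV AV /vec8_eq0 Ac; rewrite Ac; apply/eqP; rewrite -scalemx1 scaler_eq0.
apply/orP; left; apply/negP => /negP c0.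
have : (\rank A < 3)%N by apply: leq_ltn_trans rV; apply: mxrankS.
by rewrite Ac -scalemx1 mxrank_scale_nz // mxrank1.
Qed.

Lemma row_redP n m (I : set 'rV[o]_n) (A : 'M[k]_(m, n)) : submod I -> (A <= red I)%MS ->
  exists2 B : 'M[o]_(m, n), (forall i, I (row i B)) & B^r = A.
Proof.
move=> sI AI; have ex i : exists v, I v /\ v^r = row i A.
  have /redP : (row i A <= red I)%MS by apply: submx_trans AI; apply: row_sub.
  by case=> // v Iv vA; exists v.
exists (\matrix_i sval (cid (ex i))) => [i|]; first by rewrite rowK; case: cid => ? [].
by apply/row_matrixP => i; rewrite -map_row rowK; case: cid => ? [].
Qed.

(** Let [V = red I]. If [V] is a proper subspace, no nonzero scalar matrix has
its rows in [V], and the space of matrices with rows in [V], of dimension [3 *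
\rank V], embeds into [k^8]. *)
Lemma rank_bracket_span I : submod I ->
  \rank (red (bracket_span I)) = (8 - corank_bracket (rk I))%N.
Proof.
move=> sI; have q1 : (1 < q)%N := finNzRing_gt1 _.
have BP (u : 'rV[k]_8) : (u <= red (bracket_span I))%MS <->
    exists2 A : 'M[k]_3, (A <= red I)%MS & vec8 A = u.
  split=> [/redP[|_ [A IA <-] <-]|[A AI <-]]; first exact: submod_bracket_span.
    exists A^r; last by rewrite map_vec8.
    by apply/row_subP => i; rewrite -map_row; apply/redP => //; exists (row i A).
  have [B IB <-] := row_redP sI AI; apply/redP; first exact: submod_bracket_span.
  by exists (vec8 B); [exists B|rewrite map_vec8].
have rk3 := rank_leq_row (red I); have : rk I = (3 - \rank (red I))%N by [].
case: (ltnP (\rank (red I)) 3) => [lt3|ge3] ->; last first.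
  have full : row_full (red I) by rewrite /row_full eqn_leq rk3.
  rewrite (_ : 3 - _ = 0)%N /=; last by apply/eqP; rewrite subn_eq0.
  apply/eqP; rewrite subn0 -[_ == _]/(row_full _) -sub1mx; apply/row_subP => i.
  by apply/BP; exists (mat8 (row i 1%:M)); [apply: submx_full|rewrite mat8K].
have -> : (8 - corank_bracket (3 - \rank (red I)) = 3 * \rank (red I))%N.
  by move: lt3; case: (\rank _) => [|[|[|]]].
apply/eqP; rewrite -(eqn_exp2l _ _ q1) -card_rV_sub -card_mx.
pose f (X : 'M[k]_(3, \rank (red I))) := vec8 (X *m row_base (red I)).
have finj : injective f.
  move=> X Y XY; apply: (row_free_inj (row_base_free (red I))).
  apply/eqP; rewrite -subr_eq0 -mulmxBl; apply/eqP/(vec8_ker lt3).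
    by apply: submx_trans (submxMl _ _) _; rewrite eq_row_base.
  by rewrite mulmxBl -[_ - _]addrC -scaleN1r vec8P scaleN1r -/(f X) XY addNr.
rewrite -(card_imset _ finj); apply/eqP/eq_card => u.
rewrite inE; apply/idP/imsetP => [/BP[A AI <-]|[X _ ->]].
  have /submxP[X ->] : (A <= row_base (red I))%MS by rewrite eq_row_base.
  by exists X.
apply/BP; exists (X *m row_base (red I)) => //.
by apply: submx_trans (submxMl _ _) _; rewrite eq_row_base.
Qed.

(** If [red I] is a proper subspace, no nonzero scalar matrix has its rows
there, and a matrix with rows in [I] that is divisible by [pi] modulo scalars
is divisible by [pi]. Otherwise [I] is everything. *)
Lemma bracket_span_pi I x : lattice I -> bracket_span I (pi *: x) -> bracket_span (der I) x.
Proof.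
move=> lI [A IA Ax]; have sI := lattice_submod lI.
have [r0|r0] := eqVneq (rk I) 0%N.
  exists (mat8 x); last exact: mat8K.
  by move=> i; apply: sub_der => //; rewrite (rk0_setT lI r0).
have /map_res0[B AB] : A^r = 0.
  apply: (@vec8_ker _ _ (red I)).
  - by rewrite ltnNge -subn_eq0.
  - by apply/row_subP => i; rewrite -map_row; apply/redP => //; exists (row i A).
  - by rewrite -map_vec8 Ax map_res_pi.
exists B => [i|]; first by have := IA i; rewrite AB linearZ.
by apply: scale_pi_inj; rewrite -Ax AB -[_ *: B]addr0 vec8P vec8_0 addr0.
Qed.

(** In the quotient of the free nilpotent algebra of class 2 by a lattice [I]
in degree 2, this is the part of degree 1 of the center. *)
Definition center (I : set 'rV[o]_3) : set 'rV[o]_3 := [set x | forall y, I (cross x y)].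

Lemma center_der I : der (center I) = center (der I).
Proof.
by apply/seteqP; split=> x h y; have := h y; rewrite /der /= crossZl.
Qed.

Lemma lattice_center I : lattice I -> lattice (center I).
Proof.
move=> [sI [N IN]]; split; last by exists N => v y; rewrite crossZl.
split=> [y|a x y Ix Iy z]; last by rewrite crossPl; apply: sI.2.
by rewrite -(scale0r 0) crossZl scale0r; apply: sI.1.
Qed.

Lemma minor_rank1 (F : fieldType) m n (V : 'M[F]_(m, n)) (u w : 'rV[F]_n) i j :
  (\rank V <= 1)%N -> (u <= V)%MS -> (w <= V)%MS -> u 0 i * w 0 j = u 0 j * w 0 i.
Proof.
move=> V1 uV wV; have [->|u0] := eqVneq u 0; first by rewrite !mxE !mul0r.
have Vu : (V <= u)%MS.
  by rewrite -(geq_leqif (mxrank_leqif_sup uV)) rank_rV u0.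
by have /sub_rVP[c ->] := submx_trans wV Vu; rewrite !mxE mulrCA [RHS]mulrCA (mulrC (u 0 i)).
Qed.

(** Modulo [pi], an element [u] of the center satisfies [u x k^3 <= V] with [V
= red I], where [u x k^3] is the plane orthogonal to [u] if [u] is not zero.
If [V] is at most a line, then [u = 0]; if [V] is a plane, [u] is on its
normal, and the cross product of lifts of two basis vectors of [V] is in the
center by [cross_cross]. *)
Lemma rk_center I : lattice I -> rk (center I) = rank_center (rk I).
Proof.
move=> lI; have sI := lattice_submod lI.
have [lC sC] := (lattice_center lI, lattice_submod (lattice_center lI)).
have [r0|r0] := eqVneq (rk I) 0%N.
  rewrite r0 /= (_ : center I = setT) ?rk_setT //; apply/seteqP; split=> // x _ y.
  by rewrite (rk0_setT lI r0).
pose V := red I; have V2 : (\rank V < 3)%N by rewrite ltnNge -subn_eq0.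
have CV (u y : 'rV[k]_3) : (u <= red (center I))%MS -> (cross u y <= V)%MS.
  case/redP => // x Cx <-; have {y} [z <-] : exists z, z^r = y.
    by exists (map_mx res_lift y); apply: map_res_lift.
  by rewrite -map_cross; apply/redP => //; exists (cross x z).
have rI : rk I = (3 - \rank V)%N by [].
have [V1|V1] := leqP (\rank V) 1%N.
  have -> : rank_center (rk I) = 3%N by rewrite rI; move: V1; case: (\rank V) => [|[|]].
  rewrite /rk; suff -> : red (center I) = 0 by rewrite mxrank0.
  apply/eqP/rowV0P => u Cu.
  have E y z i j : cross u y 0 i * cross u z 0 j = cross u y 0 j * cross u z 0 i.
    exact: minor_rank1 (V1) (CV _ _ Cu) (CV _ _ Cu).
  have sq0 (x : k) : x * x = 0 -> x = 0.
    by move/eqP; rewrite mulf_eq0 orbb => /eqP.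
  apply: row3P; rewrite [RHS]mxE; apply: sq0.
  - by have := E (delta_mx 0 1) (delta_mx 0 ord_max) 1 ord_max;
      rewrite !crossE !mxE !eqxx -!val_eqE /= => /eqP; rewrite -subr_eq0 => /eqP <-; ring.
  - by have := E (delta_mx 0 0) (delta_mx 0 ord_max) 0 ord_max;
      rewrite !crossE !mxE !eqxx -!val_eqE /= => /eqP; rewrite -subr_eq0 => /eqP <-; ring.
  - by have := E (delta_mx 0 0) (delta_mx 0 1) 0 1;
      rewrite !crossE !mxE !eqxx -!val_eqE /= => /eqP; rewrite -subr_eq0 => /eqP <-; ring.
have rV : \rank V = 2 by apply/eqP; rewrite eqn_leq -ltnS V2 V1.
have [a aV a0] : exists2 a : 'rV[k]_3, (a <= V)%MS & a != 0.
  by apply/rowV0Pn; rewrite -mxrank_eq0 rV.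
have [b bV ba] : exists2 b : 'rV[k]_3, (b <= V)%MS & ~~ (b <= a)%MS.
  have : ~~ (V <= a)%MS.
    by apply/negP => /mxrankS; rewrite rV => /leq_trans/(_ (rank_leq_row _)).
  by case/row_subPn => i Vi; exists (row i V); rewrite ?row_sub.
pose n := cross a b.
have n0 : n != 0.
  apply/eqP => /(cross_eq0_colinear a0)[c bc]; case/negP: ba; apply/sub_rVP.
  by exists c.
have nC : (n <= red (center I))%MS.
  have [a' Ia aa] := (redP a sI).1 aV; have [b' Ib bb] := (redP b sI).1 bV.
  rewrite /n -aa -bb -map_cross; apply/redP => //; exists (cross a' b') => // z.
  by rewrite cross_cross; apply: submodBr => //; apply: submodZ.
have Cn : (red (center I) <= n)%MS.
  apply/row_subP => i; set u := row i _.
  have Cu : (u <= red (center I))%MS by apply: row_sub.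
  suff /(cross_eq0_colinear n0)[c ->] : cross n u = 0 by apply: scalemx_sub.
  apply/rowP => j; rewrite -dot_delta -dot_cross [RHS]mxE.
  have : (cross u (delta_mx 0 j) <= a + b)%MS.
    apply: submx_trans (CV _ _ Cu) _.
    have abV : (a + b <= V)%MS by rewrite addsmx_sub aV bV.
    rewrite -(geq_leqif (mxrank_leqif_sup abV)) rank_adds_row // rV.
    by rewrite rank_rV a0.
  move/sub_addsmxP => [[s t] /= ->].
  rewrite [s]mx11_scalar [t]mx11_scalar !mul_scalar_mx dotC dotPl.
  by rewrite dotZ (dotC a) (dotC b) dot_crossl dot_crossr !mulr0 addr0.
have -> : rank_center (rk I) = 2 by rewrite rI rV.
rewrite /rk; have -> : \rank (red (center I)) = \rank n.
  by apply/eqP; rewrite eqn_leq !mxrankS.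
by rewrite rank_rV n0.
Qed.

(** * The recursion for the sums over lattices *)

(** For [x = #|F|] this is the number of subspaces in [card_subspaces_over],
with [b] and [s] for the ranks of [B] and [R], and [d] for [k]. *)
Definition subspace_count (K : fieldType) (x : K) n b s d : K :=
  \prod_(i < d) ((x ^+ n - x ^+ (b + s + i)) / (x ^+ (b + d) - x ^+ (b + i))).

Lemma subspace_count_ge0 (K : realFieldType) (x : K) n b s d :
  1 <= x -> (b + s + d <= n)%N -> 0 <= subspace_count x n b s d.
Proof.
move=> x1 bsd; apply: prodr_ge0 => i _; rewrite divr_ge0 // subr_ge0 ler_weXn2l //.
  by rewrite (leq_trans _ bsd) // leq_add2l ltnW.
by rewrite leq_add2l ltnW.
Qed.

Lemma submod0 n : submod [set (0 : 'rV[o]_n)].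
Proof. by split=> [|a x y -> ->] //=; rewrite scaler0 addr0. Qed.

Lemma rank_red0 n : \rank (red [set (0 : 'rV[o]_n)]) = 0%N.
Proof.
apply/eqP; rewrite mxrank_eq0; apply/eqP/row_matrixP => i; rewrite row0.
have /redP : (row i (red [set (0 : 'rV[o]_n)]) <= red [set (0 : 'rV[o]_n)])%MS by apply: row_sub.
by case=> [|x -> <-]; [apply: submod0|rewrite map_mx0].
Qed.

Section Fibers.
Variable R : realType.
Local Open Scope ereal_scope.

Lemma natr_prod_subX (x n d : nat) (f : nat -> nat) :
  (0 < x)%N -> (forall i, (i < d)%N -> (f i <= n)%N) ->
  (\prod_(i < d) (x ^ n - x ^ f i))%N%:R = (\prod_(i < d) (x%:R ^+ n - x%:R ^+ f i))%R :> R.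
Proof.
move=> x0 fn; rewrite natr_prod; apply: eq_bigr => i _.
by rewrite natrB ?leq_pexp2l ?fn // !natrX.
Qed.

Lemma esum_fiber n (J B : set 'rV[o]_n) r d (x : R) :
  lattice J -> submod B -> B `<=` J -> (forall y, B (pi *: y) -> J y) ->
  n = (\rank (red B) + d + r)%N -> (rk J <= r)%N -> (0 <= x)%R ->
  \esum_(I in fiber J B r) x%:E =
  (subspace_count (q%:R : R) n (\rank (red B)) (rk J) d * x)%:E.
Proof.
move=> lJ sB BJ piB nE rJ x0.
have [S [f [fS cS]]] := fiber_bij lJ sB BJ piB nE.
rewrite (@reindex_esum R _ _ _ _ _ (fun=> x%:E) fS) esum_card_const //; congr (_ * _)%:E.
have q1 : (1 < q)%N := finNzRing_gt1 _.
set b := \rank (red B) in nE cS *; have q0 := ltnW q1.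
apply: (mulIf (x := \prod_(i < d) ((q%:R : R) ^+ (b + d) - q%:R ^+ (b + i))))%R.
  apply/prodf_neq0 => i _; rewrite subr_eq0 -!natrX eqr_nat eqn_exp2l //.
  by rewrite eqn_add2l gtn_eqF.
have den : forall i, (i < d)%N -> (b + i <= b + d)%N by move=> i id; rewrite leq_add2l ltnW.
have num : forall i, (i < d)%N -> (b + rk J + i <= n)%N.
  by move=> i id; apply: (@leq_trans (b + r + d)%N); [rewrite !leq_add // ltnW|rewrite addnAC -nE].
rewrite -(natr_prod_subX q0 den) -natrM cS (natr_prod_subX q0 num).
rewrite (natr_prod_subX q0 den).
rewrite /subspace_count -big_split /=; apply: eq_bigr => i _.
rewrite mulfVK // subr_eq0 -!natrX eqr_nat eqn_exp2l //.
by rewrite eqn_add2l gtn_eqF.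
Qed.

Variable w : nat -> R.
Hypotheses (w1 : w 1 = 1%R) (w_ge0 : forall n, (0 <= w n)%R)
  (wM : forall m n, (0 < m)%N -> (0 < n)%N -> w (m * n)%N = (w m * w n)%R).
Local Notation t := (w q).

Lemma wX n : w (q ^ n)%N = (t ^+ n)%R.
Proof.
elim: n => [|n IHn]; first by rewrite expn0 w1.
have q0 : (0 < q)%N := ltnW (finNzRing_gt1 _).
by rewrite expnS wM ?expn_gt0 ?q0 // IHn exprS.
Qed.

Lemma w_der n (I : set 'rV[o]_n) : lattice I ->
  w (coset_index I) = (t ^+ rk I * w (coset_index (der I)))%R.
Proof.
move=> lI; have q0 : (0 < q)%N := ltnW (finNzRing_gt1 _).
rewrite (index_der lI) wM ?expn_gt0 ?q0 ?wX //.
by have [_ [N ->]] := lattice_index (lattice_der lI); rewrite expn_gt0 q0.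
Qed.

(** The same recursion governs the pairs of lattices [(I, J)] with [J]
containing the lattice spanned by the brackets of [I], and single lattices
[I] (take [J] to be everything): [Bs I] is what [J] has to contain and [Cn I]
is the lattice whose index contributes an additional weight. *)
Section Recursion.
Variables (Bs : set 'rV[o]_3 -> set 'rV[o]_8) (Cn : set 'rV[o]_3 -> set 'rV[o]_3).
Variables c z : nat -> nat.
Hypotheses (c_le8 : forall r, (c r <= 8)%N) (c0 : c 0 = 0%N) (z0 : z 0 = 0%N).
Hypotheses (sBs : forall I, submod I -> submod (Bs I))
  (rBs : forall I, submod I -> \rank (red (Bs I)) = (8 - c (rk I))%N)
  (dBs : forall I, lattice I -> der (Bs I) = Bs (der I)).
Hypotheses (lCn : forall I, lattice I -> lattice (Cn I))
  (rCn : forall I, lattice I -> rk (Cn I) = z (rk I))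
  (dCn : forall I, lattice I -> der (Cn I) = Cn (der I)).

Local Notation pair := (set 'rV[o]_3 * set 'rV[o]_8)%type.

Definition lat_pairs : set pair :=
  [set p | [/\ lattice p.1, lattice p.2 & Bs p.1 `<=` p.2]].
Definition pair_weight (p : pair) : R :=
  (w (coset_index p.1) * w (coset_index (Cn p.1)) * w (coset_index p.2))%R.
Definition pair_der (p : pair) : pair := (der p.1, der p.2).
Definition pair_state (p : pair) : nat * nat := (rk p.1, rk p.2).

Definition states : seq (nat * nat) :=
  [seq (a, b) | a <- iota 0 4, b <- iota 0 (c a).+1].
Definition state_le (l s : nat * nat) := (l.1 <= s.1)%N && (l.2 <= s.2)%N.
Definition state_size (s : nat * nat) := (s.1 + z s.1 + s.2)%N.
Definition transition (K : fieldType) (x : K) (l s : nat * nat) : K :=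
  (subspace_count x 3 0 l.1 (3 - s.1) * subspace_count x 8 (8 - c s.1) l.2 (c s.1 - s.2))%R.

Definition state_sum (s : nat * nat) : \bar R :=
  \esum_(p in lat_pairs `&` [set p | pair_state p = s]) (pair_weight p)%:E.

Lemma mem_states s : (s \in states) = (s.1 <= 3)%N && (s.2 <= c s.1)%N.
Proof.
case: s => a b /=; apply/allpairsPdep/andP => [[a' [b' []]]|[a3 bc]].
  by rewrite !mem_iota /= => ? ? [-> ->].
by exists a, b; rewrite !mem_iota.
Qed.

Lemma uniq_states : uniq states.
Proof.
by apply: allpairs_uniq_dep => [|a _|[a b] [a' b'] _ _ /=]; rewrite ?iota_uniq // => -[-> ->].
Qed.

Lemma pair_state_mem p : lat_pairs p -> pair_state p \in states.
Proof.
case=> [lI lJ BJ]; rewrite mem_states rk_le /=; have [sI sJ] := (lattice_submod lI, lattice_submod lJ).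
rewrite /rk leq_subLR addnC -leq_subLR -rBs //.
by apply/mxrankS/red_mono => //; apply: sBs.
Qed.

Lemma pair_weight_ge0 p : (0 <= pair_weight p)%R.
Proof. by rewrite !mulr_ge0. Qed.

Lemma pair_der_lat p : lat_pairs p -> lat_pairs (pair_der p).
Proof.
move=> [lI lJ BJ]; split; [exact: lattice_der|exact: lattice_der|].
by rewrite /= -dBs // => x; apply: BJ.
Qed.

Lemma pair_weight_der p : lat_pairs p ->
  pair_weight p = (t ^+ state_size (pair_state p) * pair_weight (pair_der p))%R.
Proof.
move=> [lI lJ BJ]; rewrite /pair_weight (w_der lI) (w_der lJ) (w_der (lCn lI)).
have E (x1 x2 x3 y1 y2 y3 : R) :
  (x1 * y1 * (x2 * y2) * (x3 * y3) = x1 * x2 * x3 * (y1 * y2 * y3))%R by ring.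
by rewrite rCn // dCn // /state_size !exprD E.
Qed.

Lemma state_sum0 : state_sum (0, 0)%N = 1%:E.
Proof.
rewrite /state_sum.
have -> : lat_pairs `&` [set p | pair_state p = (0, 0)%N] = [set (setT, setT)].
  apply/seteqP; split=> [[I J] [[/= lI lJ BJ] [rI rJ]]|_ ->].
    by rewrite (rk0_setT lI rI) (rk0_setT lJ rJ).
  by split; [split; [exact: lattice_setT|exact: lattice_setT|]|rewrite /pair_state /= !rk_setT].
rewrite esum_set1 ?lee_fin ?pair_weight_ge0 // /pair_weight /=.
have lT := @lattice_setT 3.
have rT : rk (Cn setT) = 0%N by rewrite rCn // rk_setT.
by rewrite (rk0_setT (lCn lT) rT) !index_setT w1 !mulr1.
Qed.

(** The inner lattice is counted first: the number of choices for [J] depends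
on [I] only through [rk I]. *)
Lemma esum_pair_fiber p s (x : R) : lat_pairs p -> s \in states ->
  state_le (pair_state p) s -> (0 <= x)%R ->
  \esum_(p' in lat_pairs `&` [set p' | pair_state p' = s] `&` [set p' | pair_der p' = p]) x%:E
  = (transition (q%:R : R) (pair_state p) s * x)%:E.
Proof.
case: p s => [J1 J2] [a b] [/= lJ1 lJ2 BJ]; rewrite mem_states /= => /andP[a3 bc] /andP[/= r1 r2] x0.
pose F2 I := fiber J2 (Bs I) b.
have -> : lat_pairs `&` [set p' | pair_state p' = (a, b)] `&` [set p' | pair_der p' = (J1, J2)] =
    fiber J1 [set 0%R] a `*`` F2.
  apply/seteqP; split=> -[I J] /=.
      move=> [[[/= lI lJ BI] [rI rJ]] [dI dJ]]; split; split=> //= _ ->.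
    exact: (lattice_submod lI).1.
  move=> [[lI dI rI _] [lJ dJ rJ BI]]; split; last by rewrite /pair_der /= dI dJ.
  by split=> //; rewrite /pair_state /= rI rJ.
rewrite -(esum_esum (a := fun _ _ => x%:E)) //.
pose x' := (subspace_count (q%:R : R) 8 (8 - c a) (rk J2) (c a - b) * x)%R.
have q1 : (1 <= q%:R :> R)%R by rewrite ler1n ltnW // finNzRing_gt1.
have ca8 := c_le8 a.
have x'0 : (0 <= x')%R by rewrite mulr_ge0 // subspace_count_ge0 //; lia.
rewrite (eq_esum (b := fun=> x'%:E)) => [|I [lI dI rI _]].
  rewrite (@esum_fiber _ J1 _ a (3 - a)) ?rank_red0 //; first by rewrite mulrA.
  - exact: submod0.
  - by move=> _ ->; apply: (lattice_submod lJ1).1.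
  - move=> y y0; have -> : y = 0%R by apply: scale_pi_inj; rewrite y0 scaler0.
    exact: (lattice_submod lJ1).1.
  - by rewrite add0n subnK.
have sI := lattice_submod lI; have dB := dBs lI; rewrite dI in dB.
rewrite (@esum_fiber _ J2 _ b (c a - b)) ?rBs ?rI //.
- exact: sBs.
- by move=> y By; apply: BJ; rewrite -dB; apply: (sub_der (sBs sI)).
- by move=> y By; apply: BJ; rewrite -dB.
- by rewrite -addnA subnK // subnK.
Qed.

Lemma transition_ge0 (l s : nat * nat) : s \in states -> state_le l s ->
  (0 <= transition (q%:R : R) l s)%R.
Proof.
case: l s => [l1 l2] [s1 s2]; rewrite mem_states /= => /andP[s13 s2c] /andP[/= ls1 ls2].
have q1 : (1 <= q%:R :> R)%R by rewrite ler1n ltnW // finNzRing_gt1.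
have c8 := c_le8 s1.
by rewrite mulr_ge0 // subspace_count_ge0 //=; move: (c s1) c8 s2c => cs c8 s2c; lia.
Qed.

(** Sort the pairs by their images under [der]. This changes the weight by a
factor that depends only on the state, and the number of pairs over a given
one depends only on the two states. *)
Lemma state_sum_rec s : s \in states -> s != (0, 0)%N ->
  state_sum s = \sum_(l <- states | state_le l s)
    (t ^+ state_size s * transition (q%:R : R) l s)%:E * state_sum l.
Proof.
move=> sS s0; have t0 : (0 <= t)%R by [].
have c0s : (0 <= t ^+ state_size s)%R by rewrite exprn_ge0.
have T0 l := @transition_ge0 l s sS.
have wE (p : pair) : 0 <= (pair_weight p)%:E by rewrite lee_fin pair_weight_ge0.
rewrite /state_sum (esum_fibration (f := pair_der) (S' := lat_pairs)); last by [].
  transitivity (\esum_(p in lat_pairs) \sum_(l <- states | state_le l s)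
      if p \in [set p | pair_state p = l] then
        (t ^+ state_size s * transition (q%:R : R) l s)%:E * (pair_weight p)%:E else 0).
    apply: eq_esum => p Pp.
    rewrite (eq_esum (b := fun=> (t ^+ state_size s * pair_weight p)%:E)); last first.
      by move=> p' [[Pp' st'] dp'] /=; rewrite pair_weight_der // st' dp'.
    have pS := pair_state_mem Pp.
    rewrite -big_filter; have [ls|ls] := boolP (state_le (pair_state p) s).
      rewrite esum_pair_fiber ?mulr_ge0 ?pair_weight_ge0 //.
      rewrite (bigD1_seq (pair_state p)) ?filter_uniq ?uniq_states ?mem_filter ?ls //=.
      rewrite mem_set // big1 ?adde0 => [|l lp].
        by rewrite -EFinM; congr _%:E; rewrite mulrCA mulrA.
      by rewrite ifF //; apply/negP; rewrite inE /= => pl; rewrite pl eqxx in lp.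
    rewrite big1_seq => [|l]; last first.
      rewrite mem_filter /= => /andP[ll _]; rewrite ifF //.
      by apply/negP; rewrite inE /= => pl; rewrite pl ll in ls.
    apply: esum1 => p' [[[lI lJ _] st'] dp']; case/negP: ls.
    rewrite -st' -dp' /state_le /= !rk_der //; exact: lattice_submod.
  rewrite -big_filter; under eq_esum do rewrite -big_filter.
  rewrite big_seq; under eq_esum do rewrite big_seq.
  rewrite esum_sum => [|p l _]; last first.
    by rewrite mem_filter => /andP[ll lS]; case: ifP => // _; rewrite mule_ge0 // lee_fin mulr_ge0 ?T0.
  apply: eq_bigr => l; rewrite mem_filter => /andP[ll lS].
  by rewrite -esum_mkcondr esumZl // mulr_ge0 ?T0.
by move=> p [Pp _]; apply: pair_der_lat.
Qed.

Lemma esum_lat_pairs :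
  \esum_(p in lat_pairs) (pair_weight p)%:E = \sum_(l <- states) state_sum l.
Proof.
rewrite (esum_partition (f := pair_state) uniq_states) //.
  exact: pair_state_mem.
by move=> p _; rewrite lee_fin pair_weight_ge0.
Qed.

End Recursion.

(** * The two systems and their product *)

(** With these two functions a pair amounts to a single lattice. *)
Definition no_bracket (I : set 'rV[o]_3) : set 'rV[o]_8 := setT.
Definition no_center (I : set 'rV[o]_3) : set 'rV[o]_3 := setT.

Lemma rank_red_setT n : \rank (red [set: 'rV[o]_n]) = n.
Proof. by rewrite rank_red rk_setT subn0. Qed.

Lemma der_bracket_span I : lattice I -> der (bracket_span I) = bracket_span (der I).
Proof.
move=> lI; apply/seteqP; split=> x; first exact: bracket_span_pi.
move=> [A IA <-]; exists (pi *: A); last by rewrite -[_ *: A]addr0 vec8P vec8_0 addr0.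
by move=> i; rewrite linearZ; apply: IA.
Qed.

Definition lattice_sum : \bar R :=
  \esum_(I in [set I : set 'rV[o]_3 | lattice I]) (w (coset_index I))%:E.

Lemma lattice_sumE :
  lattice_sum = \sum_(l <- states (fun=> 0%N)) state_sum no_bracket no_center l.
Proof.
rewrite -esum_lat_pairs; last 2 first.
- by move=> I sI; split.
- by move=> I sI; rewrite rank_red_setT.
apply/esym; rewrite (@reindex_esum _ _ _ [set I : set 'rV[o]_3 | lattice I] _ (fun I => (I, setT))).
  by apply: eq_esum => I lI; rewrite /pair_weight /= !index_setT w1 !mulr1.
split.
- by move=> I lI; split=> //; exact: lattice_setT.
- by move=> I J _ _ [].
- move=> [I J] [/= lI lJ TJ]; exists I => //; congr (_, _).
  by apply/seteqP; split=> // x _; apply: TJ.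
Qed.

Lemma lattice_sumP (s : nat * nat) : s \in states (fun=> 0%N) -> s != (0, 0)%N ->
  state_sum no_bracket no_center s = \sum_(l <- states (fun=> 0%N) | state_le l s)
    (t ^+ state_size (fun=> 0%N) s * transition (fun=> 0%N) (q%:R : R) l s)%:E *
      state_sum no_bracket no_center l.
Proof.
apply: state_sum_rec => //.
- by move=> I _; rewrite rank_red_setT.
- by move=> I _; exact: lattice_setT.
- by move=> I _; exact: rk_setT.
Qed.

Lemma lattice_sum0 : state_sum no_bracket no_center (0, 0)%N = 1%:E.
Proof.
by apply: (@state_sum0 _ _ (fun=> 0%N)) => // I _; [exact: lattice_setT|exact: rk_setT].
Qed.

Lemma corank_bracket_le8 r : (corank_bracket r <= 8)%N.
Proof. by case: r => [|[|[|[|r]]]] //; rewrite /corank_bracket nth_default. Qed.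

Lemma pair_sumP (s : nat * nat) : s \in states corank_bracket -> s != (0, 0)%N ->
  state_sum bracket_span center s = \sum_(l <- states corank_bracket | state_le l s)
    (t ^+ state_size rank_center s * transition corank_bracket (q%:R : R) l s)%:E *
      state_sum bracket_span center l.
Proof.
apply: state_sum_rec => //.
- exact: corank_bracket_le8.
- exact: submod_bracket_span.
- exact: rank_bracket_span.
- exact: der_bracket_span.
- exact: lattice_center.
- exact: rk_center.
- by move=> I lI; rewrite center_der.
Qed.

Lemma pair_sum0 : state_sum bracket_span center (0, 0)%N = 1%:E.
Proof.
apply: (@state_sum0 _ _ rank_center) => //; [exact: lattice_center|exact: rk_center].
Qed.

Lemma pair_sumE : \esum_(p in lat_pairs bracket_span) (pair_weight center p)%:E =
  \sum_(l <- states corank_bracket) state_sum bracket_span center l.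
Proof.
by apply: esum_lat_pairs; [exact: submod_bracket_span|exact: rank_bracket_span].
Qed.

(** The graded ideals in coordinates, by [ideal_triple_bij]. The first lattice
consists of elements whose brackets with degree 1 lie in the second. *)
Definition lat_triples : set (set 'rV[o]_3 * (set 'rV[o]_3 * set 'rV[o]_8)) :=
  [set p | [/\ lattice p.1, lat_pairs bracket_span p.2 & p.1 `<=` center p.2.1]].

(** [C] is free, so its sublattices are those of [o^3], with indices
multiplied by that of [C]. *)
Lemma esum_sublattices (C : set 'rV[o]_3) : lattice C ->
  \esum_(I in [set I : set 'rV[o]_3 | lattice I /\ I `<=` C]) (w (coset_index I))%:E =
  (w (coset_index C))%:E * lattice_sum.
Proof.
move=> lC; have [g injg gC] := lattice_free lC; rewrite gC in lC *.
have q0 : (0 < q)%N := ltnW (finNzRing_gt1 _).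
rewrite (@reindex_esum _ _ _ [set I : set 'rV[o]_3 | lattice I] _ (fun I => [set v *m g | v in
  I])); last first.
  split.
  - move=> I lI; split; first exact: (lattice_mulmx injg lI lC).1.
    by move=> _ [v _ <-]; exists v.
  - move=> I J; rewrite !in_setE => lI lJ IJ.
    apply/seteqP; split=> x Ix.
      have : [set v *m g | v in I] (x *m g) by exists x.
      by rewrite IJ => -[y Jy /(inj_mxP injg) <-].
    have : [set v *m g | v in J] (x *m g) by exists x.
    by rewrite -IJ => -[y Jy /(inj_mxP injg) <-].
  - move=> I [lI IC]; have [sI [N IN]] := lI; exists [set v | I (v *m g)].
      split; first exact: submod_pre.
      by exists N => v; rewrite /= -scalemxAl; apply: IN.
    apply/seteqP; split=> x; first by case=> v Iv <-.
    by move=> Ix; have [v _ vx] := IC x Ix; exists v; rewrite //= vx.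
rewrite -esumZl // => [|I]; last by rewrite lee_fin.
apply: eq_esum => I lI; rewrite (lattice_mulmx injg lI lC).2.
have [_ [N ->]] := lattice_index lI; have [_ [M ->]] := lattice_index lC.
by rewrite wM ?expn_gt0 ?q0 // mulrC EFinM.
Qed.

Definition triple_weight (p : set 'rV[o]_3 * (set 'rV[o]_3 * set 'rV[o]_8)) : R :=
  (w (coset_index p.1) * (w (coset_index p.2.1) * w (coset_index p.2.2)))%R.

Lemma lattice_sum_ge1 : 1%:E <= lattice_sum.
Proof.
rewrite -[X in X%:E]w1 -(index_setT 3); apply: esum_ge.
exists [set setT]; last by rewrite fsbig_set1.
by split=> [|I ->]; [exact: finite_set1|exact: lattice_setT].
Qed.

Lemma esum_lat_triples :
  \esum_(p in lat_triples) (triple_weight p)%:E =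
  \esum_(p in lat_pairs bracket_span) ((pair_weight center p)%:E * lattice_sum).
Proof.
pose T1 (p : set 'rV[o]_3 * set 'rV[o]_8) := [set I : set 'rV[o]_3 | lattice I /\ I `<=` center p.1].
rewrite (@reindex_esum _ _ _ (lat_pairs bracket_span `*`` T1) _ (fun p => (p.2, p.1))); last first.
  split.
  - by move=> [p I] [/= Pp [lI IC]].
  - by move=> [p I] [p' I'] _ _ [-> ->].
  - by move=> [I p] [/= lI Pp IC]; exists (p, I).
rewrite -(esum_esum (a := fun p I => (triple_weight (I, p))%:E)) /=; last first.
  by move=> p I _ _; rewrite lee_fin !mulr_ge0.
apply: eq_esum => p [lI lJ _].
rewrite (eq_esum (b := fun I => (w (coset_index p.1) * w (coset_index p.2))%:E * (w (coset_index
  I))%:E)); last first.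
  by move=> I _; rewrite -EFinM mulrC.
rewrite esumZl ?mulr_ge0 // => [|I]; last by rewrite lee_fin.
rewrite esum_sublattices; last exact: lattice_center.
by rewrite muleA -EFinM /pair_weight [in RHS]mulrAC.
Qed.

Lemma fin_num_sum (I : eqType) (r : seq I) (F : I -> \bar R) i :
  (forall j, 0 <= F j) -> i \in r -> \sum_(j <- r) F j \is a fin_num -> F i \is a fin_num.
Proof.
move=> F0 ir; rewrite !ge0_fin_numE ?sume_ge0 //; apply: le_lt_trans.
elim: r ir => [//|j r IHr]; rewrite inE big_cons => /predU1P[<-|/IHr ir].
  by rewrite leeDl ?sume_ge0.
by apply: le_trans ir _; rewrite leeDr.
Qed.

Definition state_system (c z : nat -> nat) (K : fieldType) (x y : K) (g : nat * nat -> K) :=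
  g (0, 0)%N = 1%R /\ forall s, s \in states c -> s != (0, 0)%N ->
    g s = (\sum_(l <- states c | state_le l s)
            y ^+ state_size z s * transition c x l s * g l)%R.

Lemma real_system c z (G : nat * nat -> \bar R) :
  G (0, 0)%N = 1%:E -> (forall s, 0 <= G s) -> (forall s, s \in states c -> G s \is a fin_num) ->
  (forall s, s \in states c -> s != (0, 0)%N -> G s = \sum_(l <- states c | state_le l s)
    (t ^+ state_size z s * transition c (q%:R : R) l s)%:E * G l) ->
  state_system c z (q%:R : R) t (fine \o G).
Proof.
move=> G0 Gge Gfin GE; split=> [|s sS s0]; first by rewrite /= G0.
apply: EFin_inj; rewrite /= fineK ?Gfin // GE // -sumEFin big_seq_cond [RHS]big_seq_cond.
by apply: eq_bigr => l /andP[lS _]; rewrite [RHS]EFinM fineK // Gfin.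
Qed.

(** Both sums in the product are at least 1, so each is finite when the total
is, and the recursions for extended sums become equations of real numbers. *)
Lemma triple_sum_system (v : R) : \esum_(p in lat_triples) (triple_weight p)%:E = v%:E ->
  exists h g : nat * nat -> R,
    [/\ state_system (fun=> 0%N) (fun=> 0%N) (q%:R : R) t h,
        state_system corank_bracket rank_center (q%:R : R) t g &
        v = ((\sum_(l <- states (fun=> 0%N)) h l) * \sum_(l <- states corank_bracket) g l)%R].
Proof.
have wE p : 0 <= (pair_weight center p)%:E by rewrite lee_fin pair_weight_ge0.
rewrite esum_lat_triples => vE; have L1 := lattice_sum_ge1.
have : lattice_sum <= v%:E.
  rewrite -vE; apply: esum_ge; exists [set (setT, setT)].
    split=> [|p ->]; first exact: finite_set1.
    by split; [exact: lattice_setT|exact: lattice_setT|].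
  rewrite fsbig_set1 /pair_weight /= (_ : center setT = setT) ?index_setT ?w1 ?mulr1 ?mul1e //.
  by apply/seteqP; split.
have [L LE] : exists L, lattice_sum = L%:E \/ lattice_sum = +oo.
  by move: L1; case: lattice_sum => [L _||//]; [exists L; left|exists 0%R; right].
case: LE => [LE|->]; last by rewrite leye_eq.
move=> _; have L0 : (1 <= L)%R by rewrite -lee_fin -LE.
have SG0 l : 0 <= state_sum bracket_span center l by apply: esum_ge0.
have SH0 l : 0 <= state_sum no_bracket no_center l.
  by apply: esum_ge0 => p _; rewrite lee_fin pair_weight_ge0.
move: vE; rewrite LE; under eq_esum do rewrite muleC; rewrite esumZl //; last first.
  exact: le_trans L0.
rewrite pair_sumE => vE.
have SGfin : \sum_(l <- states corank_bracket) state_sum bracket_span center l \is a fin_num.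
  rewrite ge0_fin_numE ?sume_ge0 // ltey; apply/eqP => Soo; move: vE.
  by rewrite Soo gt0_muley // lte_fin (lt_le_trans _ L0).
have SHfin : \sum_(l <- states (fun=> 0%N)) state_sum no_bracket no_center l \is a fin_num.
  by rewrite -lattice_sumE LE.
exists (fine \o state_sum no_bracket no_center), (fine \o state_sum bracket_span center).
split.
- apply: real_system => //; [exact: lattice_sum0| |exact: lattice_sumP].
  by move=> s sS; apply: fin_num_sum SHfin.
- apply: real_system => //; [exact: pair_sum0| |exact: pair_sumP].
  by move=> s sS; apply: fin_num_sum SGfin.
apply: EFin_inj; rewrite -vE EFinM -!sumEFin; congr (_ * _).
  rewrite -LE lattice_sumE; apply: eq_big_seq => l lS.
  by rewrite /= fineK //; apply: fin_num_sum SHfin.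
apply: eq_big_seq => l lS.
by rewrite /= fineK //; apply: fin_num_sum SGfin.
Qed.

Local Notation L := (free_nilpotent_over 3 3 o).

Definition ideal_triple (I : graded_ideal L 3) :=
  (slice1 (I : set _), (slice2 (I : set _), slice3 (I : set _))).

Lemma graded_idealP (I : graded_ideal L 3) :
  [/\ gr_ideal I, gr_graded I & finite_index I].
Proof. by case: I => I /= /asboolP. Qed.

Lemma ideal_triple_lat I : lat_triples (ideal_triple I).
Proof.
have [iI gI fI] := graded_idealP I; have [s1 s2 s3] := submod_slices iI.1.
have [f1 f2 f3] := finite_index_slices fI.
have : gr_ideal (gr_prod (slice1 I) (slice2 I) (slice3 I)).
  by rewrite -(gr_graded_slices iI.1 gI).
move=> /(ideal_prod s1 s2 s3)[AB BC].
split=> /=; first exact: finite_index_lattice.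
  split=> /=; [exact: finite_index_lattice|exact: finite_index_lattice|].
  by apply/bracket_spanP => // x e; apply: BC.
by move=> a Aa y; apply: AB.
Qed.

Lemma submodule_subgroup (I : set (gr L 3)) : submodule I -> subgroup I.
Proof.
move=> /submoduleP[I0 IP]; split=> // x y Ix Iy.
by rewrite addrC -scaleN1r; apply: IP.
Qed.

Lemma index_prod A B C : lattice A -> lattice B -> lattice C ->
  finite_index (gr_prod A B C) /\
  coset_index (gr_prod A B C) = (coset_index A * (coset_index B * coset_index C))%N.
Proof.
move=> lA lB lC; have [sA sB sC] := And3 (lattice_submod lA) (lattice_submod lB) (lattice_submod lC).
have [S [f [_ [fA _]]]] := lattice_transversal lA.
have [T [g [_ [gB _]]]] := lattice_transversal lB.
have [U [h [_ [hC _]]]] := lattice_transversal lC.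
have sP := submodule_subgroup (submodule_prod sA sB sC).
have [fin ->] := transversal_index sP (transversal_prod fA gB hC).
split=> //; rewrite !card_prod mulnA.
rewrite (transversal_index (submod_subgroup sA) fA).2.
rewrite (transversal_index (submod_subgroup sB) gB).2.
by rewrite (transversal_index (submod_subgroup sC) hC).2.
Qed.

Lemma index_ideal_triple (I : graded_ideal L 3) :
  w (coset_index I) = triple_weight (ideal_triple I).
Proof.
have [iI gI fI] := graded_idealP I; have [/= l1 [/= l2 l3 _] _] := ideal_triple_lat I.
rewrite {1}(gr_graded_slices iI.1 gI) (index_prod l1 l2 l3).2 /triple_weight /=.
have q0 : (0 < q)%N := ltnW (finNzRing_gt1 _).
have [_ [a ->]] := lattice_index l1; have [_ [b ->]] := lattice_index l2.
have [_ [c ->]] := lattice_index l3.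
by rewrite !wM ?muln_gt0 ?expn_gt0 ?q0.
Qed.

Lemma ideal_triple_bij : set_bij [set: graded_ideal L 3] lat_triples ideal_triple.
Proof.
split.
- by move=> I _; apply: ideal_triple_lat.
- move=> I J _ _ [s1 s2 s3]; have [iI gI _] := graded_idealP I.
  have [iJ gJ _] := graded_idealP J; apply: val_inj => /=.
  by rewrite (gr_graded_slices iI.1 gI) (gr_graded_slices iJ.1 gJ) s1 s2 s3.
- move=> [A [B C]] [/= lA [/= lB lC BC] AB].
  have [sA sB sC] := And3 (lattice_submod lA) (lattice_submod lB) (lattice_submod lC).
  have P : `[< [/\ gr_ideal (gr_prod A B C), gr_graded (gr_prod A B C)
            & finite_index (gr_prod A B C)] >].
    apply/asboolP; split; last exact: (index_prod lA lB lC).1.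
      apply/ideal_prod => //; split=> [a x Aa|b x Bb]; first exact: AB.
      by apply: (bracket_spanP sB sC).2 Bb.
    exact: graded_prod.
  exists (GradedIdeal P) => //; rewrite /ideal_triple /=.
  by have [-> -> ->] := slices_prod sA sB sC.
Qed.

Lemma graded_ideal_system (v : R) :
  \esum_(I in [set: graded_ideal L 3]) (w (coset_index I))%:E = v%:E ->
  exists h g : nat * nat -> R,
    [/\ state_system (fun=> 0%N) (fun=> 0%N) (q%:R : R) t h,
        state_system corank_bracket rank_center (q%:R : R) t g &
        v = ((\sum_(l <- states (fun=> 0%N)) h l) * \sum_(l <- states corank_bracket) g l)%R].
Proof.
move=> vE; apply: triple_sum_system; rewrite -vE.
rewrite (@reindex_esum _ _ _ _ _ _ _ ideal_triple_bij).
by apply: eq_esum => I _; rewrite index_ideal_triple.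
Qed.

End Fibers.
End Lattice.

(** * The ring of p-adic integers *)

Lemma fraction_quotient (R : idomainType) (x : {fraction R}) :
  exists a b : R, b != 0 /\ x = FracField.tofrac a / FracField.tofrac b.
Proof.
move: x; elim/quotW => r; have d0 := denom_ratioP r.
exists (frac r).1, (frac r).2; split=> //.
apply: (mulIf (x := FracField.tofrac (frac r).2)); first by rewrite tofrac_eq0.
rewrite divfK ?tofrac_eq0 //; unlock FracField.tofrac.
rewrite -[LHS]FracField.pi_mul; apply/eqmodP; rewrite /= FracField.equivfE.
by rewrite /FracField.mulf !numden_Ratio ?mulr1 ?oner_eq0 // mulrC.
Qed.

Lemma residue_card_uniformizer (o : comNzRingType) (k : finFieldType)
    (rho : {rmorphism o -> k}) (pi : o) :
  uniformizer rho pi -> residue_card o = #|k|.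
Proof.
move=> uP; rewrite /residue_card.
have -> : [set x : o | ~ exists y, x * y = 1]%classic = [set x : o | rho x = 0]%classic.
  apply/seteqP; split=> x /= => [nx|x0 [y xy]].
    by apply/eqP; apply: contrapT => /negP /(res_unit uP).
  by have := rmorph1 rho; rewrite -xy rmorphM x0 mul0r => /esym/eqP; rewrite oner_eq0.
apply: (transversal_index (f := res_lift uP) _ _).2; first split=> [|x y /= x0 y0].
- exact: rmorph0.
- by rewrite rmorphB x0 y0 subrr.
split=> [x|a b] /=; first by exists (rho x); rewrite rmorphB res_liftK subrr.
by rewrite rmorphB !res_liftK => /eqP; rewrite subr_eq0 => /eqP.
Qed.

(** A quotient [a / b] with [a] outside a prime ideal containing [b] is not
integral: clearing denominators in a monic equation of degree [d] puts
[a ^+ d] into the ideal. *)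
Lemma integral_quotient_res (A : idomainType) (F : fieldType) (k : idomainType)
    (f : {rmorphism A -> F}) (res : {rmorphism A -> k}) (a b : A) :
  injective f -> b != 0 -> integralOver f (f a / f b) -> res b = 0 -> res a = 0.
Proof.
move=> finj b0 [P mP /rootP Px] rb.
have fb0 : f b != 0 by rewrite -(rmorph0 f) (inj_eq finj).
pose d := (size P).-1; have sP : size P = d.+1.
  by rewrite prednK // size_poly_gt0 monic_neq0.
have : \sum_(i < d.+1) P`_i * a ^+ i * b ^+ (d - i) = 0.
  apply: finj; rewrite rmorph0 -[RHS](mul0r (f b ^+ d)) -[in RHS]Px.
  rewrite rmorph_sum horner_poly sP mulr_suml; apply: eq_bigr => i _.
  have id : (i <= d)%N := leq_ord i.
  rewrite !rmorphM !rmorphXn /= expr_div_n -!mulrA; congr (_ * (_ * _)).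
  by rewrite -[X in _ * _ ^+ X](subnK id) exprD mulrCA mulVf ?mulr1 // expf_neq0.
move/(congr1 res); rewrite rmorph0 rmorph_sum /= big_ord_recr /= subnn expr0 mulr1.
have -> : P`_d = 1 by move/monicP: mP; rewrite lead_coefE.
rewrite big1 => [|i _].
  by rewrite add0r mul1r rmorphXn => /eqP; rewrite expf_eq0 => /andP[_ /eqP].
by rewrite !rmorphM !rmorphXn rb [X in _ * X]expr0n subn_eq0 leqNgt ltn_ord mulr0.
Qed.

(** Division by the uniformizer reduces any fraction [a / b] to one whose
denominator is a unit, unless it runs into a fraction excluded by
[integral_quotient_res]. *)
Lemma integrally_closed_uniformizer (A : idomainType) (F : fieldType) (k : idomainType)
    (f : {rmorphism A -> F}) (res : {rmorphism A -> k}) (pi : A) :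
  injective f -> pi != 0 ->
  (forall x, res x = 0 -> exists y, x = pi * y) ->
  (forall x, res x != 0 -> exists y, x * y = 1) ->
  (forall b, b != 0 -> exists N, forall c, b != pi ^+ N * c) ->
  forall a b, b != 0 -> integralOver f (f a / f b) -> exists c, f a / f b = f c.
Proof.
move=> finj pi0 ker unit sep a b b0; have f0 x : x != 0 -> f x != 0.
  by rewrite -(inj_eq finj) rmorph0.
have [N] := sep b b0; elim: N a b b0 => [|N IHN] a b b0 bN int.
  by have := bN b; rewrite mul1r eqxx.
have [rb|/unit[c bc]] := eqVneq (res b) 0; last first.
  exists (a * c); apply: (mulIf (f0 _ b0)).
  by rewrite divfK ?f0 // -rmorphM -mulrA [c * b]mulrC bc mulr1.
have [a' aE] := ker _ (integral_quotient_res finj b0 int rb).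
have [b' bE] := ker _ rb.
have ab : f a / f b = f a' / f b'.
  by rewrite aE bE !rmorphM invfM mulrACA divff ?mul1r ?f0.
rewrite ab in int *; apply: IHN int.
  by apply: contraNneq b0 => b'0; rewrite bE b'0 mulr0.
by move=> c; have := bN c; rewrite bE exprS -mulrA (inj_eq (mulfI pi0)).
Qed.

Section PadicIntegers.
Variables (p : nat) (p_pr : prime p).
Local Notation Zp := (padic_int p_pr).

Definition padic_res (x : Zp) : 'F_p := (x 0%N : nat)%:R.

Lemma padic_addE (x y : Zp) n : (x + y) n = x n + y n. Proof. by []. Qed.
Lemma padic_mulE (x y : Zp) n : (x * y) n = x n * y n. Proof. by []. Qed.

Lemma padic_natE m n : (m%:R : Zp) n = m%:R.
Proof. by elim: m => [//|m IHm]; rewrite !mulrSr padic_addE IHm. Qed.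

Lemma natr_Fp0 (m : nat) : ((m%:R : 'Z_(p ^ 1)) : nat)%:R = m%:R :> 'F_p.
Proof. by rewrite natr_Zmod // expn1 Fp_nat_mod. Qed.

Fact padic_res_zmod : zmod_morphism padic_res.
Proof.
have D (a b : Zp) : padic_res (a + b) = padic_res a + padic_res b.
  by rewrite /padic_res padic_addE [a 0%N]ZmodE [b 0%N]ZmodE -natrD !natr_Fp0 natrD.
by move=> x y; apply: (addIr (padic_res y)); rewrite -D !subrK.
Qed.
HB.instance Definition _ := GRing.isZmodMorphism.Build Zp 'F_p padic_res padic_res_zmod.

Fact padic_res_monoid : monoid_morphism padic_res.
Proof.
split=> [|x y]; first exact: (natr_Fp0 1).
by rewrite /padic_res padic_mulE [x 0%N]ZmodE [y 0%N]ZmodE -natrM !natr_Fp0 natrM.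
Qed.
HB.instance Definition _ := GRing.isMonoidMorphism.Build Zp 'F_p padic_res padic_res_monoid.

Lemma dvdn_padic (x : Zp) n : padic_res x = 0 -> (p %| x n)%N.
Proof.
rewrite /padic_res => /eqP; rewrite -(dvdn_pcharf (pchar_Fp p_pr)).
by rewrite -(padic_mod_le x (leq0n n)) expn1 /dvdn modn_mod.
Qed.

Lemma natr_Zmod_eq n k l : (k %% p ^ n.+1 = l %% p ^ n.+1)%N -> k%:R = l%:R :> 'Z_(p ^ n.+1).
Proof. by move=> kl; apply: val_inj; rewrite /= !natr_Zmod. Qed.

Lemma padic_res_ker (x : Zp) : padic_res x = 0 -> exists y, x = p%:R * y.
Proof.
move=> x0; pose y n : 'Z_(p ^ n.+1) := (x n.+1 %/ p)%N%:R.
have p0 := prime_gt0 p_pr.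
have yP : padic_coherent y.
  move=> n; rewrite /y natr_red //; apply: natr_Zmod_eq.
  rewrite -(padic_mod_le x (leqnSn n.+1)); case/dvdnP: (dvdn_padic n.+2 x0) => m ->.
  rewrite mulnK // [(p ^ n.+2)%N]expnSr -muln_modl mulnK // modn_mod //.
exists (padic_mk p_pr yP); apply: padicP => n; rewrite padic_mulE padic_natE /=.
rewrite /y -natrM mulnC divnK ?dvdn_padic // -(padic_valP x n) //.
Qed.

Lemma padic_res_unit (x : Zp) : padic_res x != 0 -> exists y, x * y = 1.
Proof.
move=> x0; have cop n : coprime (p ^ n.+1) (x n).
  rewrite coprime_pexpl // prime_coprime //; apply: contra x0 => px.
  rewrite /padic_res -(dvdn_pcharf (pchar_Fp p_pr)) -(padic_mod_le x (leq0n n)) expn1.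
  by rewrite /dvdn modn_mod.
have ux n : x n \is a GRing.unit.
  by rewrite [x n]ZmodE unitZpE ?pexp_gt1 // cop.
pose y n : 'Z_(p ^ n.+1) := (x n)^-1.
have yP : padic_coherent y.
  move=> n; apply: (mulrI (ux n)); rewrite [RHS](divrr (ux n)).
  have -> : x n * (y n.+1 : nat)%:R = ((x n.+1 : nat) * (y n.+1 : nat))%N%:R.
    by rewrite natrM padic_valP.
  rewrite -(natr_red p_pr) natrM -!ZmodE.
  have -> : x n.+1 * y n.+1 = 1 by exact: (divrr (ux n.+1)).
  exact: (natr_red p_pr n 1).
exists (padic_mk p_pr yP); apply: padicP => n; by rewrite padic_mulE; exact: (divrr (ux n)).
Qed.

Lemma padic_p_neq0 : (p%:R : Zp) != 0.
Proof.
apply/eqP => /(congr1 (fun x : Zp => (x 1%N : nat))); rewrite padic_natE natr_Zmod //.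
rewrite modn_small ?(prime_gt0 p_pr) //= => [p0|]; first by have := prime_gt0 p_pr; rewrite p0.
by rewrite -{1}(expn1 p) ltn_exp2l // prime_gt1.
Qed.

Lemma padic_sep (b : Zp) : b != 0 -> exists N, forall c, b != p%:R ^+ N * c.
Proof.
move=> /padic_neq0[N bN]; exists N.+1 => c; apply: contraNneq bN => ->.
rewrite padic_mulE -natrX padic_natE.
have -> : (p ^ N.+1)%:R = 0 :> 'Z_(p ^ N.+1) by exact: pchar_Zp (pexp_gt1 p_pr N).
by rewrite mul0r.
Qed.

Section Integers.
Variables (F : fieldType) (f : {rmorphism Zp -> F}).
Hypothesis finj : injective f.
Hypothesis ffrac : forall x, exists a b, b != 0 /\ x = f a / f b.
Variables (o : comNzRingType) (v : {rmorphism o -> F}).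
Hypothesis vinj : injective v.
Hypothesis vint : forall x, integralOver f (v x).
Hypothesis vsurj : forall y, integralOver f y -> exists x, v x = y.

(** The [p]-adic integers are integrally closed, so the integers of their
fraction field are the [p]-adic integers themselves. *)
Lemma padic_of_subproof x : exists a, v x = f a.
Proof.
have [a [b [b0 xab]]] := ffrac (v x); rewrite xab; have := vint x; rewrite xab.
exact: (integrally_closed_uniformizer finj padic_p_neq0 padic_res_ker padic_res_unit padic_sep b0).
Qed.

Definition padic_of x : Zp := sval (cid (padic_of_subproof x)).

Lemma padic_ofK x : f (padic_of x) = v x.
Proof. by rewrite /padic_of; case: cid. Qed.

Fact padic_of_zmod : zmod_morphism padic_of.
Proof. by move=> x y; apply: finj; rewrite !rmorphB !padic_ofK rmorphB. Qed.
HB.instance Definition _ := GRing.isZmodMorphism.Build o Zp padic_of padic_of_zmod.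

Fact padic_of_monoid : monoid_morphism padic_of.
Proof.
split=> [|x y]; apply: finj; first by rewrite padic_ofK !rmorph1.
by rewrite rmorphM !padic_ofK rmorphM.
Qed.
HB.instance Definition _ := GRing.isMonoidMorphism.Build o Zp padic_of padic_of_monoid.

Lemma padic_of_inj : injective padic_of.
Proof. by move=> x y xy; apply: vinj; rewrite -!padic_ofK xy. Qed.

Lemma padic_of_surj (a : Zp) : exists x, padic_of x = a.
Proof.
have [x xa] := vsurj (integral_id f a).
by exists x; apply: finj; rewrite padic_ofK.
Qed.

Definition integers_res : {rmorphism o -> 'F_p} := padic_res \o padic_of.

Lemma integers_uniformizer : uniformizer integers_res p%:R.
Proof.
split=> [a|x|x px0|x /padic_res_unit[y xy]].
- by exists (a : nat)%:R; rewrite rmorph_nat natr_Zp.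
- split=> [/padic_res_ker[y xy]|[y ->]].
    have [z zy] := padic_of_surj y; exists z; apply: padic_of_inj.
    by rewrite [LHS]xy rmorphM rmorph_nat /= zy.
  by rewrite rmorphM rmorph_nat (pchar_Fp_0 p_pr) mul0r.
- apply: padic_of_inj; move/(congr1 padic_of)/eqP: px0.
  by rewrite rmorphM rmorph0 rmorph_nat mulf_eq0 (negPf padic_p_neq0) => /eqP.
- have [z zy] := padic_of_surj y; exists z; apply: padic_of_inj.
  by rewrite rmorphM rmorph1 /= zy.
Qed.

End Integers.

Local Notation K := ((padic p_pr)^o : fieldExtType (padic p_pr)).

Lemma padic_uniformizer :
  exists rho : {rmorphism ring_of_integers K -> 'F_p}, uniformizer rho p%:R.
Proof.
have toE x : padic_int_to K x = FracField.tofrac x by exact: mulr1.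
have inj : injective (padic_int_to K : {rmorphism Zp -> K}).
  by move=> x y; rewrite /= !toE => /eqP; rewrite tofrac_eq => /eqP.
have frac : forall x : K, exists a b, b != 0 /\
    x = (padic_int_to K : {rmorphism Zp -> K}) a / (padic_int_to K : {rmorphism Zp -> K}) b.
  move=> x; have [a [b [b0 ->]]] := @fraction_quotient _ (x : padic p_pr).
  by exists a, b; split=> //; rewrite /= !toE.
pose v : {rmorphism ring_of_integers K -> K} := val.
have vint (x : ring_of_integers K) : integralOver (padic_int_to K) (v x).
  exact: (asboolW (valP x)).
exists (integers_res inj frac vint); apply: integers_uniformizer; first exact: val_inj.
by move=> y yint; exists (RingOfIntegers (asboolT yint)).
Qed.

End PadicIntegers.

(** * Values of rational functions *)

Lemma poly_many_roots (R : idomainType) (p : {poly R}) (u : nat -> R) :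
  injective u -> (forall i, root p (u i)) -> p = 0.
Proof.
move=> uinj up; apply/eqP; apply: contraT => p0.
have := max_poly_roots p0 (rs := [seq u i | i <- iota 0 (size p)]).
rewrite size_map size_iota ltnn => /(_ _ _)-> //.
  by apply/allP => _ /mapP[i _ ->].
by rewrite map_inj_uniq // iota_uniq.
Qed.

Section RatrChar0.
Variables (K : fieldType).
Hypothesis K0 : [pchar K] =i pred0.

Lemma intr_char0_eq0 (n : int) : (n%:~R == 0 :> K) = (n == 0).
Proof.
have natE (m : nat) : (m%:R == 0 :> K) = (m == 0%N) by have /pcharf0P := K0.
case: n => m; first exact: natE.
by rewrite NegzE rmorphN /= oppr_eq0 [_%:~R == 0]natE.
Qed.

(** An alias of [ratr], to carry its structure of ring morphism in
characteristic 0. *)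
Definition ratr_char0 : rat -> K := ratr.

Lemma ratr_char0E (a b : int) : b != 0 -> ratr_char0 (a%:~R / b%:~R) = a%:~R / b%:~R.
Proof.
move=> b0; rewrite /ratr_char0 /ratr; set x : rat := a%:~R / b%:~R.
have d0 : (denq x)%:~R != 0 :> K by rewrite intr_char0_eq0 denq_neq0.
have b0' : b%:~R != 0 :> K by rewrite intr_char0_eq0.
apply/eqP; rewrite eqr_div // -!intrM; apply/eqP; congr _%:~R.
apply: (intr_inj (R := rat)); rewrite !intrM.
apply/eqP; rewrite -eqr_div ?intr_eq0 ?denq_neq0 //.
by rewrite divq_num_den.
Qed.

Lemma rat_quotient (x : rat) : exists a b : int, b != 0 /\ x = a%:~R / b%:~R.
Proof. by exists (numq x), (denq x); rewrite denq_neq0 divq_num_den. Qed.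

Fact ratr_char0_zmod : zmod_morphism ratr_char0.
Proof.
move=> x y; have [a [b [b0 ->]]] := rat_quotient x; have [c [d [d0 ->]]] := rat_quotient y.
rewrite -mulNr addf_div ?intr_eq0 // -rmorphN -!rmorphM -rmorphD /=.
rewrite !ratr_char0E ?mulf_neq0 //.
by rewrite -mulNr addf_div ?intr_char0_eq0 // -rmorphN -!rmorphM -rmorphD.
Qed.
HB.instance Definition _ := GRing.isZmodMorphism.Build rat K ratr_char0 ratr_char0_zmod.

Fact ratr_char0_monoid : monoid_morphism ratr_char0.
Proof.
split=> [|x y]; first by have := @ratr_char0E 1 1 isT; rewrite !divr1.
have [a [b [b0 ->]]] := rat_quotient x; have [c [d [d0 ->]]] := rat_quotient y.
by rewrite mulf_div -!rmorphM /= !ratr_char0E ?mulf_neq0 // mulf_div -!rmorphM.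
Qed.
HB.instance Definition _ := GRing.isMonoidMorphism.Build rat K ratr_char0 ratr_char0_monoid.

Implicit Types (P Q : {poly {poly rat}}) (x y z : K).

Lemma bievalE P x y : bieval P x y = (map_poly (map_poly ratr_char0) P).[x%:P].[y].
Proof. by []. Qed.

Lemma bievalD P Q x y : bieval (P + Q) x y = bieval P x y + bieval Q x y.
Proof. by rewrite !bievalE rmorphD !hornerD. Qed.
Lemma bievalN P x y : bieval (- P) x y = - bieval P x y.
Proof. by rewrite !bievalE rmorphN !hornerN. Qed.
Lemma bievalM P Q x y : bieval (P * Q) x y = bieval P x y * bieval Q x y.
Proof. by rewrite !bievalE rmorphM !hornerM. Qed.
Lemma bieval1 x y : bieval 1 x y = 1.
Proof. by rewrite bievalE rmorph1 !hornerC. Qed.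
Lemma bieval0 x y : bieval 0 x y = 0.
Proof. by rewrite bievalE rmorph0 !hornerC. Qed.
Lemma bieval_outer x y : bieval 'X x y = x.
Proof. by rewrite bievalE map_polyX hornerX hornerC. Qed.
Lemma bieval_inner x y : bieval ('X)%:P x y = y.
Proof. by rewrite bievalE map_polyC /= hornerC map_polyX hornerX. Qed.

Local Notation W := {fraction {poly {poly rat}}}.
Implicit Types (U V : W).

(** Without quotients, values of sums and products follow from identities of
polynomials. *)
Lemma rat_valueP U x y z : rat_value U x y z <->
  exists P Q, [/\ U * FracField.tofrac Q = FracField.tofrac P,
      bieval Q x y != 0 & z * bieval Q x y = bieval P x y].
Proof.
split=> [[P [Q [-> Q0 ->]]]|[P [Q [UQ Q0 zQ]]]]; exists P, Q; split=> //.
- have Qn : FracField.tofrac Q != 0 :> W.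
    by rewrite tofrac_eq0; apply: contraNneq Q0 => ->; rewrite bieval0.
  by rewrite divfK.
- by rewrite divfK.
- have Qn : FracField.tofrac Q != 0 :> W.
    by rewrite tofrac_eq0; apply: contraNneq Q0 => ->; rewrite bieval0.
  by apply: (mulIf Qn); rewrite divfK.
- by apply: (mulIf Q0); rewrite divfK.
Qed.

Lemma rat_value_poly P x y : rat_value (FracField.tofrac P) x y (bieval P x y).
Proof. by apply/rat_valueP; exists P, 1; rewrite bieval1 rmorph1 !mulr1 oner_neq0. Qed.

Lemma rat_value0 x y : rat_value 0 x y 0.
Proof. by have := rat_value_poly 0 x y; rewrite bieval0 rmorph0. Qed.

Lemma rat_value1 x y : rat_value 1 x y 1.
Proof. by have := rat_value_poly 1 x y; rewrite bieval1 rmorph1. Qed.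

Lemma rat_valueD U V x y z t : rat_value U x y z -> rat_value V x y t ->
  rat_value (U + V) x y (z + t).
Proof.
move=> /rat_valueP[P [Q [UQ Q0 zQ]]] /rat_valueP[P' [Q' [VQ Q0' tQ]]].
apply/rat_valueP; exists (P * Q' + P' * Q), (Q * Q').
rewrite !bievalD !bievalM mulf_neq0 // -zQ -tQ !rmorphD !rmorphM /= -UQ -VQ.
by split=> //; ring.
Qed.

Lemma rat_valueM U V x y z t : rat_value U x y z -> rat_value V x y t ->
  rat_value (U * V) x y (z * t).
Proof.
move=> /rat_valueP[P [Q [UQ Q0 zQ]]] /rat_valueP[P' [Q' [VQ Q0' tQ]]].
apply/rat_valueP; exists (P * P'), (Q * Q').
by rewrite !bievalM mulf_neq0 // -zQ -tQ !rmorphM /= -UQ -VQ; split=> //; ring.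
Qed.

Lemma rat_valueN U x y z : rat_value U x y z -> rat_value (- U) x y (- z).
Proof.
move=> Uz; have := rat_valueM (rat_value_poly (-1) x y) Uz.
by rewrite bievalN bieval1 rmorphN rmorph1 !mulN1r.
Qed.

Lemma rat_valueB U V x y z t : rat_value U x y z -> rat_value V x y t ->
  rat_value (U - V) x y (z - t).
Proof. by move=> Uz Vt; apply/rat_valueD/rat_valueN. Qed.

Lemma rat_valueV U x y z : rat_value U x y z -> z != 0 -> rat_value U^-1 x y z^-1.
Proof.
move=> /rat_valueP[P [Q [UQ Q0 zQ]]] z0.
have P0 : bieval P x y != 0 by rewrite -zQ mulf_neq0.
have Pn : FracField.tofrac P != 0 :> W.
  by rewrite tofrac_eq0; apply: contraNneq P0 => ->; rewrite bieval0.
have U0 : U != 0 by apply: contraNneq Pn => U0; rewrite -UQ U0 mul0r.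
by apply/rat_valueP; exists Q, P; rewrite P0 -zQ -UQ !mulKf.
Qed.

Lemma rat_valueX U x y z n : rat_value U x y z -> rat_value (U ^+ n) x y (z ^+ n).
Proof.
move=> Uz; elim: n => [|n IHn]; first exact: rat_value1.
by rewrite !exprS; apply: rat_valueM.
Qed.

Lemma rat_value_sum (I : eqType) (r : seq I) (P : pred I) (F : I -> W) (G : I -> K) x y :
  (forall i, i \in r -> P i -> rat_value (F i) x y (G i)) ->
  rat_value (\sum_(i <- r | P i) F i) x y (\sum_(i <- r | P i) G i).
Proof.
move=> FG; rewrite big_seq_cond [X in rat_value _ _ _ X]big_seq_cond.
elim/big_ind2: _ => [|U z V t|i /andP[ir Pi]]; first exact: rat_value0.
  exact: rat_valueD.
exact: FG.
Qed.

Lemma rat_value_prod (I : finType) (F : I -> W) (G : I -> K) x y :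
  (forall i, rat_value (F i) x y (G i)) -> rat_value (\prod_i F i) x y (\prod_i G i).
Proof.
move=> FG; elim/big_ind2: _ => // [|U z V t]; first exact: rat_value1.
exact: rat_valueM.
Qed.

(** [P] vanishes at the point even if [Q] does: the value comes from some
fraction [P' / Q'] with [Q'] not zero there, and [P * Q' = P' * Q]. *)
Lemma rat_value_eq0 U P Q x y : U = FracField.tofrac P / FracField.tofrac Q -> Q != 0 ->
  rat_value U x y 0 -> bieval P x y = 0.
Proof.
move=> UE Q0 /rat_valueP[P' [Q' [UQ Q0' /esym]]]; rewrite mul0r => P'0.
have : P * Q' = P' * Q.
  apply/eqP; rewrite -tofrac_eq !rmorphM /= -UQ UE; apply/eqP.
  by rewrite mulrAC divfK // tofrac_eq0.
move/(congr1 (fun P => bieval P x y)); rewrite !bievalM P'0 mul0r => /eqP.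
by rewrite mulf_eq0 (negPf Q0') orbF => /eqP.
Qed.

(** For each [u i] the polynomial in the inner variable has infinitely many
roots, so it is zero; then each coefficient has the infinitely many roots [u
i]. *)
Lemma bieval_dense P (u : nat -> nat) (T : nat -> nat -> K) :
  injective u -> (forall i, injective (T i)) ->
  (forall i j, bieval P (u i)%:R (T i j) = 0) -> P = 0.
Proof.
move=> uinj Tinj PT.
pose v i : {poly rat} := (u i)%:R.
apply: (@poly_many_roots _ P v) => [i j|i].
  rewrite /v -!polyC_natr => /polyC_inj/eqP; rewrite eqr_nat => /eqP.
  exact: uinj.
have E : map_poly ratr_char0 P.[v i] = 0.
  apply: (@poly_many_roots _ _ (T i)) => // j; apply/eqP; rewrite -(PT i j) bievalE.
  by rewrite -horner_map /= /v rmorph_nat polyC_natr.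
by move/eqP: E; rewrite map_poly_eq0.
Qed.

End RatrChar0.

Lemma big_seq_condD1 (V : nmodType) (I : eqType) (r : seq I) (P : pred I) (F : I -> V) s :
  s \in r -> uniq r -> P s ->
  \sum_(i <- r | P i) F i = F s + \sum_(i <- r | P i && (i != s)) F i.
Proof.
move=> sr ur Ps; rewrite -big_filter (bigD1_seq s) ?filter_uniq ?mem_filter ?Ps //=.
by rewrite big_filter_cond.
Qed.

Section Solve.
Variables (c z : nat -> nat).

(** The unique solution of [state_system], computed by solving the equation
of each state for its diagonal term. *)
Fixpoint solve_rec (K : fieldType) (x y : K) (n : nat) (s : nat * nat) : K :=
  if n is m.+1 then
    if s == (0, 0)%N then 1 else
    y ^+ state_size z s * (\sum_(l <- states c | state_le l s && (l != s))
       transition c x l s * solve_rec x y m l)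
      / (1 - y ^+ state_size z s * transition c x s s)
  else 0.

Definition solve (K : fieldType) (x y : K) s := solve_rec x y (s.1 + s.2).+1 s.

Definition regular_at (K : fieldType) (x y : K) :=
  [/\ x != 0, forall i, (0 < i)%N -> x ^+ i != 1 &
   forall s, s \in states c -> s != (0, 0)%N ->
     1 - y ^+ state_size z s * transition c x s s != 0].

Lemma state_lt (l s : nat * nat) : state_le l s -> l != s -> (l.1 + l.2 < s.1 + s.2)%N.
Proof.
case: l s => [a b] [a' b'] /andP[/= aa bb]; rewrite xpair_eqE negb_and; lia.
Qed.

Lemma solve_unique (K : fieldType) (x y : K) g : regular_at x y ->
  state_system c z x y g -> forall s, s \in states c -> g s = solve x y s.
Proof.
move=> [_ _ reg] [g0 gP] s; rewrite /solve; move: (ltnSn (s.1 + s.2)).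
move: {2 3}(_.+1) => n; elim: n s => [//|n IHn] s; rewrite ltnS => sn sS /=.
have [->|s0] := eqVneq s (0, 0)%N; first exact: g0.
have le_ss : state_le s s by rewrite /state_le !leqnn.
apply: (mulIf (reg s sS s0)); rewrite divfK ?reg // mulrBr mulr1 {1}gP //.
rewrite (@big_seq_condD1 _ _ _ (state_le^~ s) _ s sS (uniq_states c) le_ss).
rewrite [g s * _]mulrC addrAC subrr add0r mulr_sumr.
rewrite big_seq_cond [RHS]big_seq_cond; apply: eq_bigr => l /and3P[lS ls nls].
by rewrite -mulrA -IHn // (leq_trans (state_lt ls nls)).
Qed.

Local Notation W := {fraction {poly {poly rat}}}.
Definition outer_var : W := FracField.tofrac 'X.
Definition inner_var : W := FracField.tofrac ('X)%:P.

Section Value.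
Variables (K : fieldType) (x y : K).
Hypothesis K0 : [pchar K] =i pred0.
Hypothesis reg : regular_at x y.

Lemma rat_value_outer : rat_value outer_var x y x.
Proof. by have := rat_value_poly K0 'X x y; rewrite bieval_outer. Qed.

Lemma rat_value_inner : rat_value inner_var x y y.
Proof. by have := rat_value_poly K0 ('X)%:P x y; rewrite bieval_inner. Qed.

Lemma rat_value_subspace_count n b s d :
  rat_value (subspace_count outer_var n b s d) x y (subspace_count x n b s d).
Proof.
have [x0 x1 _] := reg; have rX i := rat_valueX K0 i rat_value_outer.
apply: rat_value_prod => // i; apply: rat_valueM => //.
  exact: (rat_valueB K0 (rX _) (rX _)).
apply: rat_valueV => //; first exact: (rat_valueB K0 (rX _) (rX _)).
have bid : (b + i < b + d)%N by rewrite ltn_add2l.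
rewrite -(subnK (ltnW bid)) exprD -[X in _ - X]mul1r -mulrBl mulf_neq0 ?expf_neq0 //.
by rewrite subr_eq0 x1 // subn_gt0.
Qed.

Lemma rat_value_transition l s :
  rat_value (transition c outer_var l s) x y (transition c x l s).
Proof. exact: (rat_valueM K0 (rat_value_subspace_count _ _ _ _) (rat_value_subspace_count _ _ _
  _)). Qed.

Lemma rat_value_solve s : s \in states c ->
  rat_value (solve outer_var inner_var s) x y (solve x y s).
Proof.
rewrite /solve; move: (ltnSn (s.1 + s.2)).
move: {2 3 4}(_.+1) => n; elim: n s => [//|n IHn] s; rewrite ltnS => sn sS /=.
have [_|s0] := eqVneq s (0, 0)%N; first exact: rat_value1.
have YX m := rat_valueX K0 m rat_value_inner.
apply: (rat_valueM K0 (rat_valueM K0 (YX _) _)).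
  apply: rat_value_sum => // l lS /andP[ls nls].
  apply: (rat_valueM K0 (rat_value_transition _ _)).
  by apply: IHn => //; rewrite (leq_trans (state_lt ls nls)).
apply: rat_valueV => //; last by have [_ _] := reg; apply.
apply: (rat_valueB K0 (rat_value1 K0 _ _)).
exact: (rat_valueM K0 (YX _) (rat_value_transition _ _)).
Qed.

Lemma rat_value_solve_sum :
  rat_value (\sum_(l <- states c) solve outer_var inner_var l) x y
    (\sum_(l <- states c) solve x y l).
Proof. by apply: rat_value_sum => // l lS _; apply: rat_value_solve. Qed.

End Value.
End Solve.

(** The factors are the zeta function of [o^3] and the generating function of
the pairs of lattices. *)
Definition zeta_rat (K : fieldType) (x y : K) : K :=
  (\sum_(l <- states (fun=> 0%N)) solve (fun=> 0%N) (fun=> 0%N) x y l)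
  * \sum_(l <- states corank_bracket) solve corank_bracket rank_center x y l.

Lemma rat_value_zeta (K : fieldType) (x y : K) : [pchar K] =i pred0 ->
  regular_at (fun=> 0%N) (fun=> 0%N) x y -> regular_at corank_bracket rank_center x y ->
  rat_value (zeta_rat outer_var inner_var) x y (zeta_rat x y).
Proof.
move=> K0 reg0 reg.
exact: (rat_valueM K0 (rat_value_solve_sum K0 reg0) (rat_value_solve_sum K0 reg)).
Qed.

(** * The rational function is determined by the zeta functions *)

Section RealZeta.
Import numFieldNormedType.Exports.
Local Open Scope classical_set_scope.
Variable R : realType.

Lemma cexp_real (x : R) : cexp (x%:C%C : R[i]) = (expR x)%:C%C.
Proof. by rewrite /cexp /= cos0 sin0 mulr1 mulr0. Qed.

Lemma natpow_real (n : nat) (s : R) :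
  natpow n (- (s%:C%C) : R[i]) = (expR (- s * ln n%:R))%:C%C.
Proof. by rewrite /natpow -rmorphN -rmorphM /= cexp_real. Qed.

Lemma real_complex_inj : injective (fun x : R => x%:C%C : R[i]).
Proof. by move=> x y []. Qed.

(** Unconditional convergence: for large finite sets, hence by monotonicity
for all, the partial sums are bounded by the real part of the limit. *)
Lemma complex_sum_esum (I : choiceType) (a : I -> R) (z : R[i]) :
  (forall i, 0 <= a i) ->
  summability.partial_sum (fun i => (a i)%:C%C : R[i]^o) @ summability.totally --> (z : R[i]^o) ->
  z = (complex.Re z)%:C%C /\ \esum_(i in [set: I]) (a i)%:E = (complex.Re z)%:E.
Proof.
move=> a0 cvz; pose S (A : {fset I}) : R := \sum_(i <- A) a i.
have SE A : summability.partial_sum (fun i => (a i)%:C%C : R[i]^o) A = (S A)%:C%C.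
  rewrite /summability.partial_sum /S big_seq_fsetE /= -(rmorph_sum (real_complex R)) //.
have Smono (A B : {fset I}) : (A `<=` B)%fset -> S A <= S B.
  move=> AB; rewrite /S [leRHS](bigID (mem A) xpredT) /= -[X in _ <= X + _]big_filter.
  rewrite [X in _ <= X + _](perm_big A) ?lerDl ?sumr_ge0 //=.
  rewrite uniq_perm ?filter_uniq ?fset_uniq // => i; rewrite mem_filter.
  by case: (boolP (i \in A)) => // /(fsubsetP AB).
have near (e : R) : 0 < e -> exists A : {fset I}, forall B : {fset I}, (A `<=` B)%fset ->
    `|complex.Re z - S B| < e /\ `|complex.Im z| < e.
  move=> e0; have e0' : 0 < (e%:C%C : R[i]) by rewrite ltcR.
  have F : Filter (@summability.totally I) by apply: summability.totally_filter.
  have [A _ AP] := (@cvgrPdist_lt _ _ _ _ _ _ _).1 cvz _ e0'.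
  exists A => B AB; have := AP B AB; rewrite /= SE => zB.
  have zE : z - (S B)%:C%C = ((complex.Re z - S B) +i* complex.Im z)%C.
    by case: z {cvz AP zB} => u v; rewrite -[RHS]/((u - S B) +i* v)%C; congr (_ +i* _)%C; rewrite
      /= subr0.
  rewrite zE in zB; move: (complex.Re z - S B) (complex.Im z) zB => u v uv.
  split; rewrite -ltcR; apply: le_lt_trans uv; first exact: (normc_ge_Re (u +i* v)%C).
  rewrite normc_def lecR /=; rewrite -[leLHS]sqrtr_sqr ler_wsqrtr //. 
  by rewrite lerDr sqr_ge0.
split.
  apply/eqP; rewrite eq_complex /= eqxx /= -normr_eq0; apply/eqP/le_anti.
  rewrite normr_ge0 andbT; apply/ler_addgt0Pl => e e0; rewrite addr0.
  by have [A /(_ A (fsubset_refl _))[_ /ltW]] := near e e0.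
apply/le_anti/andP; split.
  apply: ub_ereal_sup => _ [A [fA _] <-].
  rewrite fsbig_finite //= sumEFin lee_fin -/(S _).
  apply/ler_addgt0Pl => e e0; have [B /(_ (B `|` fset_set A)%fset)[|zS _]] := near e e0.
    exact: fsubsetUl.
  apply: (le_trans (Smono _ (B `|` fset_set A)%fset (fsubsetUr _ _))).
  by rewrite -lerBlDr; move: zS; rewrite ltr_norml => /andP[]; lra.
apply/lee_addgt0Pr => e e0; have [A /(_ A (fsubset_refl _))[zS _]] := near e e0.
apply: (@le_trans _ _ ((S A)%:E + e%:E)%E).
  by rewrite -EFinD lee_fin; move: zS; rewrite ltr_norml => /andP[]; lra.
rewrite leeD2r // ; apply: ereal_sup_ubound; exists [set` A]; first by split.
by rewrite fsbig_finite //= set_fsetK sumEFin.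
Qed.
End RealZeta.

Section Morphism.
Variables (F K : fieldType) (f : {rmorphism F -> K}).

Lemma rmorph_transition c (x : F) l s : f (transition c x l s) = transition c (f x) l s.
Proof.
have E n b a d : f (subspace_count x n b a d) = subspace_count (f x) n b a d.
  by rewrite /subspace_count rmorph_prod; apply: eq_bigr => i _; rewrite fmorph_div !rmorphB !rmorphXn.
by rewrite /transition rmorphM !E.
Qed.

Lemma rmorph_solve c z (x y : F) s : f (solve c z x y s) = solve c z (f x) (f y) s.
Proof.
rewrite /solve; move: (_.+1) => n; elim: n s => [|n IHn] s /=; first exact: rmorph0.
case: eqP => _; first exact: rmorph1.
rewrite fmorph_div rmorphB rmorph1 ![f (y ^+ _ * _)]rmorphM rmorphXn rmorph_transition rmorph_sum.
by congr (_ * _ / _); apply: eq_bigr => l _; rewrite [LHS]rmorphM IHn rmorph_transition.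
Qed.

Lemma rmorph_zeta_rat (x y : F) : f (zeta_rat x y) = zeta_rat (f x) (f y).
Proof.
rewrite /zeta_rat rmorphM !rmorph_sum.
by congr (_ * _); apply: eq_bigr => l _; apply: rmorph_solve.
Qed.

Lemma rmorph_regular c z (x y : F) : regular_at c z x y -> regular_at c z (f x) (f y).
Proof.
move=> [x0 x1 reg]; split=> [|i i0|s sS s0]; first by rewrite fmorph_eq0.
  by rewrite -rmorphXn fmorph_eq1 x1.
by rewrite -rmorph_transition -rmorphXn -rmorphM -(rmorph1 f) -rmorphB fmorph_eq0 reg.
Qed.

End Morphism.

(** For a fixed [x > 1] all the denominators are close to [1] when [y] is small. *)
Lemma regular_small (R : realType) c z (x : R) : 1 < x ->
  exists2 d : R, 0 < d & forall y, 0 < y -> y < d -> regular_at c z x y.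
Proof.
move=> x1; pose M : R := 1 + \sum_(s <- states c) `|transition c x s s|.
have M0 : 1 <= M by rewrite lerDl sumr_ge0.
exists M^-1 => [|y y0 yM]; first by rewrite invr_gt0 (lt_le_trans ltr01).
have yM1 : y * M < 1 by rewrite -ltr_pdivlMr ?mul1r // (lt_le_trans ltr01).
have y1 : y <= 1.
  by apply: ltW (lt_le_trans yM _); rewrite invf_le1 // (lt_le_trans ltr01).
split=> [|i i0|s sS s0]; first by rewrite gt_eqF // (lt_trans ltr01).
  by rewrite gt_eqF // exprn_egt1 // -lt0n.
rewrite subr_eq0; apply/negP => /eqP/(congr1 Num.norm); rewrite normr1 normrM.
apply/eqP; rewrite gt_eqF // (le_lt_trans _ yM1) // ler_pM //.
  rewrite normrX gtr0_norm // -[leRHS]expr1 ler_wiXn2l ?(ltW y0) //.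
  by case: s s0 {sS} => [[|a] [|b]] // _; rewrite /state_size /=; lia.
rewrite /M (bigD1_seq s) ?uniq_states //= addrCA lerDl addr_ge0 // sumr_ge0 //.
Qed.

Lemma prime_sequence : exists2 u : nat -> nat, injective u & forall i, prime (u i).
Proof.
pose u i := iter i (fun n => s2val (prime_above n)) 2.
have uS i : (u i < u i.+1)%N by rewrite /u /=; case: prime_above.
have uP i : prime (u i) by case: i => [|i] //; rewrite /u /=; case: prime_above.
clearbody u; exists u => // i j uij; have lt_u := homo_ltn ltn_trans uS.
by case: (ltngtP i j) => // /lt_u; rewrite uij ltnn.
Qed.

Section Uniqueness.
Import numFieldNormedType.Exports.
Local Open Scope classical_set_scope.
(** A Dirichlet series does not see [W] itself but its values at the points
[(p, p^-s)]; these are dense enough to determine [W]. *)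
Lemma graded_zeta_unique (R : realType) (W : {fraction {poly {poly rat}}}) :
  (forall (p : nat) (p_pr : prime p) (K : fieldExtType (padic p_pr)),
     let o := ring_of_integers K in
     let q := residue_card o in
     exists s0 : R, forall s : R[i], s0 < complex.Re s ->
       exists2 z : R[i],
         rat_value W q%:R (natpow q (- s)) z &
         graded_ideal_zeta (free_nilpotent_over 3 3 o) 3 s z) ->
  W = zeta_rat outer_var inner_var.
Proof.
move=> W_zeta; have R0 : [pchar R[i]] =i pred0 by apply: pchar_num.
have val (p : nat) : prime p -> exists2 T : nat -> R[i], injective T &
    forall j, rat_value (W - zeta_rat outer_var inner_var) p%:R (T j) 0.
  move=> p_pr; pose K : fieldExtType (padic p_pr) := (padic p_pr)^o.
  have [s0 s0P] := W_zeta p p_pr K.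
  have [rho uP] := padic_uniformizer p_pr.
  have qE : residue_card (ring_of_integers K) = p.
    by rewrite (residue_card_uniformizer uP) card_Fp.
  have p1 : 1 < p%:R :> R by rewrite ltr1n prime_gt1.
  have lnp : 0 < ln (p%:R : R) by rewrite ln_gt0.
  have [d1 d1_0 d1P] := regular_small (fun=> 0%N) (fun=> 0%N) p1.
  have [d2 d2_0 d2P] := regular_small corank_bracket rank_center p1.
  (* Beyond the abscissa [s0] and both bounds for regularity. *)
  pose sg (j : nat) : R := `|s0| + `|ln d1| / ln p%:R + `|ln d2| / ln p%:R + 1 + j%:R.
  pose T j : R := expR (- sg j * ln p%:R).
  have q1 : 0 <= `|ln d1| / ln (p%:R : R) by rewrite divr_ge0 // ltW.
  have q2 : 0 <= `|ln d2| / ln (p%:R : R) by rewrite divr_ge0 // ltW.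
  have Tsmall d j : 0 < d -> `|ln d| / ln p%:R < sg j -> T j < d.
    move=> d0; rewrite ltr_pdivrMr // => lt_d.
    rewrite -[X in _ < X]lnK ?posrE // ltr_expR mulNr ltrNl.
    by rewrite (le_lt_trans _ lt_d) // ler_normr lexx orbT.
  exists (fun j => (T j)%:C%C) => [i j /real_complex_inj /expR_inj|j].
    move/(mulIf (lt0r_neq0 lnp))/oppr_inj/addrI/eqP; rewrite eqr_nat => /eqP //.
  have reg1 : regular_at (fun=> 0%N) (fun=> 0%N) (p%:R : R) (T j).
    by apply: d1P; rewrite ?expR_gt0 // Tsmall // /sg; have := normr_ge0 s0; have := ler0n R j; lra.
  have reg2 : regular_at corank_bracket rank_center (p%:R : R) (T j).
    by apply: d2P; rewrite ?expR_gt0 // Tsmall // /sg; have := normr_ge0 s0; have := ler0n R j; lra.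
  have pC : (p%:R : R[i]) = real_complex R p%:R by rewrite rmorph_nat.
  have sz : (zeta_rat p%:R (T j))%:C%C = zeta_rat (p%:R : R[i]) (T j)%:C%C.
    by rewrite pC -rmorph_zeta_rat.
  have [|z Wz cz] := s0P (sg j)%:C%C.
    by rewrite /= /sg; have := ler_norm s0; have := ler0n R j; lra.
  suff zE : z = zeta_rat (p%:R : R[i]) (T j)%:C%C.
    rewrite -(subrr z) {2}zE; apply: rat_valueB => //.
      by move: Wz; rewrite qE natpow_real.
    by apply: rat_value_zeta => //; rewrite pC; apply: rmorph_regular.
  rewrite -sz; pose w (n : nat) : R := expR (- sg j * ln n%:R).
  have wM m n : (0 < m)%N -> (0 < n)%N -> w (m * n)%N = w m * w n.
    by move=> m0 n0; rewrite /w natrM lnM ?posrE ?ltr0n // mulrDr expRD.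
  have w1 : w 1%N = 1 by rewrite /w ln1 mulr0 expR0.
  have w0 n : 0 <= w n by apply: expR_ge0.
  pose L := free_nilpotent_over 3 3 (ring_of_integers K).
  have wE : (fun I : graded_ideal L 3 => natpow (coset_index I) (- (sg j)%:C%C) : R[i]^o)
      = (fun I => (w (coset_index I))%:C%C) by apply/funext => I; rewrite natpow_real.
  move: cz; rewrite /graded_ideal_zeta wE => cvz.
  have [zE] := complex_sum_esum (fun=> w0 _) cvz.
  move/(graded_ideal_system uP w1 w0 wM) => [h [g [hP gP vE]]]; rewrite zE vE.
  rewrite card_Fp // -/(T j) in hP gP *.
  congr (_%:C%C); congr (_ * _); rewrite big_seq [RHS]big_seq; apply: eq_bigr => l lS.
    exact: (solve_unique reg1).
  exact: (solve_unique reg2).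
have [u u_inj u_prime] := prime_sequence.
have [T TP] := choice (fun i => let: ex_intro2 T TI TV := val _ (u_prime i) in ex_intro _ T (conj
  TI TV)).
have [P [Q [Q0 UE]]] := fraction_quotient (W - zeta_rat outer_var inner_var).
have P0 : P = 0.
  apply: (bieval_dense R0 u_inj (fun i => (TP i).1)) => i j.
  exact: (rat_value_eq0 R0 UE Q0 ((TP i).2 j)).
by apply/eqP; rewrite -subr_eq0 UE P0 rmorph0 mul0r.
Qed.
End Uniqueness.

(** * Leading terms of Laurent series *)

Section Laurent.
Variable F : fieldType.
Hypothesis F0 : [pchar F] =i pred0.
Local Notation laurent := {fraction fps F}.
Local Notation tof := (@FracField.tofrac (fps F)).

(** The list of the first [n + 1] coefficients of the inverse, since each one
depends on all the earlier ones. *)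
Fixpoint fps_inv_coefs (g : fps F) (n : nat) : seq F :=
  if n is m.+1 then
    let hs := fps_inv_coefs g m in
    rcons hs (- (g 0%N)^-1 * \sum_(i < m.+1) g (m.+1 - i)%N * hs`_i)
  else [:: (g 0%N)^-1].

Lemma fps_inverse (g : fps F) : g 0%N != 0 ->
  exists2 h : fps F, g * h = 1 & h 0%N = (g 0%N)^-1.
Proof.
move=> g0; pose h := FPS (fun n => (fps_inv_coefs g n)`_n).
have size_h n : size (fps_inv_coefs g n) = n.+1 by elim: n => //= n IHn; rewrite size_rcons IHn.
have hE n i : (i <= n)%N -> (fps_inv_coefs g n)`_i = h i.
  elim: n => [|n IHn]; first by rewrite leqn0 => /eqP ->.
  rewrite leq_eqVlt => /orP[/eqP -> //|]; rewrite ltnS => le_in.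
  by rewrite /= nth_rcons size_h ltnS le_in IHn.
exists h => //; rewrite mulrC; apply: fpsP => -[|n].
  by rewrite -[LHS]/(fps_mul h g 0%N) /= big_ord1 /= mulVf.
rewrite -[LHS]/(fps_mul h g n.+1) /= big_ord_recr /= subnn.
rewrite [(rcons _ _)`_n.+1](_ : _ = - (g 0%N)^-1 * \sum_(i < n.+1) g (n.+1 - i)%N * h i).
  rewrite mulrAC mulNr mulVf // mulN1r; apply/eqP; rewrite subr_eq0; apply/eqP/eq_bigr => i _.
  by rewrite mulrC.
rewrite nth_rcons size_h ltnn eqxx; congr (_ * _); apply: eq_bigr => i _.
by rewrite hE // -ltnS ltn_ord.
Qed.

Local Notation u := (tof (fps_u F)).

Lemma u_neq0 : u != 0 :> laurent.
Proof.
rewrite tofrac_eq0; apply/eqP => /(congr1 (fun f : fps F => f 1%N)) /eqP.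
by rewrite -[_ == _]/((1 : F) == 0) oner_eq0.
Qed.

(** [f] is [a u^n] up to terms of higher order; [a = 0] is allowed. *)
Definition lead (f : laurent) (n : int) (a : F) : Prop :=
  exists2 g : fps F, f = tof g * u ^ n & g 0%N = a.

Lemma lead_inj f n a b : lead f n a -> lead f n b -> a = b.
Proof.
move=> [g -> <-] [h]; move/(mulIf _)/eqP; rewrite tofrac_eq expfz_neq0 ?u_neq0 //.
by move/(_ isT)/eqP => -> <-.
Qed.

Lemma lead_tofrac (g : fps F) : lead (tof g) 0 (g 0%N).
Proof. by exists g; rewrite // expr0z mulr1. Qed.

Lemma lead1 : lead 1 0 1.
Proof. by rewrite -(rmorph1 tof); apply: (lead_tofrac 1). Qed.

Lemma lead0 n : lead 0 n 0.
Proof. by exists 0; rewrite // rmorph0 mul0r. Qed.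

Lemma leadD f g n a b : lead f n a -> lead g n b -> lead (f + g) n (a + b).
Proof. by move=> [f' -> <-] [g' -> <-]; exists (f' + g'); rewrite // rmorphD mulrDl. Qed.

Lemma leadN f n a : lead f n a -> lead (- f) n (- a).
Proof. by move=> [f' -> <-]; exists (- f'); rewrite // rmorphN mulNr. Qed.

Lemma leadM f g n m a b : lead f n a -> lead g m b -> lead (f * g) (n + m) (a * b).
Proof.
move=> [f' -> <-] [g' -> <-]; exists (f' * g').
  by rewrite rmorphM expfzDr ?u_neq0 //= mulrACA.
by rewrite -[LHS]/(fps_mul f' g' 0%N) /= big_ord1.
Qed.

Lemma leadV f n a : lead f n a -> a != 0 -> lead f^-1 (- n) a^-1.
Proof.
move=> [g -> <-] /fps_inverse[h gh h0]; exists h => //.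
have th : tof g * tof h = 1 by rewrite -rmorphM gh rmorph1.
have g0 : tof g != 0 by apply: contra_eq_neq th => ->; rewrite mul0r eq_sym oner_neq0.
by rewrite invfM -invr_expz; congr (_ * _); apply: (mulfI g0); rewrite divff.
Qed.

Lemma lead_shift f n m a : lead f n a -> m < n -> lead f m 0.
Proof.
move=> [g -> ga] mn; have [k ->] : exists k : nat, n = m + k.+1%:Z.
  by exists `|n - m|%N.-1; lia.
exists (g * fps_u F ^+ k.+1).
  by rewrite rmorphM rmorphXn /= expfzDr ?u_neq0 // mulrAC mulrA.
rewrite exprS mulrCA; set h := g * _; rewrite -[LHS]/(fps_mul (fps_u F) h 0%N).
by rewrite /= big_ord1 /= mul0r.
Qed.

Lemma lead_sum (I : eqType) (r : seq I) (P : pred I) f n (a : I -> F) :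
  (forall i, i \in r -> P i -> lead (f i) n (a i)) ->
  lead (\sum_(i <- r | P i) f i) n (\sum_(i <- r | P i) a i).
Proof.
move=> fa; rewrite big_seq_cond [X in lead _ _ X]big_seq_cond.
elim/big_ind2: _ => [|f1 a1 f2 a2|i /andP[ir Pi]]; [exact: lead0|exact: leadD|exact: fa].
Qed.

Lemma lead_prod d (f : 'I_d -> laurent) (a : 'I_d -> F) :
  (forall i, lead (f i) 0 (a i)) -> lead (\prod_i f i) 0 (\prod_i a i).
Proof.
move=> fa; elim/big_ind2: _ => // [|f1 a1 f2 a2]; first exact: lead1.
exact: leadM.
Qed.

Lemma lead_neq0 f n a : lead f n a -> a != 0 -> f != 0.
Proof.
move=> fa; apply: contraNneq => f0; rewrite f0 in fa.
by rewrite (lead_inj fa (lead0 n)).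
Qed.

Lemma lead_coef f (N : nat) a : lead f (- N%:Z) a -> laurent_coef f (- N%:Z) a.
Proof.
move=> [g -> ga]; exists N, g; split; first by rewrite rmorphXn /= exprnN.
by have -> : - N%:Z + N%:Z = Posz 0 by lia.
Qed.

(** The multiplicative group of series [1 + a u + ...], on which the linear
coefficient [a] is additive. *)
Definition near1 (f : laurent) (a : F) := lead (f - 1) 1 a.

Lemma near1_1 : near1 1 0.
Proof. by rewrite /near1 subrr; apply: lead0. Qed.

Lemma near1M f g a b : near1 f a -> near1 g b -> near1 (f * g) (a + b).
Proof.
move=> fa gb; rewrite /near1 (_ : f * g - 1 = (f - 1) * (g - 1) + ((f - 1) + (g - 1))); last by ring.
rewrite -[a + b]add0r; apply: leadD; last exact: leadD.
exact: lead_shift (leadM fa gb) _.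
Qed.

Lemma near1X f a n : near1 f a -> near1 (f ^+ n) (n%:R * a).
Proof.
move=> fa; elim: n => [|n IHn]; first by rewrite mul0r; apply: near1_1.
by rewrite exprS -natr1 mulrDl mul1r addrC; apply: near1M.
Qed.

Lemma near1_lead f a : near1 f a -> lead f 0 1.
Proof.
move=> fa; rewrite -[f](subrK 1) -[X in lead _ _ X]add0r; apply: leadD lead1.
exact: lead_shift fa _.
Qed.

Lemma near1B f g a b : near1 f a -> near1 g b -> lead (f - g) 1 (a - b).
Proof.
move=> fa gb; rewrite (_ : f - g = (f - 1) - (g - 1)); last by ring.
exact: leadD fa (leadN gb).
Qed.

Lemma near1_series (g : fps F) : g 0%N = 1 -> near1 (tof g) (g 1%N).
Proof.
move=> g0; pose h := FPS (fun n => g n.+1).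
exists h => //; rewrite expr1z -(rmorph1 tof) -rmorphB -rmorphM /=; congr (tof _).
apply: fpsP => n; rewrite mulrC -[RHS]/(fps_mul (fps_u F) h n) /=.
case: n => [|n]; first by rewrite big_ord1 mul0r -[LHS]/(g 0%N - 1) g0 subrr.
rewrite big_ord_recl /= mul0r add0r big_ord_recl /= mul1r subSS subn0 big1 ?addr0.
  by rewrite -[LHS]/(g n.+1 - 0) subr0.
by move=> i _; rewrite mul0r.
Qed.

End Laurent.

(** * Leading terms of the solutions *)

Lemma subspace_count_diag (K : fieldType) (x : K) n b a d :
  x != 0 -> (forall i, (0 < i)%N -> x ^+ i != 1) ->
  n = (b + a + d)%N -> subspace_count x n b a d = x ^+ (a * d).
Proof.
move=> x0 x1 ->; rewrite /subspace_count (eq_bigr (fun=> x ^+ a)).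
  by rewrite prodr_const card_ord -exprM.
move=> i _; have -> : (b + a + d = a + (b + d))%N by lia.
have -> : (b + a + i = a + (b + i))%N by lia.
rewrite !(exprD x a) -mulrBr mulfK //; have di := ltn_ord i.
have -> : (b + d = (d - i) + (b + i))%N by lia.
rewrite (exprD x (d - i)) -[X in _ - X]mul1r -mulrBl mulf_neq0 ?expf_neq0 //.
by rewrite subr_eq0 x1 // subn_gt0.
Qed.

Section Leading.
Variables (F : fieldType) (s : F).
Hypothesis F0 : [pchar F] =i pred0.
Variables (x y : {fraction fps F}).
Hypotheses (x_near1 : near1 x 1) (y_near1 : near1 y (- s)).

Lemma natr_char0_eq0 n : (n%:R == 0 :> F) = (n == 0%N).
Proof. by have /pcharf0P := F0. Qed.

Lemma natr_lt_sub m n : (m < n)%N -> n%:R - m%:R != 0 :> F.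
Proof. by move=> mn; rewrite -natrB ?natr_char0_eq0 -?lt0n ?subn_gt0 // ltnW. Qed.

Lemma near1_x n : near1 (x ^+ n) n%:R.
Proof. by rewrite -[n%:R]mulr1; apply: near1X. Qed.

Lemma near1_x_neq1 n : (0 < n)%N -> x ^+ n != 1.
Proof.
move=> n0; rewrite -subr_eq0 (lead_neq0 (near1_x n)) //.
by rewrite natr_char0_eq0 -lt0n.
Qed.

Lemma near1_x_neq0 : x != 0.
Proof. exact: lead_neq0 (near1_lead x_near1) (oner_neq0 _). Qed.

Definition subspace_limit n b a d : F :=
  \prod_(i < d) ((n%:R - (b + a + i)%:R) / ((b + d)%:R - (b + i)%:R)).

Lemma lead_subspace_count n b a d : lead (subspace_count x n b a d) 0 (subspace_limit n b a d).
Proof.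
apply: lead_prod => i; rewrite -(addrN 1); apply: leadM.
  exact: near1B (near1_x _) (near1_x _).
apply: leadV; first exact: near1B (near1_x _) (near1_x _).
by rewrite natr_lt_sub // ltn_add2l.
Qed.

Lemma subspace_limit_diag n b a d : n = (b + a + d)%N -> subspace_limit n b a d = 1.
Proof.
move=> ->; rewrite /subspace_limit big1 // => i _.
rewrite !natrD (_ : _ - _ = (b%:R + d%:R) - (b%:R + i%:R)); last by ring.
by rewrite divff // -!natrD natr_lt_sub // ltn_add2l.
Qed.

(** The product telescopes. *)
Lemma subspace_limit_step n b a d : n = (b + a + d).+1 -> subspace_limit n b a d = d.+1%:R.
Proof.
move=> ->; transitivity (\prod_(i < d) ((d.+1 - i)%:R / (d - i)%:R : F)).
  apply: eq_bigr => i _; have di := ltn_ord i; rewrite -!natrB; [|lia|lia].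
  by congr (_%:R / _%:R); lia.
elim: d => [|d IHd]; first by rewrite big_ord0.
rewrite big_ord_recl IHd /= !subn0 divfK //.
by rewrite natr_char0_eq0.
Qed.

Variables (c z : nat -> nat).
Hypothesis c_le8 : forall r, (c r <= 8)%N.

(** By [subspace_count_diag] the diagonal transition is the power of [x] with
this exponent, so [lead_denominator] is a computation in first order. *)
Definition pole (l : nat * nat) : F :=
  (state_size z l)%:R * s - (l.1 * (3 - l.1) + l.2 * (c l.1 - l.2))%:R.

Hypothesis pole_neq0 : forall l, l \in states c -> l != (0, 0)%N -> pole l != 0.

Lemma lead_denominator l : l \in states c ->
  lead (1 - y ^+ state_size z l * transition c x l l) 1 (pole l).
Proof.
case: l => r2 r3; rewrite mem_states /= => /andP[/= l1 l2]; have c8 := c_le8 r2.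
have E8 : (8 = 8 - c r2 + r3 + (c r2 - r3))%N by move: (c r2) l2 c8 => d l2 c8; lia.
have E3 : (3 = 0 + r2 + (3 - r2))%N by lia.
rewrite /transition (subspace_count_diag near1_x_neq0 near1_x_neq1 E3).
rewrite (subspace_count_diag near1_x_neq0 near1_x_neq1 E8) -exprD /=.
rewrite (_ : pole _ = 0 - ((state_size z (r2, r3))%:R * - s + (r2 * (3 - r2) + r3 * (c r2 - r3))%:R)).
  exact: near1B (near1_1 _) (near1M (near1X _ y_near1) (near1_x _)).
by rewrite /pole; ring.
Qed.

Lemma near1_regular : regular_at c z x y.
Proof.
split=> [|i i0|l lS l0]; [exact: near1_x_neq0|exact: near1_x_neq1|].
exact: lead_neq0 (lead_denominator lS) (pole_neq0 lS l0).
Qed.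

Definition transition_limit (l k : nat * nat) : F :=
  subspace_limit 3 0 l.1 (3 - k.1) * subspace_limit 8 (8 - c k.1) l.2 (c k.1 - k.2).

(** The coefficients of order [- (k.1 + k.2)] of the solution: among the
smaller states only those of size one less have a pole of high enough order to
contribute. *)
Fixpoint top_rec (n : nat) (k : nat * nat) : F :=
  if n is m.+1 then
    if k == (0, 0)%N then 1 else
    (\sum_(l <- states c | state_le l k && ((l.1 + l.2).+1 == k.1 + k.2)%N)
      transition_limit l k * top_rec m l) / pole k
  else 0.

Definition top k := top_rec (k.1 + k.2).+1 k.

Lemma top0 : top (0, 0)%N = 1.
Proof. by []. Qed.

(** The transitions have order 0, so the term of a smaller state [l] has order
[- (l.1 + l.2)], and the division by the denominator, of order 1, lowers the
order by one. *)
Lemma lead_solve k : k \in states c -> lead (solve c z x y k) (- (k.1 + k.2)%:Z) (top k).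
Proof.
rewrite /solve /top; move: (ltnSn (k.1 + k.2)).
move: {2 3 4}(_.+1) => n; elim: n k => [//|n IHn] k; rewrite ltnS => kn kS /=.
have [-> /=|k0] := eqVneq k (0, 0)%N; first exact: lead1.
have -> : - (k.1 + k.2)%:Z = (1 - (k.1 + k.2)%:Z) + (- 1) by lia.
apply: leadM; last exact: leadV (lead_denominator kS) (pole_neq0 kS k0).
rewrite -[X in lead _ X]add0r -[X in lead _ _ X]mul1r; apply: leadM.
  exact: near1_lead (near1X _ y_near1).
rewrite big_mkcondr [X in lead _ _ X]big_mkcondr; apply: lead_sum => l lS lk.
have lt_lk : l != k -> (l.1 + l.2 < k.1 + k.2)%N by apply: state_lt.
case: (eqVneq l k) => [->|/lt_lk {}lt_lk].
  by rewrite ifN ?gtn_eqF //; apply: lead0.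
have trans : lead (transition c x l k) 0 (transition_limit l k).
  by rewrite -(addr0 0); apply: leadM; apply: lead_subspace_count.
have IHl : lead (solve_rec c z x y n l) (- (l.1 + l.2)%:Z) (top_rec n l).
  by apply: IHn => //; rewrite (leq_trans lt_lk).
have prod := leadM trans IHl; rewrite add0r in prod.
case: eqP => [E|ne] /=.
  have shift i j : i.+1 = j -> 1 - j%:Z = - i%:Z by lia.
  by rewrite (shift _ _ E).
by apply: (lead_shift prod); move: (l.1 + l.2)%N (k.1 + k.2)%N lt_lk ne => i j; lia.
Qed.

Lemma sum_state_eq (B : bool) k (f : nat * nat -> F) :
  \sum_(l <- states c | B && (l == k)) f l = if B && (k \in states c) then f k else 0.
Proof.
case: B => /=; last by rewrite big_pred0.
case: ifP => kS; first rewrite (@big_seq_condD1 _ _ _ (pred1 k) _ k kS (uniq_states c)) /= ?eqxx //.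
  by rewrite big_pred0 ?addr0 // => l; case: eqP.
by rewrite big1_seq // => l /andP[/eqP ->]; rewrite kS.
Qed.

(** A state of size one less is obtained by lowering one coordinate by 1. Then
one of the two factors of the transition is diagonal, with limit 1, and the
other is given by [subspace_limit_step]. *)
Lemma topE (a b : nat) : (a, b) \in states c -> (a, b) != (0, 0)%N ->
  top (a, b) * pole (a, b) =
    (if (0 < a)%N && (b <= c a.-1)%N then (4 - a)%:R * top (a.-1, b) else 0)
    + (if (0 < b)%N then (c a - b).+1%:R * top (a, b.-1) else 0).
Proof.
move=> kS k0; rewrite {1}/top /= (negPf k0) divfK ?pole_neq0 //.
have := kS; rewrite mem_states /= => /andP[a3 bc]; have c8 := c_le8 a.
transitivity (\sum_(l <- states c | (0 < a)%N && (l == (a.-1, b)) || (0 < b)%N && (l == (a, b.-1)))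
    transition_limit l (a, b) * top l).
  apply: eq_big => [[i j]|[i j] /andP[_ /eqP <-]] //.
  by rewrite /state_le !xpair_eqE /=; lia.
rewrite (bigID (fun l => (0 < a)%N && (l == (a.-1, b)))) /=; congr (_ + _).
  rewrite (eq_bigl (fun l => (0 < a)%N && (l == (a.-1, b)))) => [|l]; last first.
    by case: (0 < a)%N; case: (0 < b)%N; case: (l == _); case: (l == _).
  rewrite sum_state_eq mem_states /=; case: (posnP a) => //= a0.
  rewrite (_ : (a.-1 <= 3)%N) /=; last by lia.
  case: ifP => // _; congr (_ * _); rewrite /transition_limit /=.
  rewrite (@subspace_limit_diag 8) ?mulr1; last by move: (c a) bc c8 => d; lia.
  by rewrite subspace_limit_step; [congr _%:R|]; lia.
rewrite (eq_bigl (fun l => (0 < b)%N && (l == (a, b.-1)))) => [|[i j]]; last first.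
  by rewrite !xpair_eqE; move: (j) (i) => {}j {}i; lia.
rewrite sum_state_eq mem_states /=; case: (posnP b) => //= b0.
rewrite a3 (leq_trans (leq_pred b) bc) /=; congr (_ * _); rewrite /transition_limit /=.
rewrite (@subspace_limit_diag 3) ?mul1r; last by lia.
by rewrite subspace_limit_step //; move: (c a) bc c8 => d; lia.
Qed.

(** The state [(3, c 3)] is the only one of maximal size. *)
Lemma lead_solve_sum : (forall r, (r <= 3)%N -> (c r <= c 3)%N) ->
  lead (\sum_(k <- states c) solve c z x y k) (- (3 + c 3)%:Z) (top (3, c 3)).
Proof.
move=> c3; have maxS : (3, c 3) \in states c by rewrite mem_states /= leqnn.
have := sum_state_eq true (3, c 3) top; rewrite maxS /= => <-.
rewrite [X in lead _ _ X]big_mkcond; apply: lead_sum => -[a b] kS _.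
have := kS; rewrite mem_states xpair_eqE /= => /andP[/= a3 bc].
have lk := lead_solve kS; have ca3 := c3 a a3.
case: (boolP ((a == 3) && (b == c 3))) => [/andP[/eqP aE /eqP bE]|ne].
  by rewrite aE bE in lk *.
by apply: (lead_shift lk); move: (c a) (c 3) bc ca3 ne => m n /= bm mn; lia.
Qed.

End Leading.

(** * The leading coefficients in closed form *)

Section Top.
Variables (F : fieldType) (s : F).
Hypothesis F0 : [pchar F] =i pred0.
Hypothesis s_lin : forall a b : nat, (0 < a)%N -> a%:R * s - b%:R != 0.

Lemma pole_free_neq0 l : l \in states (fun=> 0%N) -> l != (0, 0)%N ->
  pole s (fun=> 0%N) (fun=> 0%N) l != 0.
Proof. by case: l => [[|a] [|b]] lS // _; apply: s_lin. Qed.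

Lemma pole_bracket_neq0 l : l \in states corank_bracket -> l != (0, 0)%N ->
  pole s corank_bracket rank_center l != 0.
Proof. by case: l => [[|a] [|b]] lS // _; apply: s_lin; rewrite /state_size /=; lia. Qed.

Local Notation g a b := (top s corank_bracket rank_center (a, b)).
Local Ltac nz := repeat (apply/andP; split); first [assumption | by rewrite (natr_char0_eq0 F0)].
(** The recursion [topE] is followed through all states. Common factors are
cancelled at each state, as in [8 s - 8 = 8 (s - 1)], which keeps the
numerators at degree 4 or less. *)
Lemma top_bracket : g 3 8 =
  (2375%:R / 4%:R * s ^+ 4 - 81537%:R / 56%:R * s ^+ 3 + 66573%:R / 56%:R * s ^+ 2 - 2600%:R /
    7%:R * s + 240%:R / 7%:R) / (s ^+ 2 * (s - 1) ^+ 3 * (2%:R * s - 3%:R) * (3%:R * s - 2%:R) *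
    (3%:R * s - 5%:R) * (4%:R * s - 3%:R) * (5%:R * s - 1) * (5%:R * s - 2%:R) * (5%:R * s -
    8%:R) * (7%:R * s - 8%:R) * (11%:R * s - 15%:R) * (13%:R * s - 7%:R)).
Proof.
have E a b aS ab0 := topE F0 corank_bracket_le8 pole_bracket_neq0 (a := a) (b := b) aS ab0.
have n10 : s != 0 by have := s_lin (a := 1) 0 isT; rewrite mul1r subr0.
have n1_1 : s - 1 != 0 by have := s_lin (a := 1) 1 isT; rewrite ?mul1r.
have n2_3 : 2%:R * s - 3%:R != 0 by have := s_lin (a := 2) 3 isT; rewrite ?mul1r.
have n3_2 : 3%:R * s - 2%:R != 0 by have := s_lin (a := 3) 2 isT; rewrite ?mul1r.
have n3_5 : 3%:R * s - 5%:R != 0 by have := s_lin (a := 3) 5 isT; rewrite ?mul1r.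
have n4_3 : 4%:R * s - 3%:R != 0 by have := s_lin (a := 4) 3 isT; rewrite ?mul1r.
have n5_1 : 5%:R * s - 1 != 0 by have := s_lin (a := 5) 1 isT; rewrite ?mul1r.
have n5_2 : 5%:R * s - 2%:R != 0 by have := s_lin (a := 5) 2 isT; rewrite ?mul1r.
have n5_8 : 5%:R * s - 8%:R != 0 by have := s_lin (a := 5) 8 isT; rewrite ?mul1r.
have n7_8 : 7%:R * s - 8%:R != 0 by have := s_lin (a := 7) 8 isT; rewrite ?mul1r.
have n11_15 : 11%:R * s - 15%:R != 0 by have := s_lin (a := 11) 15 isT; rewrite ?mul1r.
have n13_7 : 13%:R * s - 7%:R != 0 by have := s_lin (a := 13) 7 isT; rewrite ?mul1r.
have E10 : g 1 0 = 3%:R / ((3%:R * s - 2%:R)).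
  apply: (mulIf (s_lin (a := 3) 2 isT)).
  rewrite [LHS](E 1 0 isT isT : _ = 3%:R * g 0 0 + 0).
  rewrite top0; field; nz.
have E11 : g 1 1 = 6%:R / ((3%:R * s - 2%:R) * (4%:R * s - 3%:R)).
  apply: (mulIf (s_lin (a := 4) 3 isT)).
  rewrite [LHS](E 1 1 isT isT : _ = 0 + 2%:R * g 1 0).
  rewrite E10; field; nz.
have E12 : g 1 2 = 6%:R / ((3%:R * s - 2%:R) * (4%:R * s - 3%:R) * (5%:R * s - 2%:R)).
  apply: (mulIf (s_lin (a := 5) 2 isT)).
  rewrite [LHS](E 1 2 isT isT : _ = 0 + 1%:R * g 1 1).
  rewrite E11; field; nz.
have E20 : g 2 0 = 6%:R / ((3%:R * s - 2%:R) * (5%:R * s - 2%:R)).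
  apply: (mulIf (s_lin (a := 5) 2 isT)).
  rewrite [LHS](E 2 0 isT isT : _ = 2%:R * g 1 0 + 0).
  rewrite E10; field; nz.
have E21 : g 2 1 = (30%:R * s - 19%:R) / ((s - 1) * (3%:R * s - 2%:R) * (4%:R * s - 3%:R) * (5%:R
  * s - 2%:R)).
  apply: (mulIf (s_lin (a := 6) 6 isT)).
  rewrite [LHS](E 2 1 isT isT : _ = 2%:R * g 1 1 + 5%:R * g 2 0).
  rewrite E11 E20; field; nz.
have E22 : g 2 2 = 44%:R / ((s - 1) * (4%:R * s - 3%:R) * (5%:R * s - 2%:R) * (7%:R * s - 8%:R)).
  apply: (mulIf (s_lin (a := 7) 8 isT)).
  rewrite [LHS](E 2 2 isT isT : _ = 2%:R * g 1 2 + 4%:R * g 2 1).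
  rewrite E12 E21; field; nz.
have E23 : g 2 3 = 33%:R / 2%:R / ((s - 1) ^+ 2 * (4%:R * s - 3%:R) * (5%:R * s - 2%:R) * (7%:R *
  s - 8%:R)).
  apply: (mulIf (s_lin (a := 8) 8 isT)).
  rewrite [LHS](E 2 3 isT isT : _ = 0 + 3%:R * g 2 2).
  rewrite E22; field; nz.
have E24 : g 2 4 = 11%:R / ((s - 1) ^+ 2 * (3%:R * s - 2%:R) * (4%:R * s - 3%:R) * (5%:R * s -
  2%:R) * (7%:R * s - 8%:R)).
  apply: (mulIf (s_lin (a := 9) 6 isT)).
  rewrite [LHS](E 2 4 isT isT : _ = 0 + 2%:R * g 2 3).
  rewrite E23; field; nz.
have E25 : g 2 5 = 11%:R / 2%:R / ((s - 1) ^+ 2 * (3%:R * s - 2%:R) * (4%:R * s - 3%:R) * (5%:R *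
  s - 1) * (5%:R * s - 2%:R) * (7%:R * s - 8%:R)).
  apply: (mulIf (s_lin (a := 10) 2 isT)).
  rewrite [LHS](E 2 5 isT isT : _ = 0 + 1%:R * g 2 4).
  rewrite E24; field; nz.
have E30 : g 3 0 = 1 / (s * (3%:R * s - 2%:R) * (5%:R * s - 2%:R)).
  apply: (mulIf (s_lin (a := 6) 0 isT)).
  rewrite [LHS](E 3 0 isT isT : _ = 1%:R * g 2 0 + 0).
  rewrite E20; field; nz.
have E31 : g 3 1 = (62%:R / 7%:R * s ^+ 2 - 75%:R / 7%:R * s + 24%:R / 7%:R) / (s * (s - 1) ^+ 2 *
  (3%:R * s - 2%:R) * (4%:R * s - 3%:R) * (5%:R * s - 2%:R)).
  apply: (mulIf (s_lin (a := 7) 7 isT)).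
  rewrite [LHS](E 3 1 isT isT : _ = 1%:R * g 2 1 + 8%:R * g 3 0).
  rewrite E21 E30; field; nz.
have E32 : g 3 2 = (283%:R / 2%:R * s ^+ 3 - 1241%:R / 4%:R * s ^+ 2 + 214%:R * s - 48%:R) / (s *
  (s - 1) ^+ 2 * (2%:R * s - 3%:R) * (3%:R * s - 2%:R) * (4%:R * s - 3%:R) * (5%:R * s - 2%:R) *
  (7%:R * s - 8%:R)).
  apply: (mulIf (s_lin (a := 8) 12 isT)).
  rewrite [LHS](E 3 2 isT isT : _ = 1%:R * g 2 2 + 7%:R * g 3 1).
  rewrite E22 E31; field; nz.
have E33 : g 3 3 = (316%:R * s ^+ 3 - 692%:R * s ^+ 2 + 461%:R * s - 96%:R) / (s * (s - 1) ^+ 2 *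
  (2%:R * s - 3%:R) * (3%:R * s - 2%:R) * (3%:R * s - 5%:R) * (4%:R * s - 3%:R) * (5%:R * s -
  2%:R) * (7%:R * s - 8%:R)).
  apply: (mulIf (s_lin (a := 9) 15 isT)).
  rewrite [LHS](E 3 3 isT isT : _ = 1%:R * g 2 3 + 6%:R * g 3 2).
  rewrite E23 E32; field; nz.
have E34 : g 3 4 = (823%:R * s ^+ 3 - 3669%:R / 2%:R * s ^+ 2 + 1235%:R * s - 240%:R) / (s * (s -
  1) ^+ 2 * (2%:R * s - 3%:R) * (3%:R * s - 2%:R) * (3%:R * s - 5%:R) * (4%:R * s - 3%:R) * (5%:R
  * s - 2%:R) * (5%:R * s - 8%:R) * (7%:R * s - 8%:R)).
  apply: (mulIf (s_lin (a := 10) 16 isT)).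
  rewrite [LHS](E 3 4 isT isT : _ = 1%:R * g 2 4 + 5%:R * g 3 3).
  rewrite E24 E33; field; nz.
have E35 : g 3 5 = (16625%:R * s ^+ 4 - 81537%:R / 2%:R * s ^+ 3 + 66573%:R / 2%:R * s ^+ 2 -
  10400%:R * s + 960%:R) / (s * (s - 1) ^+ 2 * (2%:R * s - 3%:R) * (3%:R * s - 2%:R) * (3%:R * s -
  5%:R) * (4%:R * s - 3%:R) * (5%:R * s - 1) * (5%:R * s - 2%:R) * (5%:R * s - 8%:R) * (7%:R * s -
  8%:R) * (11%:R * s - 15%:R)).
  apply: (mulIf (s_lin (a := 11) 15 isT)).
  rewrite [LHS](E 3 5 isT isT : _ = 1%:R * g 2 5 + 4%:R * g 3 4).
  rewrite E25 E34; field; nz.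
have E36 : g 3 6 = (16625%:R / 4%:R * s ^+ 4 - 81537%:R / 8%:R * s ^+ 3 + 66573%:R / 8%:R * s ^+ 2
  - 2600%:R * s + 240%:R) / (s * (s - 1) ^+ 3 * (2%:R * s - 3%:R) * (3%:R * s - 2%:R) * (3%:R * s
  - 5%:R) * (4%:R * s - 3%:R) * (5%:R * s - 1) * (5%:R * s - 2%:R) * (5%:R * s - 8%:R) * (7%:R * s
  - 8%:R) * (11%:R * s - 15%:R)).
  apply: (mulIf (s_lin (a := 12) 12 isT)).
  rewrite [LHS](E 3 6 isT isT : _ = 0 + 3%:R * g 3 5).
  rewrite E35; field; nz.
have E37 : g 3 7 = (16625%:R / 2%:R * s ^+ 4 - 81537%:R / 4%:R * s ^+ 3 + 66573%:R / 4%:R * s ^+ 2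
  - 5200%:R * s + 480%:R) / (s * (s - 1) ^+ 3 * (2%:R * s - 3%:R) * (3%:R * s - 2%:R) * (3%:R * s
  - 5%:R) * (4%:R * s - 3%:R) * (5%:R * s - 1) * (5%:R * s - 2%:R) * (5%:R * s - 8%:R) * (7%:R * s
  - 8%:R) * (11%:R * s - 15%:R) * (13%:R * s - 7%:R)).
  apply: (mulIf (s_lin (a := 13) 7 isT)).
  rewrite [LHS](E 3 7 isT isT : _ = 0 + 2%:R * g 3 6).
  rewrite E36; field; nz.
have E38 : g 3 8 = (2375%:R / 4%:R * s ^+ 4 - 81537%:R / 56%:R * s ^+ 3 + 66573%:R / 56%:R * s ^+
  2 - 2600%:R / 7%:R * s + 240%:R / 7%:R) / (s ^+ 2 * (s - 1) ^+ 3 * (2%:R * s - 3%:R) * (3%:R * s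
  - 2%:R) * (3%:R * s - 5%:R) * (4%:R * s - 3%:R) * (5%:R * s - 1) * (5%:R * s - 2%:R) * (5%:R * s
  - 8%:R) * (7%:R * s - 8%:R) * (11%:R * s - 15%:R) * (13%:R * s - 7%:R)).
  apply: (mulIf (s_lin (a := 14) 0 isT)).
  rewrite [LHS](E 3 8 isT isT : _ = 0 + 1%:R * g 3 7).
  rewrite E37; field; nz.
exact: E38.
Qed.

Local Notation gfree a := (top s (fun=> 0%N) (fun=> 0%N) (a, 0%N)).

Lemma top_free : gfree 3 = 1 / (s * (s - 1) * (s - 2%:R)).
Proof.
have E a aS a0 := topE F0 (fun=> leq0n 8) pole_free_neq0 (a := a) (b := 0) aS a0.
have n0 : s != 0 by have := s_lin (a := 1) 0 isT; rewrite mul1r subr0.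
have n1 : s - 1 != 0 by have := s_lin (a := 1) 1 isT; rewrite mul1r.
have n2 : s - 2%:R != 0 by have := s_lin (a := 1) 2 isT; rewrite mul1r.
have E1 : gfree 1 = 3%:R / (s - 2%:R).
  apply: (mulIf (s_lin (a := 1) 2 isT)).
  by rewrite [LHS](E 1 isT isT : _ = 3%:R * gfree 0 + 0) top0; field.
have E2 : gfree 2 = 3%:R / ((s - 1) * (s - 2%:R)).
  apply: (mulIf (s_lin (a := 2) 2 isT)).
  by rewrite [LHS](E 2 isT isT : _ = 2%:R * gfree 1 + 0) E1; field; rewrite n2.
apply: (mulIf (s_lin (a := 3) 0 isT)).
rewrite [LHS](E 3 isT isT : _ = 1%:R * gfree 2 + 0) E2; field.
by rewrite n0 n1 n2.
Qed.

Lemma top_product : gfree 3 * g 3 8 =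
    ((33250%:R * s ^+ 4 - 81537%:R * s ^+ 3 + 66573%:R * s ^+ 2
       - 20800%:R * s + 1920%:R) / 56%:R)
     / (s ^+ 3 * (s - 1) ^+ 4 * (s - 2%:R) * (3%:R * s - 2%:R)
        * (4%:R * s - 3%:R) * (5%:R * s - 1) * (5%:R * s - 2%:R)
        * (7%:R * s - 8%:R) * (2%:R * s - 3%:R) * (3%:R * s - 5%:R)
        * (5%:R * s - 8%:R) * (11%:R * s - 15%:R) * (13%:R * s - 7%:R)).
Proof.
have n10 : s != 0 by have := s_lin (a := 1) 0 isT; rewrite mul1r subr0.
have n1_1 : s - 1 != 0 by have := s_lin (a := 1) 1 isT; rewrite ?mul1r.
have n2_3 : 2%:R * s - 3%:R != 0 by have := s_lin (a := 2) 3 isT; rewrite ?mul1r.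
have n3_2 : 3%:R * s - 2%:R != 0 by have := s_lin (a := 3) 2 isT; rewrite ?mul1r.
have n3_5 : 3%:R * s - 5%:R != 0 by have := s_lin (a := 3) 5 isT; rewrite ?mul1r.
have n4_3 : 4%:R * s - 3%:R != 0 by have := s_lin (a := 4) 3 isT; rewrite ?mul1r.
have n5_1 : 5%:R * s - 1 != 0 by have := s_lin (a := 5) 1 isT; rewrite ?mul1r.
have n5_2 : 5%:R * s - 2%:R != 0 by have := s_lin (a := 5) 2 isT; rewrite ?mul1r.
have n5_8 : 5%:R * s - 8%:R != 0 by have := s_lin (a := 5) 8 isT; rewrite ?mul1r.
have n7_8 : 7%:R * s - 8%:R != 0 by have := s_lin (a := 7) 8 isT; rewrite ?mul1r.
have n11_15 : 11%:R * s - 15%:R != 0 by have := s_lin (a := 11) 15 isT; rewrite ?mul1r.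
have n13_7 : 13%:R * s - 7%:R != 0 by have := s_lin (a := 13) 7 isT; rewrite ?mul1r.
have n1_2 : s - 2%:R != 0 by have := s_lin (a := 1) 2 isT; rewrite mul1r.
rewrite top_free top_bracket; field; nz.
Qed.
End Top.

(** * Expansion at q = 1 *)

Lemma svar_lin (a b : nat) : (0 < a)%N -> a%:R * svar - b%:R != 0.
Proof.
move=> a0; rewrite /svar -!(rmorph_nat (@FracField.tofrac {poly rat})) -rmorphM -rmorphB /=.
rewrite tofrac_eq0; apply/eqP => /(congr1 (fun p : {poly rat} => p`_1)) /eqP.
by rewrite coefB -!polyC_natr coefCM coefX coefC subr0 mulr1 coef0 pnatr_eq0 -leqn0 leqNgt a0.
Qed.

Lemma Qs_char0 : [pchar Qs] =i pred0.
Proof.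
apply/pcharf0P => n; rewrite -(rmorph_nat (@FracField.tofrac {poly rat})) tofrac_eq0.
by rewrite -polyC_natr polyC_eq0 pnatr_eq0.
Qed.

Lemma laurent_char0 (F : fieldType) : [pchar F] =i pred0 -> [pchar {fraction fps F}] =i pred0.
Proof.
move=> F0; have lead_nat n : lead (n%:R : {fraction fps F}) 0 n%:R.
  elim: n => [|n IHn]; first exact: lead0.
  by rewrite -!natr1; apply: leadD (lead1 _).
apply/pcharf0P => -[|n]; first by rewrite !eqxx.
by apply/negbTE/(lead_neq0 (lead_nat n.+1)); rewrite natr_char0_eq0.
Qed.

Lemma near1_q : near1 (FracField.tofrac q_series) 1.
Proof.
have := @near1_series _ q_series; rewrite -[q_series 0%N]/(1 + 0 : Qs) addr0.
by rewrite -[q_series 1%N]/(0 + 1 : Qs) add0r; apply.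
Qed.

Lemma near1_q_pow : near1 (FracField.tofrac q_pow_Ns_series) (- svar).
Proof.
have := @near1_series _ q_pow_Ns_series.
rewrite -[q_pow_Ns_series 0%N]/(gbinom _ _) -[q_pow_Ns_series 1%N]/(gbinom _ _).
by rewrite /gbinom big_ord0 big_ord1 subr0 !divr1; apply.
Qed.

Theorem corollary1p4 (R : realType) (W : {fraction {poly {poly rat}}})
  (W_zeta : forall (p : nat) (p_pr : prime p) (K : fieldExtType (padic p_pr)),
     let o := ring_of_integers K in
     let q := residue_card o in
     exists s0 : R, forall s : R[i], s0 < complex.Re s ->
       exists2 z : R[i],
         rat_value W q%:R (natpow q (- s)) z &
         graded_ideal_zeta (free_nilpotent_over 3 3 o) 3 s z) :
  let s := svar in
  expansion_coef W (- 14)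
    (((33250%:R * s ^+ 4 - 81537%:R * s ^+ 3 + 66573%:R * s ^+ 2
       - 20800%:R * s + 1920%:R) / 56%:R)
     / (s ^+ 3 * (s - 1) ^+ 4 * (s - 2%:R) * (3%:R * s - 2%:R)
        * (4%:R * s - 3%:R) * (5%:R * s - 1) * (5%:R * s - 2%:R)
        * (7%:R * s - 8%:R) * (2%:R * s - 3%:R) * (3%:R * s - 5%:R)
        * (5%:R * s - 8%:R) * (11%:R * s - 15%:R) * (13%:R * s - 7%:R))).
Proof.
move=> s; rewrite (graded_zeta_unique W_zeta).
have [q1 y1] := (near1_q, near1_q_pow); have Q0 := Qs_char0.
have fP := pole_free_neq0 svar_lin; have bP := pole_bracket_neq0 svar_lin.
set x := FracField.tofrac _ in q1; set y := FracField.tofrac _ in y1.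
exists (zeta_rat x y).
  apply: rat_value_zeta; first exact: laurent_char0.
    exact: (near1_regular Q0 q1 y1 (fun=> leq0n 8) fP).
  exact: (near1_regular Q0 q1 y1 corank_bracket_le8 bP).
apply: (@lead_coef _ _ 14).
have l1 := lead_solve_sum Q0 q1 y1 (fun=> leq0n 8) fP (fun _ _ => leqnn 0).
have l2 := lead_solve_sum Q0 q1 y1 corank_bracket_le8 bP.
have := leadM l1 (l2 _); rewrite (top_product Qs_char0 svar_lin); apply.
by case=> [|[|[|[|r]]]].
Qed.
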